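(* There exists an absolute constant $\kappa>0$ such that the following holds for every $d\in\mathbb{Z}_+$, $\sigma\ge0$, $b\ge 0$ and $\eta$ with $4/\sqrt d\le\eta\le 1$. For every (possibly randomized) algorithm $\mathcal{A}$ that takes as input $\eta,\sigma,b$ and $n$ labeled examples in $(\mathbb{R}\cup\{\perp\})^d\times(\mathbb{R}\cup\{\perp\})$ and outputs $\hat\beta\in\mathbb{R}^d$, there exist $\beta\in\mathbb{R}^d$ with $\|\beta\|=b$ and an adversary as in the coordinate-wise missing data model such that, when $\mathcal{A}$ is run on $\eta,\sigma,b$ and the $\eta$-coordinate-wise incomplete version of $n$ i.i.d. samples from the linear regression model with regressor $\beta$ and noise level $\sigma$, its output satisfies $$\|\hat\beta-\beta\|\ \ge\ \tfrac{1}{\sqrt2}\,\|\beta\|$$ with probability at least $\tfrac12\big(1-(d+1)e^{-\kappa\eta n}\big)$.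
   Context: Linear regression model with regressor $\beta\in\mathbb{R}^d$ and noise level $\sigma\ge 0$: a labeled example $(X,y)$ with $X\sim\mathcal{N}(0,I_d)$ and $y=\beta^\top X+\xi$, where $\xi\sim\mathcal{N}(0,\sigma^2)$ is independent of $X$ ($\xi=0$ if $\sigma=0$). Coordinate-wise missing data model with rate $\eta\in[0,1]$: given a set $S=\{(X^{(i)},y^{(i)})\}_{i\in[n]}$ of $n$ i.i.d. labeled examples, an adversary (possibly randomized) inspects all of $S$ and, for each coordinate $j\in[d]$, may replace the $j$-th coordinate of at most $\eta n$ of the vectors $X^{(i)}$ by the symbol $\perp$, and may replace at most $\eta n$ of the labels $y^{(i)}$ by $\perp$; the resulting dataset is given to the algorithm. Probabilities are over the samples and the randomness of the adversary and the algorithm. *)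

(* Defs.v *)
From HB Require Import structures.
From mathcomp Require Import all_boot all_order all_algebra.
From mathcomp Require Import all_classical all_reals all_analysis.
From mathcomp Require Import normal_distribution.

Set Implicit Arguments.
Unset Strict Implicit.
Unset Printing Implicit Defensive.

Import Order.TTheory GRing.Theory Num.Theory.
Local Open Scope classical_set_scope.
Local Open Scope ring_scope.

Section defs.
Variables (R : realType) (n d : nat).

Definition vnorm (v : 'I_d -> R) : R := Num.sqrt (\sum_(j < d) v j ^+ 2).

Definition maskv (m : bool) (x : R) : option R := if m then None else Some x.

(* A (randomized) algorithm: from a random seed in R, the parameters
   eta, sigma, b, and n labeled examples in (R ∪ {⊥})^d × (R ∪ {⊥}),
   outputs an estimate in R^d. *)
Definition algorithm : Type :=
  R -> R -> R -> R -> ('I_n -> 'I_d -> option R) -> ('I_n -> option R) ->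
  ('I_d -> R).

(* The algorithm is (Borel-)measurable jointly in the seed and the observed
   real entries, for every fixed missingness pattern (and fixed parameters). *)
Definition alg_measurable (A : algorithm) : Prop :=
  forall (dT : measure_display) (T : measurableType dT)
    (u : T -> R) (x : T -> 'I_n -> 'I_d -> R) (y : T -> 'I_n -> R)
    (eta sigma b : R) (mX : 'I_n -> 'I_d -> bool) (my : 'I_n -> bool),
    measurable_fun setT u ->
    (forall i j, measurable_fun setT (fun t => x t i j)) ->
    (forall i, measurable_fun setT (fun t => y t i)) ->
    forall k, measurable_fun setT (fun t =>
      A (u t) eta sigma b (fun i j => maskv (mX i j) (x t i j))
        (fun i => maskv (my i) (y t i)) k).

(* A (randomized) adversary: from a random seed and the complete data set,
   chooses which covariate entries (mask.1 i j = true) and which labels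
   (mask.2 i = true) are replaced by ⊥. *)
Definition adversary : Type :=
  R -> ('I_n -> 'I_d -> R) -> ('I_n -> R) ->
  ('I_n -> 'I_d -> bool) * ('I_n -> bool).

Definition adv_budget (eta : R) (Adv : adversary) : Prop :=
  forall s x y,
    (forall j : 'I_d, #|[set i : 'I_n | (Adv s x y).1 i j]|%:R <= eta * n%:R) /\
    #|[set i : 'I_n | (Adv s x y).2 i]|%:R <= eta * n%:R.

Definition adv_measurable (Adv : adversary) : Prop :=
  forall (dT : measure_display) (T : measurableType dT)
    (v : T -> R) (x : T -> 'I_n -> 'I_d -> R) (y : T -> 'I_n -> R),
    measurable_fun setT v ->
    (forall i j, measurable_fun setT (fun t => x t i j)) ->
    (forall i, measurable_fun setT (fun t => y t i)) ->
    (forall i j, measurable [set t | (Adv (v t) (x t) (y t)).1 i j]) /\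
    (forall i, measurable [set t | (Adv (v t) (x t) (y t)).2 i]).

(* Index set of all the elementary random variables: covariate entries,
   standardized noises, the algorithm's seed (true), the adversary's seed
   (false). *)
Definition ridx : finType := (('I_n * 'I_d) + 'I_n + bool)%type.

Definition rfamily (T : Type) (ZX : 'I_n -> 'I_d -> T -> R) (Zxi : 'I_n -> T -> R)
  (U V : T -> R) : ridx -> T -> R :=
  fun k => match k with
           | inl (inl ij) => ZX ij.1 ij.2
           | inl (inr i) => Zxi i
           | inr true => U
           | inr false => V
           end.
End defs.

Local Open Scope ereal_scope.

Definition mutually_independent (R : realType) (dO : measure_display)
  (Om : measurableType dO) (P : probability Om R) (I : finType)
  (W : I -> Om -> R) : Prop :=
  forall B : I -> set R, (forall i, measurable (B i)) ->
    P (\bigcap_(i in [set: I]) (W i @^-1` B i)) =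
    \big[*%E/1%E]_(i : I) P (W i @^-1` B i).

Definition has_distribution (R : realType) (dO : measure_display)
  (Om : measurableType dO) (P : probability Om R) (X : Om -> R)
  (mu : set R -> \bar R) : Prop :=
  measurable_fun setT X /\
  forall B : set R, measurable B -> P (X @^-1` B) = mu B.

(* Main.v *)
Require Import Defs.
From HB Require Import structures.
From mathcomp Require Import all_boot all_order all_algebra.
From mathcomp Require Import all_classical all_reals all_analysis.
From mathcomp Require Import normal_distribution measurable_realfun.
From mathcomp Require Import ring lra.

Import Order.TTheory GRing.Theory Num.Theory.
Import numFieldNormedType.Exports.
Local Open Scope classical_set_scope.
Local Open Scope ring_scope.

Set Implicit Arguments.
Unset Strict Implicit.
Unset Printing Implicit Defensive.

(* The regressors [+v] and [-v], with [v = (b / sqrt d) (1, .., 1)], are confused.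
   The labels depend on a sample only through the sum [S] of its coordinates (and
   the noise), so it suffices to turn [S] into [- S] while preserving the Gaussian
   law. With one exponential coin per coordinate this is done by a
   measure-preserving involution which processes the coordinates one at a time:
   each is kept with the largest probability allowed by the two conditional
   densities and otherwise reflected, the rest of the shift being passed on. The
   expected number of moved coordinates is at most [3 sqrt d]; the set of moved
   coordinates and the values of the others are invariant under the involution, so
   erasing the moved coordinates makes the two data sets identical. A cyclic shift
   of the coordinates, fixed for each sample by averaging, makes every column be
   erased at rate at most [(3 / 4) eta], and a Chernoff bound keeps all columns
   within the budget up to probability [d exp (- eta n / 100)]. Then one of the two
   errors is large with probability at least [(1 - d exp (- eta n / 100)) / 2]. *)

(** * Integration lemmas *)

(** A moved coordinate travels a distance of order one, while the shift to be absorbed, twice the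
    sum, is of order [sqrt d]; about [sqrt d] moves are thus to be expected, and this is the scale
    behind [4 / sqrt d <= eta]. The adversary sees one data set only and must erase the same entries
    whichever regressor produced it. A mere coupling of two conditional laws gives no such symmetric
    rule; an involution on samples enlarged by coins does. The coins are exponential because a
    change [t] of the Gaussian exponent is then compensated exactly by lowering the coin by [t]:
    each branch of the step is a volume-preserving map that fixes the joint density. No conditional
    law is ever formed. An orthogonal change of variables turns the normalised sum into a free
    Gaussian variable [r], on which the involution acts as [r] to [- r]. Counting the moves is a
    recursion on the dimension: the shift left to the tail is affine in a mean-zero jump, so its
    second moment can be followed coordinate by coordinate. *)

Section integral_tools.
Local Open Scope ereal_scope.

Import HBNNSimple.

Lemma ge0_integral_density d (T : measurableType d) (R : realType)
    (nu mu : {measure set T -> \bar R}) (g : T -> R) (f : T -> \bar R) :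
  measurable_fun setT g -> (forall x, 0 <= g x)%R ->
  (forall A, measurable A -> nu A = \int[mu]_(x in A) (g x)%:E) ->
  measurable_fun setT f -> (forall x, 0 <= f x) ->
  \int[nu]_x f x = \int[mu]_x (f x * (g x)%:E).
Proof.
move=> mg g0 nuE mf f0.
have mgE : measurable_fun setT (EFin \o g) by exact/measurable_EFinP.
pose h := nnsfun_approx measurableT mf.
have -> : \int[nu]_x f x = limn (fun n => \int[nu]_x (h n x)%:E).
  rewrite -monotone_convergence//.
  - apply: eq_integral => x _; apply/esym/cvg_lim => //.
    exact: cvg_nnsfun_approx.
  - by move=> n; exact/measurable_EFinP/measurable_funP.
  - by move=> n x _; rewrite lee_fin.
  - by move=> x _ a b ab; rewrite lee_fin; exact/lefP/nd_nnsfun_approx.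
have -> : \int[mu]_x (f x * (g x)%:E) =
    limn (fun n => \int[mu]_x ((h n x)%:E * (g x)%:E)).
  rewrite -monotone_convergence//.
  - apply: eq_integral => x _; apply/esym/cvg_lim => //.
    by apply: cvgeZr => //; exact: cvg_nnsfun_approx.
  - by move=> n; apply: emeasurable_funM => //; exact/measurable_EFinP/measurable_funP.
  - by move=> n x _; rewrite mule_ge0 ?lee_fin.
  - by move=> x _ a b ab; rewrite lee_wpmul2r ?lee_fin//; exact/lefP/nd_nnsfun_approx.
congr (limn _); apply/funext => n.
transitivity (\int[nu]_x
   (\sum_(y \in range (h n)) (y * \1_(h n @^-1` [set y]) x)%:E)).
  by apply: eq_integral => t _; rewrite /= fimfunE -fsumEFin.
have indich r : measurable_fun setT (fun x => (r * \1_(h n @^-1` [set r]) x)%:E).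
  by apply: measurableT_comp => //; exact: measurable_funM.
rewrite ge0_integral_fsum//; last by move=> m y _; exact: nnfun_muleindic_ge0.
transitivity (\int[mu]_x (\sum_(y \in range (h n))
    (y * \1_(h n @^-1` [set y]) x)%:E * (g x)%:E)); last first.
  apply: eq_integral => x _.
  rewrite -ge0_mule_fsuml => [|y]; last exact: nnfun_muleindic_ge0.
  by rewrite fsumEFin // -(fimfunE _ x).
rewrite ge0_integral_fsum//; last 2 first.
  - by move=> y; apply: emeasurable_funM.
  - move=> m y _; rewrite mule_ge0 ?lee_fin//.
    by rewrite -lee_fin EFinM; exact: nnfun_muleindic_ge0.
apply: eq_fsbigr => r rhn.
have r0 : (0 <= r)%R by move: rhn; rewrite inE => -[x _ <-].
have mhr : measurable (h n @^-1` [set r]).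
  by rewrite -[X in measurable X]setTI; exact: measurable_funP.
under eq_integral do rewrite EFinM.
rewrite integralZl_indic_nnsfun//= integral_indic// setIT nuE//.
under [RHS]eq_integral do rewrite EFinM -muleA.
rewrite ge0_integralZl//; first last.
- by move=> x _; rewrite mule_ge0 ?lee_fin.
- apply: emeasurable_funM => //; apply/measurable_EFinP.
  exact: measurable_indic.
congr (_ * _); rewrite integral_mkcond; apply: eq_integral => x _.
by rewrite patchE indicE; case: ifPn => xh; rewrite ?mul1e ?mul0e.
Qed.

End integral_tools.

Section lebesgue_affine.
Local Open Scope ereal_scope.
Variable R : realType.
Local Notation mu := (@lebesgue_measure R).

(** The image of Lebesgue measure under the affine map, scaled by [b], gives each half-open interval
    its length, so uniqueness of Lebesgue measure identifies the two. *)
Lemma ge0_integral_affine (b c : R) (f : R -> \bar R) : (0 < b)%R ->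
  measurable_fun setT f -> (forall x, 0 <= f x) ->
  \int[mu]_x f x = b%:E * \int[mu]_x f (b * x + c)%R.
Proof.
move=> b0 mf f0.
pose aff := (fun x => b * x + c)%R : measurableTypeR R -> measurableTypeR R.
have maff : measurable_fun setT aff.
  by apply: measurable_funD => //; exact: measurable_funM.
pose nu : {measure set (measurableTypeR R) -> \bar R} :=
  measure_function_pushforward__canonical__measure_function_Measure mu maff.
transitivity (\int[mscale (NngNum (ltW b0)) nu]_x f x).
  apply: eq_measure_integral => A mA _.
  apply: (@lebesgue_measure_unique R (mscale (NngNum (ltW b0)) nu)) => //.
  move=> _ [[u v]] /= _ <-.
  have affE : aff @^-1` `]u, v]%classic = `]((u - c) / b)%R, ((v - c) / b)%R]%classic.
    apply/seteqP; split => x /=; rewrite !in_itv/= => /andP[ux xv]; apply/andP;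
      move: ux xv; rewrite /aff ltr_pdivrMr// ler_pdivlMr// => ux xv;
      split; lra.
  rewrite /mscale/= /pushforward affE !lebesgue_measure_itv/= !lte_fin.
  rewrite ltr_pM2r ?invr_gt0// ltrD2r; case: ifPn => uv; last by rewrite mule0.
  by rewrite -!EFinB -EFinM; congr EFin; field; rewrite gt_eqF.
rewrite ge0_integral_mscale//; congr (_ * _).
by rewrite ge0_integral_pushforward.
Qed.

Lemma ge0_integral_shift (c : R) (f : R -> \bar R) :
  measurable_fun setT f -> (forall x, 0 <= f x) ->
  \int[mu]_x f (x + c)%R = \int[mu]_x f x.
Proof.
move=> mf f0; rewrite [RHS](ge0_integral_affine c ltr01)// mul1e.
by apply: eq_integral => x _; rewrite mul1r.
Qed.

Lemma ge0_integral_opp (f : R -> \bar R) :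
  measurable_fun setT f -> (forall x, 0 <= f x) ->
  \int[mu]_x f (- x)%R = \int[mu]_x f x.
Proof.
move=> mf f0.
have mopp : measurable_fun setT (-%R : measurableTypeR R -> measurableTypeR R).
  exact: oppr_measurable.
pose nu : {measure set (measurableTypeR R) -> \bar R} :=
  measure_function_pushforward__canonical__measure_function_Measure mu mopp.
transitivity (\int[nu]_x f x); first by rewrite ge0_integral_pushforward.
by apply: eq_measure_integral => // A mA _; exact: lebesgue_measureN.
Qed.

End lebesgue_affine.

Section iterated_integrals.
Local Open Scope ereal_scope.
Context d1 d2 (T1 : measurableType d1) (T2 : measurableType d2) (R : realType).

Lemma measurable_integral2 (m : {sigma_finite_measure set T2 -> \bar R})
    (f : T1 * T2 -> \bar R) :
  measurable_fun setT f -> (forall p, 0 <= f p) ->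
  measurable_fun setT (fun x => \int[m]_y f (x, y)).
Proof. by move=> mf f0; exact: (measurable_fun_fubini_tonelli_F f). Qed.

End iterated_integrals.

(** Directed by the head symbol of the body. Measurability facts found in the context extend its
    reach, which is why proofs introduce such facts with [have] before calling [mfun]. *)
Ltac mstep := lazymatch goal with
  | |- measurable_fun _ (fun _ => ?c) => exact: measurable_cst
  | |- measurable_fun _ (fun x => x) => exact: measurable_id
  | |- measurable_fun _ (fun x => if _ then _ else _) =>
      apply: measurable_fun_ifT
  | |- measurable_fun _ (fun x => @?f x && @?g x) => apply: measurable_and
  | |- measurable_fun _ (fun x => ~~ @?f x) => apply: measurable_neg
  | |- measurable_fun _ (fun x => (@?f x <= @?g x)%R) =>
      apply: measurable_fun_ler
  | |- measurable_fun _ (fun x => (@?f x < @?g x)%R) =>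
      apply: measurable_fun_ltr
  | |- measurable_fun _ (fun x => (@?f x + @?g x)%E) =>
      apply: emeasurable_funD
  | |- measurable_fun _ (fun x => (@?f x * @?g x)%E) =>
      apply: emeasurable_funM
  | |- measurable_fun _ (fun x => (@?f x - @?g x)%R) =>
      apply: measurable_funB
  | |- measurable_fun _ (fun x => (@?f x + @?g x)%R) =>
      first [apply: measurable_funD | apply: emeasurable_funD]
  | |- measurable_fun _ (fun x => (@?f x * @?g x)%R) =>
      apply: measurable_funM
  | |- measurable_fun _ (fun x => (- @?f x)%R) =>
      apply: (measurableT_comp (@oppr_measurable _ _))
  | |- measurable_fun _ (fun x => (@?f x ^+ _)%R) =>
      apply: measurable_funX
  | |- measurable_fun _ (fun x => (@?f x)%:E) => apply/measurable_EFinP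
  | |- measurable_fun _ (fun x => (@?f x, @?g x)) =>
      apply: (@measurable_fun_pair _ _ _ _ _ _ f g)
  | |- measurable_fun _ (fun x => (@?f x).1) =>
      apply: (@measurableT_comp _ _ _ _ _ _ fst _ f measurable_fst)
  | |- measurable_fun _ (fun x => (@?f x).2) =>
      apply: (@measurableT_comp _ _ _ _ _ _ snd _ f measurable_snd)
  | |- measurable_fun _ (fun x => expR (@?f x)) =>
      apply: (@measurableT_comp _ _ _ _ _ _ _ _ f (@measurable_expR _))
  | H : measurable_fun _ ?f |- measurable_fun _ (fun x => ?f (@?g x)) =>
      apply: (@measurableT_comp _ _ _ _ _ _ f _ g H)
  | H : measurable_fun _ ?f |- measurable_fun _ ?f => exact: H
  | |- measurable_fun _ (Order.le ?a) =>
      apply: (@measurable_fun_ler _ _ _ _ (fun=> a) (fun x => x))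
  | |- measurable_fun _ (Order.lt ?a) =>
      apply: (@measurable_fun_ltr _ _ _ _ (fun=> a) (fun x => x))
  | |- measurable_fun _ (GRing.add ?a) =>
      apply: (@measurable_funD _ _ _ _ (fun=> a) (fun x => x))
  | |- measurable_fun _ (GRing.mul ?a) =>
      apply: (@measurable_funM _ _ _ _ (fun=> a) (fun x => x))
  | |- measurable_fun _ fst => exact: measurable_fst
  | |- measurable_fun _ snd => exact: measurable_snd
  end; cbn beta.
Ltac mfun := cbn beta; repeat mstep.

(** * Gaussian rotations and the one-coordinate step *)

Section gauss.
Variable R : realType.
Implicit Types (a b g z c x r t : R).
Local Notation mu := (@lebesgue_measure R).

(* [R] and [measurableTypeR R] are distinct (though convertible on sets)
   instances of [measurableType]; this moves a law from the latter to the former. *)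
Lemma measurable_to_real : measurable_fun setT (idfun : measurableTypeR R -> R).
Proof. by move=> _ Y mY; rewrite setTI. Qed.

Definition to_real : {mfun measurableTypeR R >-> R} :=
  HB.pack (idfun : measurableTypeR R -> R)
    (isMeasurableFun.Build _ _ _ _ _ measurable_to_real).

Definition std_normal : probability R R :=
  distribution (normal_prob 0 1 : probability (measurableTypeR R) R) to_real.

Definition coin_law : probability R R := distribution
  (exponential_distribution_exponential_prob__canonical__probability_measure_Probability
    (@ltr01 R) : probability (measurableTypeR R) R) to_real.

Local Notation N := std_normal.
Local Notation C := coin_law.
Local Notation phi0 := (normal_peak (1 : R)).

Definition phi x : R := phi0 * expR (- (x ^+ 2 / 2)).

Lemma phiE x : normal_pdf 0 1 x = phi x.
Proof.
rewrite normal_pdfE ?oner_eq0// /phi /normal_fun; congr (_ * expR _).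
by rewrite subr0 expr1n mulr2n mulNr.
Qed.

Lemma phi_ge0 x : 0 <= phi x.
Proof. by rewrite -phiE normal_pdf_ge0. Qed.

Lemma measurable_phi : measurable_fun setT phi.
Proof.
rewrite (_ : phi = normal_pdf 0 1); first exact: measurable_normal_pdf.
by apply/funext => x; rewrite phiE.
Qed.

Definition psi c : R := if 0 <= c then expR (- c) else 0.

Lemma psiE c : exponential_pdf 1 c = psi c.
Proof.
rewrite /psi; case: ifPn => c0.
  by rewrite exponential_pdfE// mul1r mulN1r.
by rewrite lt0_exponential_pdf// ltNge.
Qed.

Lemma psi_ge0 c : 0 <= psi c.
Proof. by rewrite /psi; case: ifP => // _; exact: expR_ge0. Qed.

Lemma measurable_psi : measurable_fun setT psi.
Proof. rewrite /psi. mfun. Qed.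


Local Open Scope ereal_scope.

Lemma integral_normalE (f : R -> \bar R) :
  measurable_fun setT f -> (forall x, 0 <= f x) ->
  \int[N]_x f x = \int[mu]_x (f x * (phi x)%:E).
Proof.
move=> mf f0; rewrite ge0_integral_distribution//.
apply: ge0_integral_density => //; [exact: measurable_phi|exact: phi_ge0|].
by move=> A mA; apply: eq_integral => x _; rewrite phiE.
Qed.

Lemma integral_coinE (f : R -> \bar R) :
  measurable_fun setT f -> (forall x, 0 <= f x) ->
  \int[C]_x f x = \int[mu]_x (f x * (psi x)%:E).
Proof.
move=> mf f0; rewrite ge0_integral_distribution//.
apply: ge0_integral_density => //; [exact: measurable_psi|exact: psi_ge0|].
by move=> A mA; apply: eq_integral => x _; rewrite psiE.
Qed.

Lemma integral_normal_opp (f : R -> \bar R) :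
  measurable_fun setT f -> (forall x, 0 <= f x) ->
  \int[N]_x f (- x)%R = \int[N]_x f x.
Proof.
have mphi := measurable_phi.
move=> mf f0; rewrite !integral_normalE//; last by mfun.
have mfphi : measurable_fun setT (fun x => f x * (phi x)%:E) by mfun.
have fphi0 x : 0 <= f x * (phi x)%:E by apply: mule_ge0 => //; rewrite lee_fin phi_ge0.
apply: (eq_trans _ (ge0_integral_opp mfphi fphi0)).
by apply: eq_integral => x _; rewrite /phi sqrrN.
Qed.

(** The matrix with rows [(a, b)] and [(b, - a)] is orthogonal. The planar change of variables is
    made of two affine ones on the line, first [z] to [x = a * r + b * z] at fixed [r], then [r] to
    [b * r - a * z] at fixed [x], with an exchange of integrals in between. *)
Lemma integral_normal_rot a b (f : R * R -> \bar R) :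
  (0 < b)%R -> (a ^+ 2 + b ^+ 2 = 1)%R ->
  measurable_fun setT f -> (forall p, 0 <= f p) ->
  \int[N]_r \int[N]_z f (a * r + b * z, b * r - a * z)%R =
  \int[N]_r \int[N]_z f (r, z).
Proof.
move=> b0 ab mf f0.
have bn0 : b != 0%R by rewrite gt_eqF.
(* The integrand in the mixed variables [(r, x)]; the final [/ b] is the Jacobian of the first
   substitution, and the second one gives back [b]. *)
pose K := (fun p : R * R => f (p.2, (p.1 - a * p.2) / b)%R *
   (phi ((p.2 - a * p.1) / b) * phi p.1 / b)%:E).
have K0 p : 0 <= K p.
  apply: mule_ge0 => //; rewrite lee_fin; apply: divr_ge0; last exact: ltW.
  by apply: mulr_ge0; exact: phi_ge0.
have mK : measurable_fun setT K.
  by rewrite /K; have := measurable_phi => mphi; mfun.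
have mphi := measurable_phi.
transitivity (\int[mu]_r \int[mu]_x K (r, x)).
  rewrite integral_normalE; last 2 first.
  - apply: (measurable_integral2 N (f := fun p : R * R => f (a * p.1 + b * p.2, b * p.1 - a * p.2)%R)) => //.
    by mfun.
  - by move=> r; exact: integral_ge0.
  apply: eq_integral => r _; rewrite integral_normalE//; last by mfun.
  rewrite -ge0_integralZr//; last 3 first.
  - by mfun.
  - by move=> x _; rewrite mule_ge0// lee_fin phi_ge0.
  - by rewrite lee_fin phi_ge0.
  rewrite (ge0_integral_affine (a * r) b0); last 2 first.
  - by mfun.
  - by move=> x.
  rewrite -ge0_integralZl//; last 2 first.
  - by mfun.
  - by rewrite lee_fin ltW.
  apply: eq_integral => z _; rewrite /K/= muleCA -EFinM -muleA -EFinM.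
  congr (f (_, _) * _%:E).
  - by rewrite addrC.
  - apply/eqP; rewrite -subr_eq0.
    have -> : (b * r - a * z - (r - a * (b * z + a * r)) / b =
        (a ^+ 2 + b ^+ 2 - 1) * r / b)%R by field.
    by rewrite ab subrr !mul0r.
  - have -> : ((b * z + a * r - a * r) / b = z)%R by field.
    by field.
transitivity (\int[mu]_x \int[mu]_r K (r, x)); first exact: fubini_tonelli.
rewrite [RHS]integral_normalE; last 2 first.
- exact: measurable_integral2.
- by move=> r; exact: integral_ge0.
apply: eq_integral => x _; rewrite integral_normalE//; last by mfun.
rewrite -ge0_integralZr//; last 3 first.
- by mfun.
- by move=> y _; rewrite mule_ge0// lee_fin phi_ge0.
- by rewrite lee_fin phi_ge0.
rewrite (ge0_integral_affine (a * x) b0); last 2 first.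
- by mfun.
- by move=> y.
rewrite -ge0_integralZl//; last 2 first.
- by mfun.
- by rewrite lee_fin ltW.
apply: eq_integral => y _; rewrite /K/= muleCA -EFinM -muleA -EFinM.
congr (f (_, _) * _%:E); first by field.
have -> : ((x - a * (b * y + a * x)) / b = b * x - a * y)%R.
  apply/eqP; rewrite -subr_eq0.
  have -> : ((x - a * (b * y + a * x)) / b - (b * x - a * y) =
      (1 - (a ^+ 2 + b ^+ 2)) * x / b)%R by field.
  by rewrite ab subrr !mul0r.
rewrite mulrCA divff// mulr1 /phi mulrACA [RHS]mulrACA -!expRD.
congr (_ * expR _)%R.
rewrite -!opprD -!mulrDl; congr (- (_ / _))%R.
by rewrite -[in RHS](mul1r (_ + _))%R -ab; ring.
Qed.

(** Passing from [(t, c)] to [(- t, c - t)] exchanges the two inequalities. Requiring both makes the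
    steps below invertible at every point, including the null set of negative coins. *)
Definition accept t c : bool := (0 <= c)%R && (t <= c)%R.

(** Here [t] equals [((z + g)^2 - z^2) / 2], so that [expR (- t)] is the density ratio
    [phi (z + g) / phi z] and acceptance has probability [min 1 (expR (- t))]: the reflection form
    of the maximal coupling of two Gaussians. *)
Definition reflect_step g (p : R * R) : R * R :=
  let t := (g * (p.1 + g / 2))%R in
  if accept t p.2 then (p.1 + g, p.2 - t)%R else (- p.1, p.2)%R.

Lemma measurable_reflect_step g : measurable_fun setT (reflect_step g).
Proof. by rewrite /reflect_step /accept; mfun. Qed.

(* On accepted points the step translates [z] and lowers the coin so as to keep
   [z^2/2 + c], hence the density of [N x Exp(1)], unchanged; rejected points are
   reflected. Both pieces preserve Lebesgue measure. *)
Lemma integral_reflect_step g (H : R * R -> \bar R) :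
  measurable_fun setT H -> (forall p, 0 <= H p) ->
  \int[N]_z \int[C]_c H (reflect_step g (z, c)) = \int[N]_z \int[C]_c H (z, c).
Proof.
move=> mH H0.
have mphi := measurable_phi; have mpsi := measurable_psi.
have lebE (G : R * R -> \bar R) : measurable_fun setT G -> (forall p, 0 <= G p) ->
    \int[N]_z \int[C]_c G (z, c) =
    \int[mu]_z \int[mu]_c (G (z, c) * (psi c * phi z)%:E).
  move=> mG G0; rewrite integral_normalE; last 2 first.
  - exact: measurable_integral2.
  - by move=> r; exact: integral_ge0.
  apply: eq_integral => z _; rewrite integral_coinE//; last by mfun.
  rewrite -ge0_integralZr//; last 3 first.
  - by mfun.
  - by move=> y _; rewrite mule_ge0// lee_fin psi_ge0.
  - by rewrite lee_fin phi_ge0.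
  by apply: eq_integral => c _; rewrite -muleA -EFinM.
have mstep := measurable_reflect_step g.
apply: (eq_trans (lebE (fun p => H (reflect_step g p)) _ _)) => //; first by mfun.
apply: esym; apply: (eq_trans (lebE H mH H0)); apply: esym.
pose t z := (g * (z + g / 2))%R.
pose w (P : bool) z c := (if P then expR (- c) * phi z else 0)%R.
have w0 P z c : (0 <= w P z c)%R.
  by rewrite /w; case: P => //; rewrite mulr_ge0 ?expR_ge0 ?phi_ge0.
pose A := (fun p : R * R => H (p.1 + g, p.2 - t p.1)%R *
   (w (accept (t p.1) p.2) p.1 p.2)%:E).
pose B := (fun p : R * R => H (- p.1, p.2)%R *
   (w ((0 <= p.2)%R && (p.2 < t p.1)%R) p.1 p.2)%:E).
(* The supports of [A'] and [B'] are the images of the accepted and of the rejected region; like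
   these, they partition the half-plane of nonnegative coins. *)
pose A' := (fun p : R * R => H p *
   (w ((0 <= p.2)%R && (t (- p.1) <= p.2)%R) p.1 p.2)%:E).
pose B' := (fun p : R * R => H p *
   (w ((0 <= p.2)%R && (p.2 < t (- p.1))%R) p.1 p.2)%:E).
have [A0 B0 A'0 B'0] : [/\ forall p, 0 <= A p, forall p, 0 <= B p,
    forall p, 0 <= A' p & forall p, 0 <= B' p].
  by split=> p; rewrite mule_ge0// lee_fin.
have mt : measurable_fun setT t by rewrite /t; mfun.
have [mA mB mA' mB'] : [/\ measurable_fun setT A, measurable_fun setT B,
    measurable_fun setT A' & measurable_fun setT B'].
  by split; rewrite /A /B /A' /B' /w /accept; mfun.
have pairm (G : R * R -> \bar R) z : measurable_fun setT G ->
    measurable_fun setT (fun c => G (z, c)).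
  by move=> mG; mfun.
have splitE (G G1 G2 : R * R -> \bar R) :
    (forall p, 0 <= G1 p) -> (forall p, 0 <= G2 p) ->
    measurable_fun setT G1 -> measurable_fun setT G2 ->
    (forall p, G p = G1 p + G2 p) ->
    \int[mu]_z \int[mu]_c G (z, c) =
    \int[mu]_z \int[mu]_c G1 (z, c) + \int[mu]_z \int[mu]_c G2 (z, c).
  move=> G10 G20 mG1 mG2 GE.
  rewrite -ge0_integralD//; last 4 first.
  - by move=> z _; exact: integral_ge0.
  - exact: measurable_integral2.
  - by move=> z _; exact: integral_ge0.
  - exact: measurable_integral2.
  apply: eq_integral => z _; rewrite -ge0_integralD//; try exact: pairm.
  by apply: eq_integral => c _; rewrite GE.
have EA p : H (reflect_step g p) * (psi p.2 * phi p.1)%:E = A p + B p.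
  case: p => z c; rewrite /A /B /reflect_step /accept /psi /w /t/=.
  case: (leP 0%R c) => c0 /=; last by rewrite mul0r !mule0 adde0.
  by case: leP => tc; rewrite mule0 ?adde0 ?add0e.
have EB p : H p * (psi p.2 * phi p.1)%:E = A' p + B' p.
  case: p => z c; rewrite /A' /B' /psi /w/=.
  case: (leP 0%R c) => c0 /=; last by rewrite mul0r !mule0 adde0.
  by case: leP => tc; rewrite mule0 ?adde0 ?add0e.
apply: (eq_trans (splitE _ A B A0 B0 mA mB EA)).
apply: esym; apply: (eq_trans (splitE _ A' B' A'0 B'0 mA' mB' EB)); apply: esym.
have E1 : \int[mu]_z \int[mu]_c A (z, c) = \int[mu]_z \int[mu]_c A' (z, c).
  have mIA' : measurable_fun setT (fun z => \int[mu]_c A' (z, c)).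
    exact: measurable_integral2.
  have IA'0 z : 0 <= \int[mu]_c A' (z, c) by exact: integral_ge0.
  apply: (eq_trans _ (ge0_integral_shift g mIA' IA'0)).
  apply: eq_integral => z _.
  apply: (eq_trans (esym (ge0_integral_shift (t z) (pairm A z mA)
    (fun c => A0 (z, c))))).
  apply: eq_integral => c _; rewrite /A /A'/= addrK; congr (_ * _%:E).
  rewrite /w /accept; have -> : (t (- (z + g)) = - t z)%R by rewrite /t; field.
  have -> : (t z <= c + t z)%R = (0 <= c)%R by rewrite lerDr.
  have -> : (0 <= c + t z)%R = (- t z <= c)%R by rewrite -lerBlDr sub0r.
  rewrite andbC; case: ifP => // _; rewrite /phi mulrCA [RHS]mulrCA -!expRD.
  by congr (_ * expR _)%R; rewrite /t; field.
have E2 : \int[mu]_z \int[mu]_c B (z, c) = \int[mu]_z \int[mu]_c B' (z, c).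
  have mIB' : measurable_fun setT (fun z => \int[mu]_c B' (z, c)).
    exact: measurable_integral2.
  have IB'0 z : 0 <= \int[mu]_c B' (z, c) by exact: integral_ge0.
  apply: (eq_trans _ (ge0_integral_opp mIB' IB'0)).
  apply: eq_integral => z _; apply: eq_integral => c _.
  by rewrite /B /B'/= opprK /w /phi sqrrN.
exact: (f_equal2 _ E1 E2).
Qed.

End gauss.

Definition tmap (T K : Type) (h : T -> K) n (t : n.-tuple T) : n.-tuple K :=
  [tuple of map h t].

(** * Independent samples *)

Section iid_law.
Local Open Scope ereal_scope.
Context d (T : measurableType d) (R : realType).

Definition tcons n (p : T * n.-tuple T) : n.+1.-tuple T :=
  [the n.+1.-tuple T of p.1 :: p.2].

Lemma measurable_tcons n : measurable_fun setT (@tcons n).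
Proof. by apply: measurable_cons. Qed.

HB.instance Definition _ n :=
  isMeasurableFun.Build _ _ _ _ (@tcons n) (@measurable_tcons n).

Lemma tnth_tcons0 n x (t : n.-tuple T) : tnth (tcons (x, t)) ord0 = x.
Proof. by []. Qed.

Lemma tnth_tconsS n x (t : n.-tuple T) i :
  tnth (tcons (x, t)) (lift ord0 i) = tnth t i.
Proof. by rewrite tnthS. Qed.

Lemma tcons_eta n (t : n.+1.-tuple T) :
  t = tcons (thead t, [tuple of behead t]).
Proof. by rewrite {1}(tuple_eta t). Qed.

Lemma behead_tcons n (p : T * n.-tuple T) : [tuple of behead (tcons p)] = p.2.
Proof. exact: val_inj. Qed.

Lemma measurable_thead n : measurable_fun setT (fun t : n.+1.-tuple T => thead t).
Proof. exact: measurable_tnth. Qed.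

Variable P : probability T R.

Fixpoint iid n : probability (n.-tuple T) R :=
  if n is m.+1 return probability (n.-tuple T) R
  then distribution (P \x iid m) (@tcons m)
  else \d_[tuple].

Lemma integral_iidS n (f : n.+1.-tuple T -> \bar R) :
  measurable_fun setT f -> (forall t, 0 <= f t) ->
  \int[iid n.+1]_t f t = \int[P]_x \int[iid n]_t f (tcons (x, t)).
Proof.
move=> mf f0; rewrite /= ge0_integral_distribution//.
apply: (fubini_tonelli1 (f \o @tcons n)); last by move=> x; exact: f0.
by apply: (measurableT_comp mf); exact: measurable_tcons.
Qed.

End iid_law.

Section iid_indep.
Local Open Scope ereal_scope.
Context d d' (T : measurableType d) (K : measurableType d') (R : realType).
Variables (P : probability T R) (pi : T -> K).
Hypothesis mpi : measurable_fun setT pi.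

Lemma measurable_map_tuple n :
  measurable_fun setT (@tmap T K pi n).
Proof.
apply/measurable_fun_tnthP => i.
rewrite (_ : _ \o _ = pi \o (fun t : n.-tuple T => tnth t i)).
  by apply: (measurableT_comp mpi); exact: measurable_tnth.
by apply/funext => t /=; rewrite tnth_map.
Qed.

Lemma map_tcons n x (t : n.-tuple T) :
  (tmap pi (tcons (x, t))) = tcons (pi x, (tmap pi t)).
Proof. exact: val_inj. Qed.

Lemma measurable_prod_tnth n (u : 'I_n -> T -> \bar R) :
  (forall i, measurable_fun setT (u i)) ->
  measurable_fun setT (fun t : n.-tuple T => \big[*%E/1]_(i < n) u i (tnth t i)).
Proof.
elim: n u => [|n IHn] u mu.
  by under eq_fun do rewrite big_ord0; exact: measurable_cst.
under eq_fun do rewrite big_ord_recl.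
apply: emeasurable_funM.
  by apply: (measurableT_comp (mu _)); exact: measurable_tnth.
rewrite (_ : (fun t : n.+1.-tuple T => _) = (fun t : n.-tuple T =>
    \big[*%E/1]_(i < n) u (lift ord0 i) (tnth t i)) \o
    (fun t : n.+1.-tuple T => [tuple of behead t])); last first.
  apply/funext => t /=; apply: eq_bigr => i _.
  by rewrite [in LHS](tuple_eta t) tnthS.
apply: (measurableT_comp (IHn (fun i => u (lift ord0 i)) _)) => //.
exact: measurable_behead.
Qed.

Lemma prod_ge0 n (x : 'I_n -> \bar R) :
  (forall i, 0 <= x i) -> 0 <= \big[*%E/1]_(i < n) x i.
Proof. by move=> x0; elim/big_ind: _ => // a b; exact: mule_ge0. Qed.

(** Factorisation for one entry passes to tuples by induction. It serves to separate the coins from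
    the data: with [pi := snd] inside a sample and with [pi := sample_coins] across samples. *)
Lemma integral_iid_indep n (u : 'I_n -> T -> \bar R) (f : n.-tuple K -> \bar R) :
  (forall i, measurable_fun setT (u i)) -> (forall i x, 0 <= u i x) ->
  (forall i (h : K -> \bar R), measurable_fun setT h -> (forall k, 0 <= h k) ->
     \int[P]_x (u i x * h (pi x)) = \int[P]_x u i x * \int[P]_x h (pi x)) ->
  measurable_fun setT f -> (forall t, 0 <= f t) ->
  \int[iid P n]_t (\big[*%E/1]_(i < n) u i (tnth t i) * f (tmap pi t)) =
  \big[*%E/1]_(i < n) (\int[P]_x u i x) * \int[iid P n]_t f (tmap pi t).
Proof.
move=> mu u0 uh mf f0; elim: n u f mu u0 uh mf f0 => [|n IHn] u f mu u0 uh mf f0.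
  by rewrite big_ord0 mul1e; apply: eq_integral => t _; rewrite big_ord0 mul1e.
have mmap m := @measurable_map_tuple m.
have mprod := @measurable_prod_tnth n (fun i => u (lift ord0 i)).
have fc x : measurable_fun setT (fun t => f (tcons (x, t))).
  by have mc := @measurable_tcons _ K n; mfun.
have mF : measurable_fun setT (fun p : K * n.-tuple T =>
    f (tcons (p.1, (tmap pi p.2)))).
  by have mc := @measurable_tcons _ K n; have mn := mmap n; mfun.
rewrite integral_iidS; last 2 first.
- apply: emeasurable_funM; first exact: measurable_prod_tnth.
  by apply: (measurableT_comp mf); exact: mmap.
- by move=> t; rewrite mule_ge0//; exact: prod_ge0.
have mh : measurable_fun setT (fun k : K =>
    \int[iid P n]_t f (tcons (k, (tmap pi t)))).
  by apply: (measurable_integral2 (iid P n) mF).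
transitivity (\int[P]_x (u ord0 x *
    (\big[*%E/1]_(i < n) (\int[P]_x u (lift ord0 i) x) *
     \int[iid P n]_t f (tcons (pi x, (tmap pi t)))))).
  apply: eq_integral => x _.
  rewrite -(IHn _ (fun t => f (tcons (pi x, t))))//; last first.
    by move=> i h; exact: uh.
  rewrite -ge0_integralZl//.
  - apply: eq_integral => t _; rewrite big_ord_recl tnth_tcons0 map_tcons muleA.
    by congr (_ * _ * _); apply: eq_bigr => i _; rewrite tnth_tconsS.
  - apply: emeasurable_funM; first by apply: mprod.
    by apply: (measurableT_comp (fc _)); exact: mmap.
  - by move=> t _; rewrite mule_ge0//; exact: prod_ge0.
under eq_integral do rewrite muleCA.
rewrite ge0_integralZl//; first last.
- by apply: prod_ge0 => i; exact: integral_ge0.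
- by move=> x _; rewrite mule_ge0//; exact: integral_ge0.
- by apply: emeasurable_funM => //; apply: (measurableT_comp mh).
rewrite (uh ord0 (fun k => \int[iid P n]_t f (tcons (k, (tmap pi t)))))//; last first.
  by move=> k; exact: integral_ge0.
rewrite big_ord_recl [in RHS]integral_iidS; last 2 first.
- by apply: (measurableT_comp mf); exact: mmap.
- by [].
rewrite muleCA muleA; congr (_ * _).
by apply: eq_integral => x _; apply: eq_integral => t _; rewrite map_tcons.
Qed.

End iid_indep.

Section iid_consequences.
Local Open Scope ereal_scope.
Context d (T : measurableType d) (R : realType) (P : probability T R).

Lemma integral_prob_cst d' (T' : measurableType d') (Q : probability T' R) (x : \bar R) :
  \int[Q]_t x = x.
Proof.
rewrite integral_cst//; apply: (eq_trans (f_equal (mule x) (probability_setT Q))).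
exact: mule1.
Qed.

Lemma integral_iid_prod n (u : 'I_n -> T -> \bar R) :
  (forall i, measurable_fun setT (u i)) -> (forall i x, 0 <= u i x) ->
  \int[iid P n]_t (\big[*%E/1]_(i < n) u i (tnth t i)) =
  \big[*%E/1]_(i < n) (\int[P]_x u i x).
Proof.
move=> mu u0.
have := @integral_iid_indep _ _ T bool R P (fun=> true) (measurable_cst _) n u
  (fun=> 1) mu u0.
rewrite integral_prob_cst mule1 => <- //.
  by apply: eq_integral => t _; rewrite mule1.
move=> i h mh h0; rewrite ge0_integralZr//; congr (_ * _).
by rewrite integral_prob_cst.
Qed.

Lemma integral_iid_map n (h : T -> T) (f : n.-tuple T -> \bar R) :
  measurable_fun setT h ->
  (forall g : T -> \bar R, measurable_fun setT g -> (forall x, 0 <= g x) ->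
     \int[P]_x g (h x) = \int[P]_x g x) ->
  measurable_fun setT f -> (forall t, 0 <= f t) ->
  \int[iid P n]_t f (tmap h t) = \int[iid P n]_t f t.
Proof.
move=> mh hP mf f0; elim: n f mf f0 => [|n IHn] f mf f0.
  by apply: eq_integral => t _; congr f; rewrite [RHS]tuple0 [LHS]tuple0.
have mmap m := measurable_map_tuple mh (n := m).
have mft x : measurable_fun setT (fun t => f (tcons (x, t))).
  by have mc := @measurable_tcons _ T n; mfun.
rewrite !integral_iidS//; last first.
  by apply: (measurableT_comp mf); exact: mmap.
rewrite -(hP (fun x => \int[iid P n]_t f (tcons (x, t)))); last 2 first.
- apply: (measurable_integral2 (iid P n) (f := f \o @tcons _ T n)) => [|p].
    by apply: (measurableT_comp mf); exact: measurable_tcons.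
  exact: f0.
- by move=> x; exact: integral_ge0.
apply: eq_integral => x _; rewrite -(IHn (fun t => f (tcons (h x, t))))//.
by apply: eq_integral => t _; rewrite map_tcons.
Qed.

End iid_consequences.

(** * Negating the sum of Gaussian coordinates *)

Section shift_sum.
Variable R : realType.
Implicit Types (x c m t r delta : R).
Local Notation N := (std_normal R).
Local Notation C := (coin_law R).

Definition xsum n (p : n.-tuple (R * R)) : R := \sum_(i < n) (tnth p i).1.

(* [m] is midway between the conditional means of the head given the sum before
   and after the shift by [- delta], and [expR (- t)] is the ratio of the two
   conditional densities at [x]: the head stays with probability
   [min 1 (expR (- t))], decided by its exponential coin [c], and is reflected
   around [m] otherwise; the tail then absorbs what remains of the shift. *)
Fixpoint shift_sum n : R -> n.-tuple (R * R) -> n.-tuple (R * R) :=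
  match n return R -> n.-tuple (R * R) -> n.-tuple (R * R) with
  | 0 => fun _ p => p
  | n'.+1 => fun delta p =>
    let x := (thead p).1 in
    let c := (thead p).2 in
    let m := (xsum p - delta / 2) / n'.+1%:R in
    let t := delta * (x - m) / n'%:R in
    if (0 < n')%N && accept t c
    then tcons ((x, c - t), shift_sum delta [tuple of behead p])
    else tcons ((2 * m - x, c),
                shift_sum (delta - 2 * (x - m)) [tuple of behead p])
  end.

(* The orthogonal change of variables that makes [sqrt n * r] the sum of the
   coordinates: a rotation of [(r, z)] produces the head and the normalised sum
   of the tail, so the head component of the last pair is never used. *)
Fixpoint spread n : R -> n.-tuple (R * R) -> n.-tuple (R * R) :=
  match n return R -> n.-tuple (R * R) -> n.-tuple (R * R) with
  | 0 => fun _ p => p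
  | n'.+1 => fun r p =>
    let z := (thead p).1 in
    let c := (thead p).2 in
    let a := (Num.sqrt n'.+1%:R)^-1 in
    let b := Num.sqrt n'%:R / Num.sqrt n'.+1%:R in
    tcons ((a * r + b * z, c), spread (b * r - a * z) [tuple of behead p])
  end.

Lemma xsum_tcons n u (q : n.-tuple (R * R)) : xsum (tcons (u, q)) = u.1 + xsum q.
Proof. by rewrite /xsum big_ord_recl; under eq_bigr do rewrite tnth_tconsS. Qed.

Lemma shift_sum_tcons n delta x c (q : n.-tuple (R * R)) :
  let m := (x + xsum q - delta / 2) / n.+1%:R in
  let t := delta * (x - m) / n%:R in
  shift_sum delta (tcons ((x, c), q)) =
  if (0 < n)%N && accept t c then tcons ((x, c - t), shift_sum delta q)
  else tcons ((2 * m - x, c), shift_sum (delta - 2 * (x - m)) q).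
Proof. by rewrite /= xsum_tcons behead_tcons. Qed.

Lemma spread_tcons n r z c (q : n.-tuple (R * R)) :
  let a := (Num.sqrt n.+1%:R)^-1 in
  let b := Num.sqrt n%:R / Num.sqrt n.+1%:R in
  spread r (tcons ((z, c), q)) =
  tcons ((a * r + b * z, c), spread (b * r - a * z) q).
Proof. by rewrite /= behead_tcons. Qed.

Lemma measurable_xsum n : measurable_fun setT (@xsum n).
Proof.
apply: measurable_sum => i.
by apply: (measurableT_comp measurable_fst); exact: measurable_tnth.
Qed.

Lemma measurable_shift_sum n :
  measurable_fun setT (fun u : R * n.-tuple (R * R) => shift_sum u.1 u.2).
Proof.
elim: n => [|n IHn]; first exact: measurable_snd.
have mx := @measurable_xsum n.+1.
have mb : measurable_fun setT (fun t : n.+1.-tuple (R * R) => [tuple of behead t]).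
  exact: measurable_behead.
have mh : measurable_fun setT (@thead n (R * R)) by exact: measurable_thead.
have mc : measurable_fun setT (@tcons _ (R * R)%type n) by exact: measurable_tcons.
have mS (f : R * n.+1.-tuple (R * R) -> R) : measurable_fun setT f ->
    measurable_fun setT (fun u : R * n.+1.-tuple (R * R) =>
      shift_sum (f u) [tuple of behead u.2]).
  move=> mf; apply: (measurableT_comp IHn (g := fun u => (f u, [tuple of behead u.2]))).
  apply: measurable_fun_pair => //.
  by apply: (measurableT_comp mb); exact: measurable_snd.
rewrite /= /accept.
have mS1 := mS (fun u => u.1) measurable_fst.
have mS2 := mS (fun u => u.1 - 2 * ((thead u.2).1 - (xsum u.2 - u.1 / 2) / n.+1%:R)).
apply: measurable_fun_ifT.
- by mfun.
- by apply: (measurableT_comp mc); apply: measurable_fun_pair => //; mfun.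
- apply: (measurableT_comp mc); apply: measurable_fun_pair; first by mfun.
  by apply: mS2; mfun.
Qed.

Lemma measurable_spread n :
  measurable_fun setT (fun u : R * n.-tuple (R * R) => spread u.1 u.2).
Proof.
elim: n => [|n IHn]; first exact: measurable_snd.
have mb : measurable_fun setT (fun t : n.+1.-tuple (R * R) => [tuple of behead t]).
  exact: measurable_behead.
have mh : measurable_fun setT (@thead n (R * R)) by exact: measurable_thead.
have mc : measurable_fun setT (@tcons _ (R * R)%type n) by exact: measurable_tcons.
rewrite /=; apply: (measurableT_comp mc); apply: measurable_fun_pair; first by mfun.
pose a : R := (Num.sqrt n.+1%:R)^-1.
pose b : R := Num.sqrt n%:R / Num.sqrt n.+1%:R.
apply: (measurableT_comp IHn (g := fun u : R * n.+1.-tuple (R * R) =>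
  (b * u.1 - a * (thead u.2).1, [tuple of behead u.2]))).
apply: measurable_fun_pair; first by mfun.
by apply: (measurableT_comp mb); exact: measurable_snd.
Qed.

Arguments shift_sum : simpl never.
Arguments spread : simpl never.

Lemma xsum_shift_sum n delta (p : n.-tuple (R * R)) : (0 < n)%N ->
  xsum (shift_sum delta p) = xsum p - delta.
Proof.
elim: n delta p => // n IHn delta p _.
rewrite (tcons_eta p); case: (thead p) => x c; move: [tuple of _] => q.
rewrite shift_sum_tcons xsum_tcons.
have [n0|n0] := posnP n.
  (* A last coordinate has no tail: then [m = x - delta / 2] and the reflected value [2 * m - x] is
     [x - delta], which absorbs all that is left of the shift. *)
  subst n; rewrite /= xsum_tcons /xsum !big_ord0 /= divr1.
  by field.
case: ifP => _; rewrite xsum_tcons IHn//=; first by rewrite addrA.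
by ring.
Qed.

(** The way back meets the same [m], the midpoint being symmetric in the old and the new sum. After
    an acceptance the threshold is [- t] and the coin [c - t], hence accepted again; after a
    rejection both [delta] and [x - m] have changed sign, so [t] and [c] are the same and the
    rejection is repeated. *)
Lemma shift_sumK n delta (p : n.-tuple (R * R)) :
  shift_sum (- delta) (shift_sum delta p) = p.
Proof.
elim: n delta p => // n IHn delta p.
have := xsum_shift_sum delta p (ltn0Sn n).
rewrite (tcons_eta p); case: (thead p) => x c; move: [tuple of _] => q.
rewrite shift_sum_tcons xsum_tcons /=.
set m := (x + xsum q - delta / 2) / n.+1%:R.
set t := delta * (x - m) / n%:R.
case: ifPn => [/andP[n0 /andP[c0 tc]]|rej]; rewrite xsum_tcons /= => sE.
  rewrite shift_sum_tcons sE.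
  have -> : (x + xsum q - delta - - delta / 2) / n.+1%:R = m.
    by rewrite /m; congr (_ / _); field.
  have -> : - delta * (x - m) / n%:R = - t by rewrite /t !mulNr.
  rewrite n0 /accept subr_ge0 tc lerBrDr addNr c0 /= opprK subrK.
  by rewrite IHn.
rewrite shift_sum_tcons sE.
have -> : (x + xsum q - delta - - delta / 2) / n.+1%:R = m.
  by rewrite /m; congr (_ / _); field.
have -> : - delta * (2 * m - x - m) / n%:R = t by rewrite /t; congr (_ / _); ring.
rewrite (negbTE rej); congr (tcons ((_, _), _)); first by ring.
rewrite -[RHS](IHn (delta - 2 * (x - m))); congr shift_sum; ring.
Qed.

Lemma spread_coefs n (a := (Num.sqrt n.+1%:R)^-1 : R)
    (b := Num.sqrt n%:R / Num.sqrt n.+1%:R : R) :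
  [/\ 0 < a, a ^+ 2 + b ^+ 2 = 1, n.+1%:R = a ^- 2 & Num.sqrt n%:R = b / a].
Proof.
have s0 : 0 < Num.sqrt (n.+1%:R : R) by rewrite sqrtr_gt0 ltr0n.
have sn : Num.sqrt (n.+1%:R : R) != 0 by rewrite gt_eqF.
split.
- by rewrite invr_gt0.
- rewrite /a /b exprVn expr_div_n !sqr_sqrtr ?ler0n// -[X in X + _]div1r -mulrDl.
  by rewrite -natr1 addrC divff// natr1 pnatr_eq0.
- by rewrite /a exprVn invrK sqr_sqrtr// ler0n.
- by rewrite /a /b invrK divfK.
Qed.

Lemma xsum_spread n r (p : n.-tuple (R * R)) :
  xsum (spread r p) = Num.sqrt n%:R * r.
Proof.
elim: n r p => [|n IHn] r p; first by rewrite /xsum big_ord0 sqrtr0 mul0r.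
rewrite (tcons_eta p); case: (thead p) => z c; move: [tuple of _] => q.
rewrite spread_tcons xsum_tcons IHn /=.
have [] := spread_coefs n; set a := (Num.sqrt n.+1%:R)^-1.
set b := Num.sqrt n%:R / _ => a0 ab _ ->.
rewrite -[Num.sqrt n.+1%:R]invrK -/a.
have an0 : a != 0 by rewrite gt_eqF.
have -> : a * r + b * z + b / a * (b * r - a * z) = (a ^+ 2 + b ^+ 2) * a^-1 * r.
  by field.
by rewrite ab mul1r.
Qed.

End shift_sum.

(** * Invariance of the product law under negation of the sum *)

Section negation.
Variable R : realType.
Implicit Types (r delta : R).
Local Notation N := (std_normal R).
Local Notation C := (coin_law R).
Local Open Scope ereal_scope.

Definition unit_law : probability (R * R)%type R :=
  (N \x C)%E.

Lemma integral_unit_law (f : R * R -> \bar R) :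
  measurable_fun setT f -> (forall p, 0 <= f p) ->
  \int[unit_law]_u f u = \int[N]_x \int[C]_c f (x, c).
Proof. by move=> mf f0; exact: (fubini_tonelli1 f). Qed.

Lemma integral_unit_lawS n (f : n.+1.-tuple (R * R) -> \bar R) :
  measurable_fun setT f -> (forall p, 0 <= f p) ->
  \int[iid unit_law n.+1]_p f p =
  \int[N]_x \int[C]_c \int[iid unit_law n]_q f (tcons ((x, c), q)).
Proof.
move=> mf f0; apply: (eq_trans (integral_iidS unit_law mf f0)).
have mc : measurable_fun setT (@tcons _ (R * R)%type n) by exact: measurable_tcons.
have mft : measurable_fun setT (fun u => f (@tcons _ (R * R)%type n u)) by mfun.
apply: (integral_unit_law (f := fun u => \int[iid unit_law n]_q f (tcons (u, q)))).
- exact: (measurable_integral2 (iid unit_law n) mft).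
- by move=> u; exact: integral_ge0.
Qed.

(** In the induction the head is [x = a * r + b * z]. Replacing [r] by [s = r - a * delta] and [z]
    by [z + g], with [b * g = a ^+ 2 * delta], leaves [x] unchanged, while replacing [z] by [- z]
    turns it into [2 * m - x]. These are the two branches of [reflect_step g], and in each of them
    the induction hypothesis brings the tail to its new normalised sum. With one coordinate
    everything is forced and the two sides agree pointwise. *)
Lemma integral_shift_spread n r delta (f : n.-tuple (R * R) -> \bar R) :
  measurable_fun setT f -> (forall p, 0 <= f p) ->
  \int[iid unit_law n]_p f (shift_sum delta (spread r p)) =
  \int[iid unit_law n]_p f (spread (r - delta / Num.sqrt n%:R)%R p).
Proof.
elim: n r delta f => [|n IHn] r delta f mf f0.
  by apply: eq_integral => p _; congr f; rewrite [LHS]tuple0 [RHS]tuple0.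
have msh k := @measurable_shift_sum R k.
have msp k := @measurable_spread R k.
have mc : measurable_fun setT (@tcons _ (R * R)%type n) by exact: measurable_tcons.
have mf1 : measurable_fun setT (fun p => f (shift_sum delta (spread r p))).
  apply: (measurableT_comp mf).
  apply: (measurableT_comp (msh n.+1) (g := fun p => (delta, spread r p))).
  apply: measurable_fun_pair => //.
  apply: (measurableT_comp (msp n.+1) (g := fun p => (r, p))).
  by mfun.
have mf2 s : measurable_fun setT (fun p => f (spread s p)).
  apply: (measurableT_comp mf).
  apply: (measurableT_comp (msp n.+1) (g := fun p => (s, p))).
  by mfun.
have [a0 ab nE snE] := spread_coefs R n.
set a : R := ((Num.sqrt n.+1%:R)^-1)%R in a0 ab nE snE *.
set b : R := (Num.sqrt n%:R / Num.sqrt n.+1%:R)%R in ab snE.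
have [n0|n0] := posnP n.
  subst n; apply: eq_integral => p _; congr f.
  rewrite (tcons_eta p); case: (thead p) => z c; move: [tuple of _] => q.
  rewrite !spread_tcons shift_sum_tcons /= /a sqrtr1 sqrtr0.
  rewrite /xsum big_ord0; congr (tcons ((_, _), _)).
  by field.
have b0 : (0 < b)%R by rewrite divr_gt0// sqrtr_gt0 ltr0n.
have an0 : a != 0%R by rewrite gt_eqF.
have bn0 : b != 0%R by rewrite gt_eqF.
have nE' : (n%:R = (b / a) ^+ 2 :> R)%R by rewrite -snE sqr_sqrtr ?ler0n.
pose s := (r - delta / Num.sqrt n.+1%:R)%R.
pose H (p : R * R) := \int[iid unit_law n]_q
  f (tcons ((a * s + b * p.1, p.2)%R, spread (b * s - a * p.1)%R q)).
have mH : measurable_fun setT H.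
  apply: (measurable_integral2 (iid unit_law n) (f := fun u : (R * R) * n.-tuple (R * R) =>
    f (tcons ((a * s + b * u.1.1, u.1.2)%R, spread (b * s - a * u.1.1)%R u.2)))) => //.
  apply: (measurableT_comp mf); apply: (measurableT_comp mc).
  apply: measurable_fun_pair; first by mfun.
  apply: (measurableT_comp (msp n) (g := fun u : (R * R) * n.-tuple (R * R) =>
    ((b * s - a * u.1.1)%R, u.2))).
  by mfun.
have H0 p : 0 <= H p by exact: integral_ge0.
pose g := (a ^+ 2 * delta / b)%R.
apply: (eq_trans (integral_unit_lawS mf1 (fun p => f0 _))).
apply: esym; apply: (eq_trans (integral_unit_lawS (mf2 s) (fun p => f0 _))); apply: esym.
transitivity (\int[N]_z \int[C]_c H (reflect_step g (z, c))); last first.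
  apply: (eq_trans (integral_reflect_step g mH H0)).
  apply: eq_integral => z _; apply: eq_integral => c _; apply: eq_integral => q _.
  by rewrite spread_tcons.
apply: eq_integral => z _; apply: eq_integral => c _.
pose x := (a * r + b * z)%R.
pose m := (a * r - a ^+ 2 * delta / 2)%R.
pose t := (g * (z + g / 2))%R.
have mf3 y : measurable_fun setT (fun q => f (tcons (y, q))) by mfun.
transitivity (\int[iid unit_law n]_q f (
    if accept t c then tcons ((x, c - t)%R, shift_sum delta (spread (b * r - a * z)%R q))
    else tcons ((2 * m - x, c)%R,
         shift_sum (delta - 2 * (x - m))%R (spread (b * r - a * z)%R q)))).
  apply: eq_integral => q _; congr f.
  rewrite spread_tcons shift_sum_tcons n0 xsum_spread -/a -/b -/x /=.
  have -> : ((x + Num.sqrt n%:R * (b * r - a * z) - delta / 2) / n.+1%:R = m)%R.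
    rewrite snE nE /x /m.
    have -> : (a * r + b * z + b / a * (b * r - a * z) = (a ^+ 2 + b ^+ 2) * r / a)%R.
      by field.
    by rewrite ab; field.
  have -> // : (delta * (x - m) / n%:R = t)%R.
  rewrite nE' /x /m /t /g; field.
  by rewrite an0 bn0.
rewrite /reflect_step /= -/t.
case: ifP => _.
- apply: (eq_trans (IHn (b * r - a * z)%R delta _ (mf3 (x, c - t)%R) (fun q => f0 _))).
  apply: eq_integral => q _; congr (f (tcons ((_, _), spread _ _))).
  + by rewrite /x /s /g -/a /=; field.
  + rewrite snE /s /g -/a /=.
    have -> : (delta / (b / a) = (a ^+ 2 + b ^+ 2) * delta * a / b)%R.
      by rewrite ab; field; rewrite an0 bn0.
    by field.
- apply: (eq_trans (IHn (b * r - a * z)%R _ _ (mf3 (2 * m - x, c)%R) (fun q => f0 _))).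
  apply: eq_integral => q _; congr (f (tcons ((_, _), spread _ _))).
  + by rewrite /x /m /s -/a /=; field.
  + rewrite snE /x /m /s -/a /=.
    have -> : ((delta - 2 * (a * r + b * z - (a * r - a ^+ 2 * delta / 2))) / (b / a) =
      ((1 - a ^+ 2) * delta * a / b) - 2 * a * z)%R.
      by field; rewrite an0 bn0.
    have -> : (1 - a ^+ 2 = b ^+ 2)%R by rewrite -ab addrC addKr.
    by field.
Qed.

(** The rotation of [(r, z)] yields the head and the normalised sum of the tail as independent
    standard Gaussians, so the latter plays the role of [r] in the induction hypothesis. *)
Lemma integral_spread n (f : n.+1.-tuple (R * R) -> \bar R) :
  measurable_fun setT f -> (forall p, 0 <= f p) ->
  \int[N]_r \int[iid unit_law n.+1]_p f (spread r p) = \int[iid unit_law n.+1]_p f p.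
Proof.
elim: n f => [|n IHn] f mf f0.
  have mc : measurable_fun setT (@tcons _ (R * R)%type 0) by exact: measurable_tcons.
  apply: esym; apply: (eq_trans (integral_unit_lawS mf f0)); apply: esym.
  apply: eq_integral => r _.
  have mfr : measurable_fun setT (fun p => f (spread r p)).
    apply: (measurableT_comp mf).
    apply: (measurableT_comp (@measurable_spread R 1) (g := fun p => (r, p))).
    by mfun.
  apply: (eq_trans (integral_unit_lawS mfr (fun p => f0 _))).
  transitivity (\int[N]_z \int[C]_c \int[iid unit_law 0]_q f (tcons ((r, c), q))).
    apply: eq_integral => z _; apply: eq_integral => c _; apply: eq_integral => q _.
    rewrite spread_tcons /=; congr (f (tcons ((_, _), _))).
    by rewrite sqrtr0 sqrtr1 mul0r mul0r addr0 invr1 mul1r.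
  exact: integral_prob_cst.
have mc : measurable_fun setT (@tcons _ (R * R)%type n.+1) by exact: measurable_tcons.
have msp := @measurable_spread R n.+1.
have [a0 ab nE snE] := spread_coefs R n.+1.
set a : R := ((Num.sqrt n.+2%:R)^-1)%R in a0 ab nE snE.
set b : R := (Num.sqrt n.+1%:R / Num.sqrt n.+2%:R)%R in ab snE.
have b0 : (0 < b)%R by rewrite divr_gt0// sqrtr_gt0 ltr0n.
have mF : measurable_fun setT (fun u : ((R * R) * R) * n.+1.-tuple (R * R) =>
    f (tcons (u.1.1, spread u.1.2 u.2))).
  apply: (measurableT_comp mf); apply: (measurableT_comp mc).
  apply: measurable_fun_pair; first by mfun.
  apply: (measurableT_comp msp (g := fun u : ((R * R) * R) * n.+1.-tuple (R * R) =>
    (u.1.2, u.2))).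
  by mfun.
pose G (u : (R * R) * R) := \int[iid unit_law n.+1]_q f (tcons (u.1, spread u.2 q)).
have mG : measurable_fun setT G by exact: (measurable_integral2 (iid unit_law n.+1) mF).
have G0 u : 0 <= G u by exact: integral_ge0.
pose K (u : R * R) := \int[C]_c G ((u.1, c), u.2).
have mK : measurable_fun setT K.
  apply: (measurable_integral2 C (f := fun u => G ((u.1.1, u.2), u.1.2))) => //.
  by mfun.
have K0 u : 0 <= K u by exact: integral_ge0.
transitivity (\int[N]_r \int[N]_z K (a * r + b * z, b * r - a * z)%R).
  apply: eq_integral => r _.
  have mfr : measurable_fun setT (fun p => f (spread r p)).
    apply: (measurableT_comp mf).
    apply: (measurableT_comp (@measurable_spread R n.+2) (g := fun p => (r, p))).
    by mfun.
  apply: (eq_trans (integral_unit_lawS mfr (fun p => f0 _))).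
  apply: eq_integral => z _; apply: eq_integral => c _; apply: eq_integral => q _.
  by rewrite spread_tcons.
apply: (eq_trans (integral_normal_rot b0 ab mK K0)).
apply: esym; apply: (eq_trans (integral_unit_lawS mf f0)); apply: esym.
apply: eq_integral => x _; rewrite /K /=.
transitivity (\int[C]_c \int[N]_w G ((x, c), w)).
  apply: (fubini_tonelli (m1 := N) (m2 := C) (fun u => G ((x, u.2), u.1))) => //.
  by mfun.
apply: eq_integral => c _.
apply: (IHn (fun p => f (tcons ((x, c), p)))) => //.
by mfun.
Qed.

(** The shift depends on the sample, but only through its sum, which is [Num.sqrt n.+1%:R * r] once
    [r] is fixed. The normalised sum then goes from [r] to [- r], and the law of [r] is
    symmetric. *)
Lemma integral_negate n (f : n.+1.-tuple (R * R) -> \bar R) :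
  measurable_fun setT f -> (forall p, 0 <= f p) ->
  \int[iid unit_law n.+1]_p f (shift_sum (2 * xsum p)%R p) =
  \int[iid unit_law n.+1]_p f p.
Proof.
move=> mf f0.
have mx := @measurable_xsum R n.+1.
have mF : measurable_fun setT (fun p => f (shift_sum (2 * xsum p)%R p)).
  apply: (measurableT_comp mf).
  apply: (measurableT_comp (@measurable_shift_sum R n.+1)
    (g := fun p => ((2 * xsum p)%R, p))).
  by mfun.
apply: (eq_trans (esym (integral_spread mF (fun p => f0 _)))).
apply: esym; apply: (eq_trans (esym (integral_spread mf f0))); apply: esym.
pose K r := \int[iid unit_law n.+1]_p f (spread r p).
have mK : measurable_fun setT K.
  apply: (measurable_integral2 (iid unit_law n.+1) (f := fun u => f (spread u.1 u.2))) => //.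
  by apply: (measurableT_comp mf); exact: measurable_spread.
have K0 r : 0 <= K r by exact: integral_ge0.
apply: (eq_trans _ (integral_normal_opp mK K0)).
apply: eq_integral => r _.
have -> : (- r = r - (2 * (Num.sqrt n.+1%:R * r)) / Num.sqrt n.+1%:R)%R.
  field; by rewrite gt_eqF// sqrtr_gt0 ltr0n.
apply: (eq_trans _ (integral_shift_spread _ _ mf f0)).
by apply: eq_integral => p _; rewrite xsum_spread.
Qed.

End negation.

(** * Expected number of moved coordinates *)

Section gaussian_moments.
Variable R : realType.
Implicit Types (g z c x r t delta : R).
Local Notation N := (std_normal R).
Local Notation C := (coin_law R).
Local Notation mu := (@lebesgue_measure R).
Local Notation phi0 := (normal_peak (1 : R)).

Lemma normal_peak_le_half : phi0 <= 1 / 2.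
Proof.
rewrite /normal_peak expr1n mul1r -(invrK (1 / 2)) lef_pV2 ?posrE; last 2 first.
- by rewrite sqrtr_gt0 pmulrn_lgt0// pi_gt0.
- by rewrite invr_gt0 divr_gt0.
rewrite invf_div divr1 -[leLHS]ger0_norm// -sqrtr_sqr ler_sqrt; last first.
  by rewrite mulrn_wge0// pi_ge0.
by rewrite -mulr_natr; have := @pi_ge2 R; lra.
Qed.

Lemma sinh_ge (y : R) : 0 <= y -> 2 * y <= expR y - expR (- y).
Proof.
rewrite le_eqVlt => /predU1P[<-|y0]; first by rewrite oppr0 subrr mulr0.
pose f (x : R) : R := expR x - expR (- x) - 2 * x.
pose f' (x : R) : R := expR x + expR (- x) - 2.
have df x : is_derive x 1 f (f' x).
  rewrite /f /f'; apply: is_derive_eq; by rewrite scaler1 mulrN1 opprK.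
have [|c] := @MVT R f f' 0 y y0 (fun x _ => df x).
  by apply: derivable_within_continuous => x _; exact: ex_derive.
rewrite in_itv/= => /andP[c0 cy]; rewrite /f oppr0 subrr mulr0 !subr0 => fE.
rewrite -subr_ge0 fE addr0 mulr_ge0 ?(ltW y0)// /f'.
have -> : expR c + expR (- c) - 2 = (expR (c / 2) - expR (- (c / 2))) ^+ 2.
  rewrite sqrrB -!expRM_natl expRxMexpNx_1.
  have -> : 2%:R * (c / 2) = c by field.
  have -> : 2%:R * - (c / 2) = - c by field.
  by rewrite mulr2n; ring.
exact: sqr_ge0.
Qed.

Lemma cosh_ge (x : R) : 2 + x ^+ 2 <= expR x + expR (- x).
Proof.
wlog x0 : x / 0 <= x => [hw|].
  case: (leP 0 x) => x0; first exact: hw.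
  by have := hw (- x); rewrite opprK sqrrN [expR _ + _]addrC oppr_ge0; apply; exact: ltW.
have := @sinh_ge (x / 2); rewrite divr_ge0// => /(_ isT) h.
have : x ^+ 2 <= (expR (x / 2) - expR (- (x / 2))) ^+ 2.
  rewrite ler_pXn2r// ?nnegrE//; first by apply: le_trans h; lra.
  by apply: le_trans h; rewrite mulr_ge0// divr_ge0.
rewrite sqrrB -!expRM_natl expRxMexpNx_1.
have -> : 2%:R * (x / 2) = x by field.
have -> : 2%:R * - (x / 2) = - x by field.
by rewrite mulr2n; lra.
Qed.

Local Open Scope ereal_scope.

Lemma integral_normal_exp x : \int[N]_z (expR (x * z))%:E = (expR (x ^+ 2 / 2))%:E.
Proof.
have mphi := @measurable_phi R.
have mf : measurable_fun setT (fun z : R => (expR (x * z))%:E) by mfun.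
have f0 (z : R) : 0 <= (expR (x * z))%:E by rewrite lee_fin expR_ge0.
apply: (eq_trans (integral_normalE mf f0)).
have mg : measurable_fun setT (fun z : R => (expR (x ^+ 2 / 2) * phi z)%:E) by mfun.
have g0 (z : R) : 0 <= (expR (x ^+ 2 / 2) * phi z)%:E.
  by rewrite lee_fin mulr_ge0 ?expR_ge0 ?phi_ge0.
transitivity (\int[mu]_z (expR (x ^+ 2 / 2) * phi (z + - x))%:E).
  apply: eq_integral => z _; rewrite -EFinM /phi; congr _%:E.
  by rewrite mulrCA [RHS]mulrCA -!expRD; congr (_ * expR _)%R; field.
apply: (eq_trans (ge0_integral_shift (- x)%R mg g0)).
under eq_integral do rewrite EFinM.
rewrite ge0_integralZl//; first last.
- by move=> z _; rewrite lee_fin phi_ge0.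
- by mfun.
have -> : \int[mu]_z (phi z)%:E = 1.
  by rewrite -(integral_normal_pdf (0 : R) 1); apply: eq_integral => z _; rewrite phiE.
by rewrite mule1.
Qed.

(** Obtained from the exponential moments at [1 / 5] and [- 1 / 5]: [2 + l^2 z^2] is below
    [expR (l * z) + expR (- l * z)], and [expR (1 / 50) <= 50 / 49]. The exact value is [1]; the
    loss is affordable. *)
Lemma integral_normal_sqr : \int[N]_z (z ^+ 2)%:E <= (50 / 49)%:E.
Proof.
pose l : R := (1 / 5)%R.
have m2 : measurable_fun setT (fun z : R => (z ^+ 2)%:E) by mfun.
have I0 : 0 <= \int[N]_z (z ^+ 2)%:E.
  by apply: integral_ge0 => z _; rewrite lee_fin sqr_ge0.
have le1 : 2%:E + (1 / 25)%:E * \int[N]_z (z ^+ 2)%:E <= (2 * expR (l ^+ 2 / 2))%:E.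
  rewrite -(ge0_integralZl _ _ m2)//; last by move=> z _; rewrite lee_fin sqr_ge0.
  rewrite -[X in X + _](integral_prob_cst N) -ge0_integralD//; last 2 first.
  - by move=> z _; rewrite -EFinM lee_fin mulr_ge0// sqr_ge0.
  - by mfun.
  have -> : (2 * expR (l ^+ 2 / 2))%:E =
      \int[N]_z ((expR (l * z))%:E + (expR (- l * z))%:E).
    rewrite ge0_integralD//; first last.
    - by mfun.
    - by mfun.
    by rewrite !integral_normal_exp sqrrN -EFinD; congr _%:E; ring.
  apply: ge0_le_integral => //.
  - by move=> z _; rewrite adde_ge0// -EFinM lee_fin mulr_ge0// sqr_ge0.
  - by mfun.
  - by mfun.
  move=> z _; rewrite -EFinM -!EFinD lee_fin mulNr.
  by apply: le_trans (cosh_ge _); rewrite /l; lra.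
have : (expR (l ^+ 2 / 2) <= 50 / 49)%R.
  have := ler_wpM2l (expR_ge0 (l ^+ 2 / 2)%R) (expR_ge1Dx (- (l ^+ 2 / 2))%R).
  by rewrite expRxMexpNx_1 /l; lra.
move: I0 le1; case: (\int[N]_z _) => [s| |]//.
- by rewrite -EFinM -EFinD !lee_fin; lra.
- by move=> _; rewrite gt0_muley ?lte_fin// addey// leye_eq.
Qed.

Lemma integral_normal_cube : \int[N]_z (if (0 <= z)%R then z ^+ 3 else 0%R)%:E <= 1.
Proof.
have mphi := @measurable_phi R.
(* An antiderivative of [z ^+ 3 * phi z] that vanishes at infinity; the integral is [- F 0], twice
   the peak of the density. *)
pose F (z : R) : R := (- ((z ^+ 2 + 2) * phi z))%R.
pose f (z : R) : R := (z ^+ 3 * phi z)%R.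
have dF (z : R) : is_derive z 1%R F (f z).
  have dg : is_derive z 1%R (fun z : R => expR (- (z ^+ 2 / 2)))%R
      (- z * expR (- (z ^+ 2 / 2)))%R.
    by apply: is_derive_eq; rewrite -?[_ *: _]/(_ * _)%R; field.
  rewrite /F /f /phi; apply: is_derive_eq.
  by rewrite -?[_ *: _]/(_ * _)%R; field.
have df (z : R) : derivable f z 1%R.
  by rewrite /f /phi; exact: ex_derive.
have F0 : F x @[x --> +oo%R] --> (0 : R)%R.
  apply/cvgrPdist_le => e e0; near=> x.
  have x0 : (0 < x)%R by near: x; exact: nbhs_pinfty_gt.
  rewrite sub0r normrN /F normrN ger0_norm; last first.
    by rewrite mulr_ge0 ?phi_ge0// addr_ge0// sqr_ge0.
  have xe : (8 / e <= x)%R by near: x; apply: nbhs_pinfty_ge; exact: num_real.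
  apply: (@le_trans _ _ (8 / x)%R); last by rewrite ler_pdivrMr// mulrC -ler_pdivrMr.
  rewrite /phi expRN ler_pdivlMr//.
  have e1 : ((1 + x ^+ 2 / 4) ^+ 2 <= expR (x ^+ 2 / 2))%R.
    have -> : (x ^+ 2 / 2 = 2%:R * (x ^+ 2 / 4))%R by field.
    rewrite expRM_natl; apply: lerXn2r; rewrite ?nnegrE ?expR_ge0 ?expR_ge1Dx//.
    by rewrite addr_ge0// divr_ge0// sqr_ge0.
  rewrite mulrA mulrAC ler_pdivrMr ?expR_gt0//.
  apply: (@le_trans _ _ ((x ^+ 2 + 2) * (1 / 2) * x)%R).
    rewrite ler_pM2r// ler_wpM2l ?normal_peak_le_half//.
    by rewrite addr_ge0// sqr_ge0.
  apply: (@le_trans _ _ (8 * (1 + x ^+ 2 / 4) ^+ 2)%R); last by rewrite ler_pM2l.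
  by nra.
have FTC : \int[mu]_(z in `[0%R, +oo[) (f z)%:E = 0%:E - (F 0%R)%:E.
  apply: ge0_continuous_FTC2y => //.
  - by move=> x x0; rewrite /f mulr_ge0 ?phi_ge0// exprn_ge0.
  - by apply: derivable_within_continuous => x _; exact: df.
  - apply: cvg_at_right_filter.
    by apply: differentiable_continuous; apply/derivable1_diffP; exact: ex_derive.
  - by move=> x _; rewrite derive1E; exact: derive_val.
pose p3 (z : R) : \bar R := (if (0 <= z)%R then z ^+ 3 else 0%R)%:E.
have mp3 : measurable_fun setT p3 by rewrite /p3; mfun.
have p30 (z : R) : 0 <= p3 z.
  by rewrite /p3 lee_fin; case: ifP => // z0; rewrite exprn_ge0.
rewrite -/p3 (integral_normalE mp3 p30) /p3.
have -> : \int[mu]_z ((if (0 <= z)%R then z ^+ 3 else 0%R)%:E * (phi z)%:E) =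
    \int[mu]_(z in `[0%R, +oo[) (f z)%:E.
  rewrite [RHS]integral_mkcond; apply: eq_integral => z _.
  rewrite patchE -EFinM; case: ifPn => z0.
    by rewrite mem_set//= in_itv/= z0.
  by rewrite mul0r memNset//= in_itv/= andbT; exact/negP.
rewrite FTC sub0e -EFinN lee_fin /F /phi opprK expr0n/= mul0r oppr0 expR0.
by have := normal_peak_le_half; lra.
Unshelve. all: by end_near. Qed.

End gaussian_moments.

(** * Rejection probability of a single step *)

Section one_step.
Variable R : realType.
Implicit Types (g z c t delta : R).
Local Notation N := (std_normal R).
Local Notation C := (coin_law R).
Local Notation mu := (@lebesgue_measure R).
Local Notation phi0 := (normal_peak (1 : R)).
Local Open Scope ereal_scope.

Lemma le_integral_EFin d (T : measurableType d) (m : {measure set T -> \bar R})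
    (k1 k2 : T -> R) :
  measurable_fun setT k1 -> measurable_fun setT k2 ->
  (forall x, 0 <= k1 x)%R -> (forall x, k1 x <= k2 x)%R ->
  \int[m]_x (k1 x)%:E <= \int[m]_x (k2 x)%:E.
Proof.
move=> mk1 mk2 k10 k12; apply: ge0_le_integral; first exact: measurableT.
- by move=> x _; rewrite lee_fin.
- by mfun.
- by mfun.
- by move=> x _; rewrite lee_fin.
Qed.

Lemma integral_EFinD d (T : measurableType d) (m : {measure set T -> \bar R})
    (k1 k2 : T -> R) :
  measurable_fun setT k1 -> measurable_fun setT k2 ->
  (forall x, 0 <= k1 x)%R -> (forall x, 0 <= k2 x)%R ->
  \int[m]_x (k1 x + k2 x)%:E = \int[m]_x (k1 x)%:E + \int[m]_x (k2 x)%:E.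
Proof.
move=> mk1 mk2 k10 k20; apply: (@ge0_integralD _ _ _ m setT _
  (fun x => (k1 x)%:E) (fun x => (k2 x)%:E)); first exact: measurableT.
- by move=> x _; rewrite lee_fin.
- by mfun.
- by move=> x _; rewrite lee_fin.
- by mfun.
Qed.

Lemma integral_EFinM d (T : measurableType d) (m : {measure set T -> \bar R})
    (a : R) (k : T -> R) :
  measurable_fun setT k -> (0 <= a)%R -> (forall x, 0 <= k x)%R ->
  \int[m]_x (a * k x)%:E = a%:E * \int[m]_x (k x)%:E.
Proof.
move=> mk a0 k0; under eq_integral do rewrite EFinM.
apply: ge0_integralZl; first exact: measurableT.
- by mfun.
- by move=> x _; rewrite lee_fin.
- by rewrite lee_fin.
Qed.

(** The term [h (tau x) - h x] has mean zero. The two sides are compared through the positive and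
    negative parts of [h], so that only nonnegative functions are integrated. *)
Lemma integral_coboundary d (T : measurableType d) (P : probability T R)
    (tau : T -> T) (h F G : T -> R) :
  measurable_fun setT tau ->
  (forall f : T -> \bar R, measurable_fun setT f -> (forall x, 0 <= f x) ->
     \int[P]_x f (tau x) = \int[P]_x f x) ->
  measurable_fun setT h -> measurable_fun setT F -> measurable_fun setT G ->
  (forall x, 0 <= F x)%R -> (forall x, 0 <= G x)%R ->
  (forall x, F x + h x = G x + h (tau x))%R ->
  \int[P]_x `|h x|%:E < +oo ->
  \int[P]_x (F x)%:E = \int[P]_x (G x)%:E.
Proof.
move=> mtau tauP mh mF mG F0 G0 FG hoo.
pose hp x := Num.max (h x) 0%R; pose hm x := Num.max (- h x)%R 0%R.
have mhp : measurable_fun setT hp by apply: measurable_maxr => //; exact: measurable_cst.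
have mhm : measurable_fun setT hm.
  by apply: measurable_maxr; [mfun|exact: measurable_cst].
have hp0 x : (0 <= hp x)%R by rewrite le_max lexx orbT.
have hm0 x : (0 <= hm x)%R by rewrite le_max lexx orbT.
have hE x : (h x = hp x - hm x)%R.
  by rewrite /hp /hm; case: (leP (h x) 0%R) => hx;
    [rewrite max_l ?oppr_ge0//|rewrite max_r ?oppr_le0 ?(ltW hx)//]; ring.
have fin (k : T -> R) : measurable_fun setT k -> (forall x, 0 <= k x)%R ->
    (forall x, k x <= `|h x|)%R -> \int[P]_x (k x)%:E \is a fin_num.
  move=> mk k0 kh; rewrite ge0_fin_numE; last first.
    by apply: integral_ge0 => x _; rewrite lee_fin.
  apply: le_lt_trans hoo; apply: le_integral_EFin => //.
  exact: measurableT_comp.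
have finp : \int[P]_x (hp x)%:E \is a fin_num.
  by apply: fin => // x; rewrite /hp ge_max normr_ge0 ler_norm.
have finm : \int[P]_x (hm x)%:E \is a fin_num.
  by apply: fin => // x; rewrite /hm ge_max normr_ge0 -normrN ler_norm.
have tp : \int[P]_x (hp (tau x))%:E = \int[P]_x (hp x)%:E.
  by apply: (tauP (fun x => (hp x)%:E)) => //; mfun.
have tm : \int[P]_x (hm (tau x))%:E = \int[P]_x (hm x)%:E.
  by apply: (tauP (fun x => (hm x)%:E)) => //; mfun.
have : \int[P]_x (F x + (hp x + hm (tau x)))%:E =
       \int[P]_x (G x + (hp (tau x) + hm x))%:E.
  apply: eq_integral => x _; congr _%:E.
  by have := FG x; rewrite !hE; lra.
rewrite !integral_EFinD//; try by [mfun | move=> x; rewrite addr_ge0].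
rewrite tp tm => FGE.
have fin2 : \int[P]_x (hp x)%:E + \int[P]_x (hm x)%:E \is a fin_num.
  by rewrite fin_numD finp finm.
by rewrite -[LHS](addeK _ fin2) FGE addeK.
Qed.


Lemma integral_coin_reject t :
  \int[C]_c (if accept t c then 0 else 1)%:E = (1 - expR (- Num.max t 0))%:E.
Proof.
have mpsi := @measurable_psi R.
pose s : R := Num.max t 0%R.
have acE c : accept t c = (s <= c)%R by rewrite /accept ge_max andbC.
have s0 : (0 <= s)%R by rewrite le_max lexx orbT.
have mA : measurable_fun setT (fun c => if s <= c then 1 else 0 : R)%R by mfun.
have A0 c : (0 <= if s <= c then 1 else 0 : R)%R by case: ifP.
have mB : measurable_fun setT (fun c => if s <= c then 0 else 1 : R)%R by mfun.
have B0 c : (0 <= if s <= c then 0 else 1 : R)%R by case: ifP.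
have psi1 : \int[mu]_c (psi c)%:E = 1.
  rewrite -(integral_exponential_pdf (@ltr01 R)).
  by apply: eq_integral => c _; rewrite psiE.
have IA : \int[C]_c (if s <= c then 1 else 0)%:E = (expR (- s))%:E.
  apply: (eq_trans (@integral_coinE R (fun c => (if s <= c then 1 else 0)%:E) _ _)).
  - by mfun.
  - by move=> c; rewrite lee_fin.
  transitivity (\int[mu]_c (expR (- s) * psi (c + - s))%:E).
    apply: eq_integral => c _; rewrite -EFinM; congr _%:E.
    rewrite /psi subr_ge0; case: ifPn => sc; last by rewrite mul0r mulr0.
    by rewrite (le_trans s0 sc) mul1r -expRD; congr expR; ring.
  have mg : measurable_fun setT (fun c => (expR (- s) * psi c)%:E) by mfun.
  have g0 c : 0 <= (expR (- s) * psi c)%:E.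
    by rewrite lee_fin mulr_ge0 ?expR_ge0 ?psi_ge0.
  apply: (eq_trans (ge0_integral_shift (- s)%R mg g0)).
  by rewrite integral_EFinM ?psi1 ?mule1 ?expR_ge0//; exact: psi_ge0.
have IAB : \int[C]_c (if s <= c then 1 else 0)%:E +
    \int[C]_c (if s <= c then 0 else 1)%:E = 1.
  rewrite -integral_EFinD// -[RHS](integral_prob_cst C).
  by apply: eq_integral => c _; case: ifP => _; rewrite ?addr0 ?add0r.
under eq_integral do rewrite acE.
have fA : \int[C]_c (if s <= c then 1 else 0)%:E \is a fin_num by rewrite IA.
by rewrite -/s -[LHS](addeK _ fA) [X in X - _]addeC IAB IA -EFinB.
Qed.

Lemma integral_unit_reject g (k : R -> R) : measurable_fun setT k ->
  (forall z, 0 <= k z)%R ->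
  \int[unit_law R]_u (k u.1 * (if accept (g * (u.1 + g / 2)) u.2 then 0 else 1))%:E =
  \int[N]_z (k z * (1 - expR (- Num.max (g * (z + g / 2)) 0)))%:E.
Proof.
move=> mk k0.
pose F (u : R * R) : \bar R :=
  (k u.1 * (if accept (g * (u.1 + g / 2)) u.2 then 0 else 1))%:E.
have mF : measurable_fun setT F by rewrite /F /accept; mfun.
have F0 u : 0 <= F u by rewrite lee_fin mulr_ge0//; case: ifP.
apply: (eq_trans (integral_unit_law mF F0)).
apply: eq_integral => z _; rewrite /F/= [RHS]EFinM -integral_coin_reject.
apply: integral_EFinM => //.
- by rewrite /accept; mfun.
- by move=> c; case: ifP.
Qed.

(** The conditional probability of rejection given [z], that is the positive part of
    [1 - phi (z + g) / phi z]. *)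
Definition reject_mass g z : R := (1 - expR (- Num.max (g * (z + g / 2)) 0))%R.

Lemma reject_mass_ge0 g z : (0 <= reject_mass g z)%R.
Proof. by rewrite subr_ge0 expR_le1 oppr_le0 le_max lexx orbT. Qed.

Lemma measurable_reject_mass g : measurable_fun setT (reject_mass g).
Proof.
rewrite /reject_mass; apply: measurable_funB; first exact: measurable_cst.
apply: (measurableT_comp (@measurable_expR _)).
apply: (measurableT_comp (@oppr_measurable _ _)).
by apply: measurable_maxr; mfun.
Qed.

Lemma reject_mass_opp g z : reject_mass g (- z)%R = reject_mass (- g)%R z.
Proof.
rewrite /reject_mass; have -> // : (g * (- z + g / 2) = - g * (z + - g / 2))%R.
by field.
Qed.

Lemma integral_reject_mass_sym g (k : R -> R) : measurable_fun setT k ->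
  (forall z, 0 <= k z)%R -> (forall z, k (- z)%R = k z) ->
  \int[N]_z (k z * reject_mass g z)%:E =
  \int[N]_z (k z * reject_mass `|g|%R z)%:E.
Proof.
move=> mk k0 kN; case: (leP 0%R g) => g0; first by rewrite ger0_norm.
have mr := @measurable_reject_mass g.
have mF : measurable_fun setT (fun z => (k z * reject_mass g z)%:E) by mfun.
have F0 z : 0 <= (k z * reject_mass g z)%:E.
  by rewrite lee_fin mulr_ge0// reject_mass_ge0.
rewrite (ltr0_norm g0).
apply: (eq_trans (esym (integral_normal_opp mF F0))).
by apply: eq_integral => z _; rewrite kN reject_mass_opp.
Qed.

(* The rejected mass is the total variation distance of two unit-variance
   Gaussians at distance [|g|], i.e. the mass of an interval of that length. *)
Lemma reject_prob_ge0 g : (0 <= g)%R -> \int[N]_z (reject_mass g z)%:E <= (g / 2)%:E.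
Proof.
move=> g0.
have mr := @measurable_reject_mass g.
have mphi := @measurable_phi R.
pose h : R := (g / 2)%R.
have h0 : (0 <= h)%R by rewrite divr_ge0.
have mF : measurable_fun setT (fun z => (reject_mass g z)%:E) by mfun.
have F0 z : 0 <= (reject_mass g z)%:E by rewrite lee_fin reject_mass_ge0.
apply: (le_trans (y := \int[mu]_z (if (- h <= z)%R && (z < h)%R then phi z else 0%R)%:E)).
  rewrite (integral_normalE mF F0).
  (* To the right of [- h] the rejected density is [phi z - phi (z + g)], and it vanishes to the
     left. Adding [U] on one side and its translate [V] on the other replaces this difference by
     sums, leaving [W], the density between [- h] and [h]. *)
  pose U z : R := if (- h <= z)%R then phi (z + g) else 0%R.
  pose V z : R := if (h <= z)%R then phi z else 0%R.
  pose W z : R := if (- h <= z)%R && (z < h)%R then phi z else 0%R.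
  have [mU mV mW] : [/\ measurable_fun setT U, measurable_fun setT V &
    measurable_fun setT W] by split; rewrite /U /V /W; mfun.
  have [U0 V0 W0] : [/\ forall z, (0 <= U z)%R, forall z, (0 <= V z)%R &
      forall z, (0 <= W z)%R].
    by split=> z; rewrite /U /V /W; case: ifP => // _; exact: phi_ge0.
  have UV : \int[mu]_z (U z)%:E = \int[mu]_z (V z)%:E.
    apply: (eq_trans _ (@ge0_integral_shift R g (fun z => (V z)%:E) _ _)).
    - apply: eq_integral => z _; congr _%:E; rewrite /U /V.
      by have -> : (h <= z + g)%R = (- h <= z)%R by apply/idP/idP; rewrite /h; lra.
    - by mfun.
    - by move=> z; rewrite lee_fin.
  have phi1 : \int[mu]_z (phi z)%:E = 1.
    by rewrite -(integral_normal_pdf (0 : R) 1); apply: eq_integral => z _; rewrite phiE.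
  have finU : \int[mu]_z (U z)%:E \is a fin_num.
    rewrite UV ge0_fin_numE; last by apply: integral_ge0 => z _; rewrite lee_fin.
    apply: (@le_lt_trans _ _ 1); last exact: ltry.
    rewrite -phi1; apply: le_integral_EFin => // z.
    by rewrite /V; case: ifP => // _; exact: phi_ge0.
  pose F z : R := (reject_mass g z * phi z)%R.
  have mFr : measurable_fun setT F by rewrite /F; mfun.
  have Fr0 z : (0 <= F z)%R by rewrite mulr_ge0 ?reject_mass_ge0 ?phi_ge0.
  have E : \int[mu]_z (F z)%:E + \int[mu]_z (U z)%:E =
           \int[mu]_z (W z)%:E + \int[mu]_z (V z)%:E.
    apply: (eq_trans (esym (integral_EFinD mu mFr mU Fr0 U0))).
    apply: (eq_trans _ (integral_EFinD mu mW mV W0 V0)).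
    apply: eq_integral => z _; congr _%:E.
    rewrite /F /U /V /W /reject_mass.
    case: (leP (- h)%R z) => hz /=.
      have t0 : (0 <= g * (z + g / 2))%R.
        by rewrite mulr_ge0//; move: hz; rewrite /h; lra.
      rewrite max_l// mulrBl mul1r.
      have -> : (expR (- (g * (z + g / 2))) * phi z = phi (z + g))%R.
        by rewrite /phi mulrCA -expRD; congr (_ * expR _)%R; field.
      by case: ltP => _; ring.
    have t0 : (g * (z + g / 2) <= 0)%R.
      by rewrite mulr_ge0_le0//; move: hz; rewrite /h; lra.
    rewrite max_r// oppr0 expR0 subrr mul0r.
    by rewrite ifF// lt_geF//; apply: lt_le_trans hz _; lra.
  rewrite -[leLHS](addeK _ finU) -[leRHS](addeK _ finU).
  by rewrite E -UV.
apply: (@le_trans _ _ (\int[mu]_z (1 / 2 * (if (- h <= z)%R && (z < h)%R then 1 else 0))%:E)).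
  apply: le_integral_EFin; [by mfun|by mfun|move=> z|move=> z]; case: ifP => _.
  - exact: phi_ge0.
  - by [].
  - rewrite mulr1; apply: (le_trans _ (@normal_peak_le_half R)).
    rewrite /phi ler_piMr ?normal_peak_ge0// expR_le1 oppr_le0 divr_ge0//.
    exact: sqr_ge0.
  - by rewrite mulr0.
rewrite integral_EFinM//; last 2 first.
- by mfun.
- by move=> z; case: ifP.
have -> : \int[mu]_z (if (- h <= z)%R && (z < h)%R then 1 else 0)%:E = g%:E.
  transitivity (\int[mu]_(z in `[(- h)%R, h[) 1).
    rewrite [RHS]integral_mkcond; apply: eq_integral => z _.
    rewrite patchE; case: ifPn => zh; first by rewrite mem_set//= in_itv.
    by rewrite memNset//= in_itv/=; exact/negP.
  rewrite integral_cst//= mul1e lebesgue_measure_itv/= lte_fin.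
  case: ltP => hh; first by rewrite -EFinB; congr _%:E; rewrite /h; field.
  by congr _%:E; move: hh; rewrite /h; lra.
by rewrite -EFinM lee_fin; lra.
Qed.

Lemma reject_prob g : \int[N]_z (reject_mass g z)%:E <= (`|g| / 2)%:E.
Proof.
have -> : \int[N]_z (reject_mass g z)%:E = \int[N]_z (1 * reject_mass `|g|%R z)%:E.
  apply: (eq_trans _ (@integral_reject_mass_sym g (fun=> 1%R) (measurable_cst _) _ _)).
  - by apply: eq_integral => z _; rewrite mul1r.
  - by [].
  - by [].
under eq_integral do rewrite mul1r.
exact: reject_prob_ge0.
Qed.

End one_step.

Section jump.
Variable R : realType.
Implicit Types (g z c t delta : R).
Local Notation N := (std_normal R).
Local Notation C := (coin_law R).
Local Notation Q := (unit_law R).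
Local Open Scope ereal_scope.

Lemma integral_unit_reflect g (f : R * R -> \bar R) :
  measurable_fun setT f -> (forall u, 0 <= f u) ->
  \int[Q]_u f (reflect_step g u) = \int[Q]_u f u.
Proof.
move=> mf f0; have mr := @measurable_reflect_step R g.
have mF : measurable_fun setT (fun u => f (reflect_step g u)) by mfun.
apply: (eq_trans (integral_unit_law mF (fun u => f0 _))).
apply: (eq_trans (integral_reflect_step g mf f0)).
exact: (esym (integral_unit_law mf f0)).
Qed.

Lemma integral_unit_fst (k : R -> R) :
  measurable_fun setT k -> (forall z, 0 <= k z)%R ->
  \int[Q]_u (k u.1)%:E = \int[N]_z (k z)%:E.
Proof.
move=> mk k0.
have mF : measurable_fun setT (fun u : R * R => (k u.1)%:E) by mfun.
have F0 (u : R * R) : 0 <= (k u.1)%:E by rewrite lee_fin.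
apply: (eq_trans (integral_unit_law mF F0)).
by apply: eq_integral => z _; exact: (integral_prob_cst C (k z)%:E).
Qed.

Definition jump g (u : R * R) : R := ((reflect_step g u).1 - u.1)%R.

Lemma measurable_jump g : measurable_fun setT (jump g).
Proof. by have mr := @measurable_reflect_step R g; rewrite /jump; mfun. Qed.

(** By [1 - expR (- t) <= t] the rejection probability is at most [g] times the positive part of
    [z], plus [g ^+ 2 / 2]; this reduces the claim to the third one-sided moment and the second
    moment. *)
Lemma sqr_reject_mass_ge0 g : (0 <= g)%R ->
  \int[N]_z (z ^+ 2 * reject_mass g z)%:E <= (g + g ^+ 2 * (25 / 49))%:E.
Proof.
move=> g0; have mr := @measurable_reject_mass R g.
apply: (@le_trans _ _ (\int[N]_z (g * (if (0 <= z)%R then z ^+ 3 else 0) +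
    g ^+ 2 / 2 * z ^+ 2)%:E)).
  apply: le_integral_EFin; [by mfun|by mfun| |] => z.
    by rewrite mulr_ge0 ?sqr_ge0// reject_mass_ge0.
  have rt : (reject_mass g z <= Num.max (g * (z + g / 2)) 0)%R.
    rewrite /reject_mass.
    by have := expR_ge1Dx (- Num.max (g * (z + g / 2)) 0)%R; lra.
  have tg : (Num.max (g * (z + g / 2)) 0 <= g * (if (0 <= z)%R then z else 0) + g ^+ 2 / 2)%R.
    rewrite ge_max; apply/andP; split.
      have : (g * z <= g * (if (0 <= z)%R then z else 0))%R.
        by apply: ler_wpM2l => //; case: (leP 0%R z) => // /ltW.
      by rewrite mulrDr expr2 mulrA; lra.
    by rewrite addr_ge0// ?divr_ge0 ?sqr_ge0// mulr_ge0//; case: (leP 0%R z).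
  apply: (le_trans (ler_wpM2l (sqr_ge0 z) (le_trans rt tg))).
  by rewrite le_eqVlt; apply/orP; left; apply/eqP; case: ifP => _; field.
rewrite integral_EFinD; last 4 first.
- by mfun.
- by mfun.
- by move=> z; rewrite mulr_ge0//; case: ifP => // z0; rewrite exprn_ge0.
- by move=> z; rewrite mulr_ge0 ?sqr_ge0// divr_ge0// sqr_ge0.
rewrite integral_EFinM; last 3 first.
- by mfun.
- by [].
- by move=> z; case: ifP => // z0; rewrite exprn_ge0.
rewrite integral_EFinM; last 3 first.
- by mfun.
- by rewrite divr_ge0// sqr_ge0.
- by move=> z; rewrite sqr_ge0.
rewrite EFinD; apply: leeD.
  rewrite -[leRHS]mule1; apply: lee_wpmul2l; first by rewrite lee_fin.
  exact: integral_normal_cube.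
apply: (@le_trans _ _ ((g ^+ 2 / 2)%:E * (50 / 49)%:E)).
  apply: lee_wpmul2l; first by rewrite lee_fin divr_ge0// sqr_ge0.
  exact: integral_normal_sqr.
by rewrite -EFinM lee_fin; lra.
Qed.

(** The jump is [g] on acceptance and [- 2 * z] on rejection. Rejections are rare, with probability
    of order [g], but displace by order one, whence a term linear in the modulus of [g]. The other
    constant is [1 + 4 * 25 / 49]. *)
Lemma jump_sqr g :
  \int[Q]_u (jump g u ^+ 2)%:E <= (4 * `|g| + 149 / 49 * g ^+ 2)%:E.
Proof.
have mj := measurable_jump g.
pose rj (u : R * R) : R := if accept (g * (u.1 + g / 2)) u.2 then 0%R else 1%R.
have mrj : measurable_fun setT rj by rewrite /rj /accept; mfun.
have rj0 u : (0 <= rj u)%R by rewrite /rj; case: ifP.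
apply: (@le_trans _ _ (\int[Q]_u (g ^+ 2 + 4 * (u.1 ^+ 2 * rj u))%:E)).
  apply: le_integral_EFin; [by mfun|by mfun|by move=> u; exact: sqr_ge0|move=> u].
  rewrite /jump /reflect_step /rj; case: ifP => _ /=.
    by rewrite !mulr0 addr0 addrAC subrr add0r.
  have -> : ((- u.1 - u.1) ^+ 2 = 4 * u.1 ^+ 2)%R by ring.
  by rewrite mulr1 lerDr; exact: sqr_ge0.
rewrite (@integral_EFinD _ _ _ Q (fun=> g ^+ 2)%R (fun u => 4 * (u.1 ^+ 2 * rj u))%R); last 4 first.
- exact: measurable_cst.
- by mfun.
- by move=> u; exact: sqr_ge0.
- by move=> u; apply: mulr_ge0 => //; apply: mulr_ge0 => //; exact: sqr_ge0.
rewrite integral_prob_cst.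
rewrite (@integral_EFinM _ _ _ Q 4%R (fun u => (u.1 ^+ 2 * rj u))%R); last 3 first.
- by mfun.
- by [].
- by move=> u; rewrite mulr_ge0 ?sqr_ge0//.
have -> : \int[Q]_u (u.1 ^+ 2 * rj u)%:E = \int[N]_z (z ^+ 2 * reject_mass g z)%:E.
  by apply: (integral_unit_reject g (k := fun z => (z ^+ 2)%R)) => [|z]; [mfun|exact: sqr_ge0].
have -> : \int[N]_z (z ^+ 2 * reject_mass g z)%:E =
    \int[N]_z (z ^+ 2 * reject_mass `|g|%R z)%:E.
  apply: (integral_reject_mass_sym g (k := fun z => (z ^+ 2)%R)) => [|z|z].
  - by mfun.
  - exact: sqr_ge0.
  - exact: sqrrN.
apply: (@le_trans _ _ ((g ^+ 2)%:E + 4%:E * (`|g| + `|g| ^+ 2 * (25 / 49))%:E)).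
  apply: leeD => //; apply: lee_wpmul2l; first by rewrite lee_fin.
  exact: sqr_reject_mass_ge0.
by rewrite -EFinM -EFinD lee_fin real_normK ?num_real//; lra.
Qed.

(** The cross term vanishes: the jump is the increment of [u.1] under the measure-preserving
    [reflect_step g], hence a coboundary. *)
Lemma jump_affine g (p q : R) :
  \int[Q]_u ((p + q * jump g u) ^+ 2)%:E =
  (p ^+ 2)%:E + (q ^+ 2)%:E * \int[Q]_u (jump g u ^+ 2)%:E.
Proof.
have mj := measurable_jump g.
have mr := @measurable_reflect_step R g.
have -> : \int[Q]_u ((p + q * jump g u) ^+ 2)%:E =
    \int[Q]_u (p ^+ 2 + q ^+ 2 * jump g u ^+ 2)%:E.
  apply: (@integral_coboundary _ _ _ Q (reflect_step g) (fun u => 2 * p * q * u.1)%R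
    (fun u => (p + q * jump g u) ^+ 2)%R (fun u => p ^+ 2 + q ^+ 2 * jump g u ^+ 2)%R).
  - exact: mr.
  - exact: integral_unit_reflect.
  - by mfun.
  - by mfun.
  - by mfun.
  - by move=> u; exact: sqr_ge0.
  - by move=> u; rewrite addr_ge0 ?sqr_ge0// mulr_ge0 ?sqr_ge0//.
  - by move=> u; rewrite /jump; ring.
  - apply: (@le_lt_trans _ _ (\int[Q]_u (`|2 * p * q| * (1 + u.1 ^+ 2))%:E)).
      apply: le_integral_EFin.
      + by apply: measurableT_comp => //; mfun.
      + by mfun.
      + by move=> u; exact: normr_ge0.
      + move=> u; rewrite normrM ler_wpM2l//.
        by have := sqr_ge0 (`|u.1| - 1)%R; have := sqr_ge0 `|u.1|%R;
           rewrite sqrrB1 !real_normK ?num_real//; lra.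
    rewrite (@integral_EFinM _ _ _ Q `|2 * p * q|%R (fun u => 1 + u.1 ^+ 2)%R); last 3 first.
    + by mfun.
    + exact: normr_ge0.
    + by move=> u; rewrite addr_ge0 ?sqr_ge0//.
    rewrite (@integral_unit_fst (fun z => 1 + z ^+ 2)%R); last 2 first.
    + by mfun.
    + by move=> z; rewrite addr_ge0 ?sqr_ge0//.
    rewrite (@integral_EFinD _ _ _ N (fun=> 1)%R (fun z => z ^+ 2)%R); last 4 first.
    + exact: measurable_cst.
    + by mfun.
    + by [].
    + by move=> z; exact: sqr_ge0.
    apply: (@le_lt_trans _ _ (`|2 * p * q|%:E * (1 + (50 / 49)%:E))).
      apply: lee_wpmul2l; first by rewrite lee_fin.
      rewrite integral_prob_cst; apply: leeD => //; exact: integral_normal_sqr.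
    by rewrite -EFinD -EFinM ltry.
rewrite (@integral_EFinD _ _ _ Q (fun=> p ^+ 2)%R (fun u => q ^+ 2 * jump g u ^+ 2)%R); last 4 first.
- exact: measurable_cst.
- by mfun.
- by move=> u; exact: sqr_ge0.
- by move=> u; rewrite mulr_ge0 ?sqr_ge0//.
rewrite integral_prob_cst (@integral_EFinM _ _ _ Q (q ^+ 2)%R (fun u => jump g u ^+ 2)%R)//.
- by mfun.
- exact: sqr_ge0.
- by move=> u; exact: sqr_ge0.
Qed.

End jump.

(** * Recursion for the number of moved coordinates *)

Section cost.
Variable R : realType.
Implicit Types (c r t delta : R).
Local Notation N := (std_normal R).
Local Notation Q := (unit_law R).

(** Coins are left out of the comparison: an accepted coordinate has its coin lowered, but this does
    not show in the data. *)
Definition moved n delta (p : n.-tuple (R * R)) (i : 'I_n) : bool :=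
  (tnth p i).1 != (tnth (shift_sum delta p) i).1.

Definition cost n delta (p : n.-tuple (R * R)) : R :=
  \sum_(i < n) (if moved delta p i then 1 else 0).

Lemma cost_ge0 n delta (p : n.-tuple (R * R)) : 0 <= cost delta p.
Proof. by apply: sumr_ge0 => i _; case: ifP. Qed.

Lemma cost_le n delta (p : n.-tuple (R * R)) : cost delta p <= n%:R.
Proof.
rewrite -[n in leRHS]card_ord -sumr_const; apply: ler_sum => i _.
by case: ifP.
Qed.

Lemma cost_tcons n delta x c (q : n.-tuple (R * R)) :
  let m := (x + xsum q - delta / 2) / n.+1%:R in
  let t := delta * (x - m) / n%:R in
  cost delta (tcons ((x, c), q)) <=
  if (0 < n)%N && accept t c then cost delta q
  else 1 + cost (delta - 2 * (x - m)) q.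
Proof.
cbv zeta; set m := (x + xsum q - delta / 2) / n.+1%:R.
set t := delta * (x - m) / n%:R; rewrite /cost big_ord_recl /moved shift_sum_tcons -/m -/t.
case: ((0 < n)%N && accept t c) => /=.
- rewrite eqxx /= add0r.
  by under eq_bigr do rewrite !tnth_tconsS.
- apply: lerD; first by case: ifP.
  by under eq_bigr do rewrite !tnth_tconsS.
Qed.

Lemma measurable_moved n (i : 'I_n) :
  measurable_fun setT (fun u : R * n.-tuple (R * R) => moved u.1 u.2 i).
Proof.
have ms := @measurable_shift_sum R n.
have mt : measurable_fun setT (fun p : n.-tuple (R * R) => tnth p i).
  exact: measurable_tnth.
rewrite /moved; apply: measurable_neg; apply: measurable_fun_eqr.
- apply: (measurableT_comp measurable_fst).
  by apply: (measurableT_comp mt); exact: measurable_snd.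
- apply: (measurableT_comp measurable_fst).
  by apply: (measurableT_comp mt).
Qed.

Lemma measurable_cost n :
  measurable_fun setT (fun u : R * n.-tuple (R * R) => cost u.1 u.2).
Proof.
apply: measurable_sum => i; have mi := measurable_moved i.
by apply: measurable_fun_ifT; [exact: mi|exact: measurable_cst|exact: measurable_cst].
Qed.

Local Open Scope ereal_scope.

Lemma measurable_cost_spread n r delta :
  measurable_fun setT (fun p : n.-tuple (R * R) => (cost delta (spread r p))%:E).
Proof.
apply/measurable_EFinP.
apply: (measurableT_comp (@measurable_cost n) (g := fun p => (delta, spread r p))).
apply: measurable_fun_pair; first exact: measurable_cst.
apply: (measurableT_comp (@measurable_spread R n) (g := fun p => (r, p))).
by mfun.
Qed.

(** The first term bounds the probability that the head moves; the rest is the assumed bound for the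
    tail, applied to the shift handed on and averaged over the head. With [y = b * g] and
    [b ^+ 2 * delta = n%:R * y], everything is expressed by [y]. *)
Lemma cost_step n (q p : R) : (0 < n)%N -> (0 <= q)%R -> (0 <= p)%R ->
  (forall r delta, \int[iid Q n]_s (cost delta (spread r s))%:E <=
     (q * delta ^+ 2 + p)%:E) ->
  forall r delta,
  let b := (Num.sqrt n%:R / Num.sqrt n.+1%:R)%R in
  let y := (delta / n.+1%:R)%R in
  \int[iid Q n.+1]_s (cost delta (spread r s))%:E <=
  (`|y| / (2 * b) + p + q * (n%:R ^+ 2 * y ^+ 2 +
     (4 * b * `|y| + 149 / 49 * y ^+ 2)))%:E.
Proof.
move=> n0 q0 p0 IH r delta; cbv zeta.
set b : R := (Num.sqrt n%:R / Num.sqrt n.+1%:R)%R.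
set y : R := (delta / n.+1%:R)%R.
have [a0 ab nE snE] := spread_coefs R n.
set a : R := ((Num.sqrt n.+1%:R)^-1)%R in a0 ab nE snE.
rewrite -/b in ab snE.
have b0 : (0 < b)%R by rewrite divr_gt0// sqrtr_gt0 ltr0n.
have an0 : a != 0%R by rewrite gt_eqF.
have bn0 : b != 0%R by rewrite gt_eqF.
have nE' : (n%:R = (b / a) ^+ 2 :> R)%R by rewrite -snE sqr_sqrtr ?ler0n.
pose g := (a ^+ 2 * delta / b)%R.
have yE : y = (g * b)%R by rewrite /y /g nE; field; rewrite an0 bn0.
have mc : measurable_fun setT (@tcons _ (R * R)%type n) by exact: measurable_tcons.
have mcs := @measurable_cost_spread.
have mj := measurable_jump g.
pose rj (u : R * R) : R :=
  (1 * if accept (g * (u.1 + g / 2)) u.2 then 0 else 1)%R.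
have mrj : measurable_fun setT rj by rewrite /rj /accept; mfun.
have rj0 u : (0 <= rj u)%R by rewrite /rj mul1r; case: ifP.
(* The shift handed to the tail, in one formula for both branches: it is [delta] on acceptance,
   since [b * g = a ^+ 2 * delta], and [delta - 2 * (x - m)] on rejection. *)
pose D (u : R * R) : R := (b ^+ 2 * delta + b * jump g u)%R.
have mD : measurable_fun setT D by rewrite /D; mfun.
have cs0 s : 0 <= (cost delta (spread r s))%:E by rewrite lee_fin cost_ge0.
have mF : measurable_fun setT (fun u : (R * R) * n.-tuple (R * R) =>
    (cost delta (spread r (tcons u)))%:E).
  exact: (measurableT_comp (@mcs n.+1 r delta) mc).
rewrite (integral_iidS Q (mcs n.+1 r delta) (cs0 _)).
apply: (@le_trans _ _ (\int[Q]_u (rj u + (p + q * D u ^+ 2))%:E)).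
  apply: ge0_le_integral; first exact: measurableT.
  - by move=> u _; apply: integral_ge0 => s _; rewrite lee_fin cost_ge0.
  - apply: (measurable_integral2 (iid Q n) mF) => u.
    by rewrite lee_fin cost_ge0.
  - by mfun.
  move=> [z c] _.
  pose x := (a * r + b * z)%R.
  pose m := (a * r - a ^+ 2 * delta / 2)%R.
  pose t := (g * (z + g / 2))%R.
  pose w := (b * r - a * z)%R.
  apply: (@le_trans _ _ (\int[iid Q n]_s (if accept t c then cost delta (spread w s)
      else 1 + cost (delta - 2 * (x - m)) (spread w s))%:E)).
    apply: ge0_le_integral; first exact: measurableT.
    - by move=> s _; rewrite lee_fin cost_ge0.
    - apply: (measurableT_comp (mcs n.+1 r delta)
        (g := fun s => @tcons _ (R * R)%type n ((z, c), s))).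
      by mfun.
    - case: (accept t c); first exact: mcs.
      have := mcs n w (delta - 2 * (x - m))%R => h.
      under eq_fun do rewrite EFinD.
      by apply: emeasurable_funD => //; exact: measurable_cst.
    move=> s _; rewrite lee_fin spread_tcons.
    apply: (le_trans (cost_tcons _ _ _ _)).
    rewrite n0 xsum_spread -/a -/b -/x -/w /=.
    have -> : ((x + Num.sqrt n%:R * w - delta / 2) / n.+1%:R = m)%R.
      rewrite snE nE /x /m /w.
      have -> : (a * r + b * z + b / a * (b * r - a * z) = (a ^+ 2 + b ^+ 2) * r / a)%R.
        by field.
      by rewrite ab; field.
    have -> // : (delta * (x - m) / n%:R = t)%R.
    by rewrite nE' /x /m /t /g; field; rewrite an0 bn0.
  rewrite /rj /D /jump /reflect_step /= -/t mul1r.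
  case: (accept t c) => /=.
    apply: (le_trans (IH w delta)); rewrite lee_fin add0r addrC lerD2l.
    have -> // : (b ^+ 2 * delta + b * (z + g - z) = delta)%R.
    rewrite -[RHS]mul1r -ab /g; field; by [].
  rewrite (@integral_EFinD _ _ _ (iid Q n) (fun=> 1%R)
    (fun s => cost (delta - 2 * (x - m))%R (spread w s))); last 4 first.
  - exact: measurable_cst.
  - by apply/measurable_EFinP; exact: mcs.
  - by [].
  - by move=> s; exact: cost_ge0.
  rewrite integral_prob_cst [leRHS]EFinD; apply: leeD => //.
  apply: (le_trans (IH w _)); rewrite lee_fin addrC lerD2l.
  have -> // : (delta - 2 * (x - m) = b ^+ 2 * delta + b * (- z - z))%R.
  have -> : (b ^+ 2 = 1 - a ^+ 2)%R by rewrite -ab addrAC subrr add0r.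
  by rewrite /x /m; field.
rewrite integral_EFinD; last 4 first.
- exact: mrj.
- by mfun.
- exact: rj0.
- by move=> u; apply: addr_ge0 => //; apply: mulr_ge0 => //; exact: sqr_ge0.
rewrite (@integral_EFinD _ _ _ Q (fun=> p) (fun u => q * D u ^+ 2)%R); last 4 first.
- exact: measurable_cst.
- by mfun.
- by [].
- by move=> u; apply: mulr_ge0 => //; exact: sqr_ge0.
rewrite (@integral_EFinM _ _ _ Q q (fun u => D u ^+ 2)%R); last 3 first.
- by mfun.
- exact: q0.
- by move=> u; exact: sqr_ge0.
rewrite integral_prob_cst.
have I1 : \int[Q]_u (rj u)%:E <= (`|y| / (2 * b))%:E.
  apply: (@le_trans _ _ (`|g| / 2)%:E).
    have -> : \int[Q]_u (rj u)%:E = \int[N]_z (reject_mass g z)%:E.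
      apply: (eq_trans (integral_unit_reject g (k := fun=> 1%R) (measurable_cst _) (fun=> ler01))).
      by apply: eq_integral => z _; rewrite mul1r.
    exact: reject_prob.
  rewrite lee_fin yE (normrM g b) (gtr0_norm b0) le_eqVlt; apply/orP; left; apply/eqP.
  by field.
apply: (@le_trans _ _ ((`|y| / (2 * b))%:E + (p%:E +
    q%:E * (n%:R ^+ 2 * y ^+ 2 + (4 * b * `|y| + 149 / 49 * y ^+ 2))%:E))); last first.
  by rewrite -EFinM -!EFinD addrA.
apply: leeD => //; apply: leeD => //; apply: lee_wpmul2l; first by rewrite lee_fin.
rewrite jump_affine.
apply: (@le_trans _ _ (((b ^+ 2 * delta) ^+ 2)%:E +
   (b ^+ 2)%:E * (4 * `|g| + 149 / 49 * g ^+ 2)%:E)).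
  apply: leeD => //; apply: lee_wpmul2l; first by rewrite lee_fin sqr_ge0.
  exact: jump_sqr.
rewrite -EFinM -EFinD lee_fin yE (normrM g b) (gtr0_norm b0) nE' le_eqVlt.
apply/orP; left; apply/eqP; rewrite /g; field.
by rewrite an0 bn0.
Qed.

End cost.

Section expected_cost.
Variable R : realType.
Implicit Types (r delta : R).
Local Notation N := (std_normal R).
Local Notation Q := (unit_law R).

Section potential.
Variables (d k0 : nat).
Hypothesis d16 : (16 <= d)%N.
Let s : R := Num.sqrt d%:R.
Hypothesis sk : s <= k0%:R.

(* Potential for the induction on the dimension: for a shift [delta] of [n >= k0]
   coordinates, at most [pot_q n * delta ^ 2 + pot_p n] of them move on average,
   where [k0] is about [sqrt d]; below [k0] the trivial bound [n] is used. *)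
Definition pot_q n : R := Num.sqrt d%:R / 5 * (n%:R - k0%:R) / n%:R ^+ 2.
Definition pot_p n : R := k0%:R + (n%:R - k0%:R) / Num.sqrt d%:R.

Lemma sqrt_ge4 : 4 <= s.
Proof.
have -> : 4 = Num.sqrt (4 ^+ 2 : R) by rewrite sqrtr_sqr ger0_norm.
rewrite ler_wsqrtr// -natrX ler_nat; exact: d16.
Qed.

(** From [n] to [n.+1] the quadratic part of the potential gains [s / 5 * Y ^+ 2] and the constant
    part gains [s^-1]. Of the first, [s / 25 * Y ^+ 2] pays for the quadratic error of the step; the
    remainder and [s^-1] pay, by the inequality of the means, for the linear terms. *)
Lemma pot_step n (b y : R) : (k0 <= n)%N -> 0 < b -> b ^+ 2 = n%:R / n.+1%:R ->
  `|y| / (2 * b) + pot_p n + pot_q n * (n%:R ^+ 2 * y ^+ 2 +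
     (4 * b * `|y| + 149 / 49 * y ^+ 2)) <=
  pot_q n.+1 * (n.+1%:R * y) ^+ 2 + pot_p n.+1.
Proof.
move=> kn b0 b2; have s4 := sqrt_ge4.
have knR : k0%:R <= n%:R :> R by rewrite ler_nat.
have sk_ := sk; have n4 : 4 <= n%:R :> R by apply: le_trans s4 (le_trans sk_ knR).
have n0 : n%:R != 0 :> R by rewrite gt_eqF//; lra.
have n10 : n.+1%:R != 0 :> R by rewrite pnatr_eq0.
have s0 : s != 0 by rewrite gt_eqF//; lra.
have n1E : n.+1%:R = n%:R + 1 :> R by rewrite -natr1.
rewrite -(real_normK (num_real y)); set Y := `|y|; have Y0 : 0 <= Y by exact: normr_ge0.
rewrite exprMn -(real_normK (num_real y)) -/Y.
(* The left side is largest at [n = 2 * k0], where it is [1 / (4 * k0)]; this is what keeps [pot_q]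
   below [1 / 20] in all dimensions. *)
have w1 : (n%:R - k0%:R) / n%:R ^+ 2 <= (4 * s)^-1.
  rewrite ler_pdivrMr ?exprn_gt0//; last by lra.
  rewrite mulrC ler_pdivlMr; last by lra.
  have := sqr_ge0 (n%:R - 2 * k0%:R : R); nra.
have w0 : 0 <= (n%:R - k0%:R) / n%:R ^+ 2 :> R.
  by rewrite divr_ge0 ?subr_ge0// sqr_ge0.
have q0 : 0 <= pot_q n by rewrite /pot_q -mulrA mulr_ge0// divr_ge0// sqrtr_ge0.
have q1 : pot_q n <= 1 / 20.
  rewrite /pot_q -/s -mulrA; apply: le_trans (ler_wpM2l _ w1) _; first by lra.
  by rewrite le_eqVlt; apply/orP; left; apply/eqP; field.
have q2 : pot_q n <= s / 80 by apply: (le_trans q1); lra.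
have b45 : 4 / 5 <= b ^+ 2.
  by rewrite b2 n1E ler_pdivlMr; lra.
have b1 : b ^+ 2 <= 1 by rewrite b2 n1E ler_pdivrMr; lra.
have b1' : b <= 1 by rewrite -(@ler_pXn2r _ 2)// ?nnegrE ?expr1n// ltW.
have b89 : 8 / 9 <= b.
  rewrite -(@ler_pXn2r _ 2)// ?nnegrE ?(ltW b0)//; first by lra.
have t1 : Y / (2 * b) <= 57 / 100 * Y.
  rewrite mulrC ler_wpM2r// -[leRHS]invrK lef_pV2 ?posrE; last 2 first.
  - by rewrite mulr_gt0.
  - by lra.
  by lra.
have t2 : pot_q n * (4 * b * Y) <= 1 / 5 * Y.
  have -> : pot_q n * (4 * b * Y) = pot_q n * b * (4 * Y) by ring.
  apply: (@le_trans _ _ (1 / 20 * (4 * Y))); last by lra.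
  rewrite ler_wpM2r ?mulr_ge0//.
  by rewrite -[leRHS]mulr1 ler_pM// ltW.
have t3 : pot_q n * (149 / 49 * Y ^+ 2) <= s * (1 / 25) * Y ^+ 2.
  rewrite mulrA ler_wpM2r ?sqr_ge0//; lra.
have e1 : pot_q n * (n%:R ^+ 2 * Y ^+ 2) = s / 5 * (n%:R - k0%:R) * Y ^+ 2.
  by rewrite /pot_q -/s; field.
have e2 : pot_q n.+1 * (n.+1%:R ^+ 2 * Y ^+ 2) =
    s / 5 * (n%:R - k0%:R) * Y ^+ 2 + s / 5 * Y ^+ 2.
  by rewrite /pot_q -/s n1E; field; rewrite -n1E.
have e3 : pot_p n.+1 = pot_p n + s^-1 by rewrite /pot_p -/s n1E; field.
rewrite !mulrDr e1 e2 e3.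
(* On the left [77 / 100] is [57 / 100 + 1 / 5], from [t1] and [t2]; on the right [4 / 25] is
   [1 / 5 - 1 / 25]. Completing the square leaves [4 / 5 * Y]. *)
have key : 77 / 100 * Y <= s * (4 / 25) * Y ^+ 2 + s^-1.
  have -> : s * (4 / 25) * Y ^+ 2 + s^-1 =
     (2 / 5 * (s * Y) - 1) ^+ 2 / s + 4 / 5 * Y by field.
  have : 0 <= (2 / 5 * (s * Y) - 1) ^+ 2 / s by rewrite divr_ge0 ?sqr_ge0//; lra.
  lra.
have Y2 : 0 <= s * Y ^+ 2 by rewrite mulr_ge0 ?sqr_ge0//; lra.
lra.
Qed.

Local Open Scope ereal_scope.

Lemma cost_potential n : (k0 <= n)%N -> forall r delta,
  \int[iid Q n]_p (cost delta (spread r p))%:E <=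
  (pot_q n * delta ^+ 2 + pot_p n)%:E.
Proof.
have s4 := sqrt_ge4.
have k4 : (4 <= k0%:R :> R)%R by apply: le_trans s4 sk.
have k00 : (0 < k0)%N by rewrite -(ltr_nat R); apply: lt_le_trans k4.
have q0 m : (k0 <= m)%N -> (0 <= pot_q m)%R.
  move=> kn; rewrite /pot_q; apply: divr_ge0; last exact: sqr_ge0.
  by apply: mulr_ge0; [rewrite divr_ge0// sqrtr_ge0|rewrite subr_ge0 ler_nat].
have p0 m : (k0 <= m)%N -> (0 <= pot_p m)%R.
  by move=> kn; rewrite /pot_p addr_ge0// divr_ge0 ?sqrtr_ge0// subr_ge0 ler_nat.
elim: n => [|n IH] kn r delta; first by move: kn; rewrite leqNgt k00.
move: kn; rewrite leq_eqVlt => /predU1P[kE|kn].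
  apply: (@le_trans _ _ (\int[iid Q n.+1]_p (n.+1%:R)%:E)).
    apply: ge0_le_integral; first exact: measurableT.
    - by move=> p _; rewrite lee_fin cost_ge0.
    - exact: measurable_cost_spread.
    - exact: measurable_cst.
    - by move=> p _; rewrite lee_fin cost_le.
  rewrite integral_prob_cst lee_fin /pot_q /pot_p -kE subrr.
  by rewrite !mulr0 !mul0r add0r addr0.
apply: (le_trans (cost_step (leq_trans k00 kn) (q0 _ kn) (p0 _ kn) (IH kn) r delta)).
have [a0 ab nE snE] := spread_coefs R n.
rewrite lee_fin; set y : R := (delta / n.+1%:R)%R.
have -> : (delta = n.+1%:R * y)%R by rewrite /y mulrC divfK// pnatr_eq0.
apply: pot_step => //.
- by rewrite divr_gt0// sqrtr_gt0 ltr0n// (leq_trans k00 kn).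
- by rewrite expr_div_n !sqr_sqrtr.
Qed.

End potential.

Local Open Scope ereal_scope.

(** Given [r] the shift is [2 * s * r], so the quadratic part of the potential contributes about
    [4 / 5 * s]. The constant part contributes about [2 * s]: one [s] from [k0] and one from the
    increments [s^-1] over the other coordinates. *)
Lemma expected_cost n : (15 <= n)%N ->
  \int[iid Q n.+1]_p (cost (2 * xsum p)%R p)%:E <= (3 * Num.sqrt n.+1%:R)%:E.
Proof.
move=> n15; set s : R := Num.sqrt n.+1%:R.
have s4 : (4 <= s)%R by apply: sqrt_ge4.
pose k0 := (Num.truncn s).+1.
have sk : (s <= k0%:R)%R by rewrite ltW// truncnS_gt.
have ks : (k0%:R <= s + 1)%R.
  by rewrite -natr1 lerD2r truncn_le//; lra.
have s2 : (s ^+ 2 = n.+1%:R)%R by rewrite sqr_sqrtr.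
have kn : (k0 <= n.+1)%N.
  by rewrite -(ler_nat R) -s2; apply: (le_trans ks); rewrite expr2; nra.
have mx := @measurable_xsum R n.+1.
have mF : measurable_fun setT (fun p : n.+1.-tuple (R * R) =>
    (cost (2 * xsum p)%R p)%:E).
  apply/measurable_EFinP.
  apply: (measurableT_comp (@measurable_cost R n.+1) (g := fun p => ((2 * xsum p)%R, p))).
  by mfun.
have F0 (p : n.+1.-tuple (R * R)) : 0 <= (cost (2 * xsum p)%R p)%:E.
  by rewrite lee_fin cost_ge0.
rewrite -(integral_spread mF F0).
pose q := pot_q n.+1 k0 n.+1; pose c := pot_p n.+1 k0 n.+1.
have q0 : (0 <= q)%R.
  rewrite /q /pot_q; apply: divr_ge0; last exact: sqr_ge0.
  by apply: mulr_ge0; [rewrite divr_ge0// sqrtr_ge0|rewrite subr_ge0 ler_nat].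
have c0 : (0 <= c)%R.
  by rewrite /c /pot_p addr_ge0// divr_ge0 ?sqrtr_ge0// subr_ge0 ler_nat.
apply: (@le_trans _ _ (\int[N]_r (4 * q * s ^+ 2 * r ^+ 2 + c)%:E)).
  apply: ge0_le_integral; first exact: measurableT.
  - by move=> r _; apply: integral_ge0.
  - apply: (measurable_integral2 (iid Q n.+1) (f := fun u : R * n.+1.-tuple (R * R) =>
      (cost (2 * xsum (spread u.1 u.2))%R (spread u.1 u.2))%:E)) => // .
    by apply: (measurableT_comp mF); exact: measurable_spread.
  - by mfun.
  move=> r _.
  apply: (@le_trans _ _ (\int[iid Q n.+1]_p (cost (2 * (s * r))%R (spread r p))%:E)).
    apply: ge0_le_integral; first exact: measurableT.
    - by move=> p _; exact: F0.
    - apply: (measurableT_comp mF).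
      apply: (measurableT_comp (@measurable_spread R n.+1) (g := fun p => (r, p))).
      by mfun.
    - exact: measurable_cost_spread.
    - by move=> p _; rewrite xsum_spread.
  apply: (le_trans (@cost_potential n.+1 k0 n15 sk n.+1 kn r _)).
  by rewrite lee_fin -/q -/c le_eqVlt; apply/orP; left; apply/eqP; ring.
have A0 : (0 <= 4 * q * s ^+ 2)%R by rewrite mulr_ge0 ?sqr_ge0// mulr_ge0.
rewrite (@integral_EFinD _ _ _ N (fun r => 4 * q * s ^+ 2 * r ^+ 2)%R (fun=> c)); last 4 first.
- by mfun.
- exact: measurable_cst.
- by move=> r; rewrite mulr_ge0// sqr_ge0.
- by [].
rewrite (@integral_EFinM _ _ _ N (4 * q * s ^+ 2)%R (fun r => r ^+ 2)%R); last 3 first.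
- by mfun.
- exact: A0.
- by move=> r; exact: sqr_ge0.
rewrite integral_prob_cst.
apply: (@le_trans _ _ ((4 * q * s ^+ 2)%:E * (50 / 49)%:E + c%:E)).
  apply: leeD => //; apply: lee_wpmul2l; first by rewrite lee_fin.
  exact: integral_normal_sqr.
rewrite -EFinM -EFinD lee_fin.
have s0 : (s != 0)%R by rewrite gt_eqF//; lra.
have -> : (4 * q * s ^+ 2 = 4 / 5 * (s - k0%:R / s))%R.
  by rewrite /q /pot_q -/s -s2; field.
have -> : (c = k0%:R + s - k0%:R / s)%R by rewrite /c /pot_p -/s -s2; field.
have : (1 <= k0%:R / s)%R by rewrite ler_pdivlMr ?mul1r//; lra.
by move: (k0%:R / s)%R => v v1; lra.
Qed.

End expected_cost.

(** * Spreading and concentration *)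

Section shifts.
Variable R : realType.

Lemma exists_le_mean (I : finType) (F : I -> R) (x : R) :
  (0 < #|I|)%N -> \sum_i F i <= #|I|%:R * x -> exists i, F i <= x.
Proof.
move=> I0 le; have [//|no] := pselect (exists i, F i <= x).
have lt i : x < F i by rewrite ltNge; apply/negP => h; apply: no; exists i.
have [i0 _] : exists i0, i0 \in I by apply/card_gt0P.
move: le; rewrite leNgt => /negP; case.
have -> : #|I|%:R * x = \sum_(i : I) x by rewrite sumr_const mulr_natl.
rewrite (bigD1 i0)//= [ltRHS](bigD1 i0)//=.
by apply: ltr_leD => //; apply: ler_sum => i _; exact: ltW.
Qed.

(** For uniform independent shifts the factors are independent with mean at most [x]. What is
    averaged is the sum over all columns of the exponential-moment bounds, so that one fixed [J]
    serves every column at once. *)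
Lemma exists_shifts n d (F : 'I_d.+1 -> R) (x : R) :
  (forall k, 0 <= F k) -> \sum_k F k <= d.+1%:R * x ->
  exists J : {ffun 'I_n -> 'I_d.+1},
    \sum_(j < d.+1) \prod_(i < n) F (j + J i) <= d.+1%:R * x ^+ n.
Proof.
move=> F0 Fx; apply: exists_le_mean; first by rewrite card_ffun card_ord expn_gt0.
rewrite exchange_big /=.
have row (j : 'I_d.+1) : \sum_(J : {ffun 'I_n -> 'I_d.+1}) \prod_(i < n) F (j + J i) <=
    (d.+1%:R * x) ^+ n.
  rewrite -(bigA_distr_bigA (fun (i : 'I_n) k => F (j + k))) /=.
  have -> : \sum_k F (j + k) = \sum_k F k.
    by rewrite [RHS](reindex_inj (addrI j)).
  rewrite prodr_const card_ord lerXn2r// ?nnegrE; first exact: sumr_ge0.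
  by apply: le_trans Fx; exact: sumr_ge0.
apply: le_trans (ler_sum _ (fun j _ => row j)) _.
rewrite sumr_const card_ord card_ffun !card_ord natrX exprMn -[leLHS]mulr_natl.
by rewrite mulrCA.
Qed.

End shifts.

Section chernoff.
Local Open Scope ereal_scope.
Context dT (T : measurableType dT) (R : realType) (P : probability T R).

(** The slope [15 / 49] is an upper bound for [expR (1 / 4) - 1], as [expR (1 / 8) <= 8 / 7] follows
    from [7 / 8 <= expR (- (1 / 8))]. *)
Lemma integral_expR_bool (m : T -> bool) : measurable_fun setT m ->
  \int[P]_t (expR (1 / 4 * (m t)%:R))%:E <=
  (1 + 15 / 49 * fine (\int[P]_t (if m t then 1 else 0)%:E))%R%:E.
Proof.
move=> mm.
have e64 : (expR (1 / 4) <= 64 / 49 :> R)%R.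
  have -> : (1 / 4 = 1 / 8 + 1 / 8 :> R)%R by lra.
  rewrite expRD.
  have h : (expR (1 / 8) <= 8 / 7 :> R)%R.
    have e0 : (0 < expR (- (1 / 8)) :> R)%R := expR_gt0 _.
    have e1 : (7 / 8 <= expR (- (1 / 8)) :> R)%R.
      by have := expR_ge1Dx (- (1 / 8) : R)%R; lra.
    rewrite -[X in expR X]opprK expRN -[leRHS]invrK lef_pV2 ?posrE//.
    by lra.
  apply: (@le_trans _ _ ((8 / 7) * (8 / 7)))%R; last by lra.
  by rewrite ler_pM// expR_ge0.
have m1 : measurable_fun setT (fun t => (if m t then 1 else 0 : R)%R) by mfun.
have fin : \int[P]_t (if m t then 1 else 0)%R%:E \is a fin_num.
  rewrite ge0_fin_numE; last by apply: integral_ge0 => t _; rewrite lee_fin; case: ifP.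
  apply: (@le_lt_trans _ _ (\int[P]_t 1%:E)); last first.
    by rewrite integral_prob_cst ltry.
  apply: le_integral_EFin => //; first by move=> t; case: ifP.
  by move=> t; case: ifP.
apply: (@le_trans _ _ (\int[P]_t (1 + 15 / 49 * (if m t then 1 else 0))%:E)).
  apply: le_integral_EFin; [|by mfun|by move=> t; exact: expR_ge0|].
    rewrite (_ : (fun t => _) = (fun t => if m t then expR (1 / 4) else expR 0)%R).
      by mfun.
    by apply/funext => t; case: (m t); rewrite ?mulr1 ?mulr0.
  by move=> t; case: (m t); rewrite ?mulr1 ?mulr0 ?expR0; lra.
rewrite (@integral_EFinD _ _ _ P (fun=> 1)%R (fun t => 15 / 49 * (if m t then 1 else 0))%R); last 4 first.
- exact: measurable_cst.
- by mfun.
- by [].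
- by move=> t; case: ifP => _; lra.
rewrite (@integral_EFinM _ _ _ P (15 / 49)%R (fun t => (if m t then 1 else 0))%R); last 3 first.
- by mfun.
- by lra.
- by move=> t; case: ifP => _; lra.
by rewrite integral_prob_cst -[X in _ * X]fineK// -EFinM -EFinD.
Qed.

Lemma chernoff n (m : 'I_n -> T -> bool) (x : R) :
  (forall i, measurable_fun setT (m i)) ->
  iid P n [set t | (x < \sum_(i < n) (if m i (tnth t i) then 1 else 0))%R] <=
  (expR (- (x / 4)) *
   \prod_(i < n) (1 + 15 / 49 * fine (\int[P]_t (if m i t then 1 else 0)%:E)))%:E.
Proof.
move=> mm.
have mt (i : 'I_n) : measurable_fun setT (fun t : n.-tuple T => m i (tnth t i)).
  by apply: (measurableT_comp (mm i)); exact: measurable_tnth.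
have mS : measurable_fun setT (fun t : n.-tuple T =>
    (\sum_(i < n) (if m i (tnth t i) then 1 else 0 : R))%R).
  by apply: measurable_sum => i; have mi := mt i; mfun.
set E := [set t | _].
have mE : measurable E.
  by rewrite -[E]setTI; apply: (measurable_fun_ltr (measurable_cst x) mS).
pose u i t : \bar R := (expR (1 / 4 * (m i t)%:R))%:E.
have mu i : measurable_fun setT (u i).
  rewrite /u (_ : (fun t => _) = (fun t => (if m i t then expR (1 / 4) else expR 0)%:E)).
    by have mi := mm i; mfun.
  by apply/funext => t; case: (m i t); rewrite ?mulr1 ?mulr0.
have u0 i t : 0 <= u i t by rewrite lee_fin expR_ge0.
apply: (@le_trans _ _ (\int[iid P n]_t ((expR (- (x / 4)))%:E *
    \big[*%E/1]_(i < n) u i (tnth t i)))).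
  rewrite -(setIT E) -integral_indic//; apply: ge0_le_integral => //.
  - by apply/measurable_EFinP; exact: measurable_indic.
  - apply: emeasurable_funM; first exact: measurable_cst.
    exact: measurable_prod_tnth.
  move=> t _; rewrite /u prodEFin -EFinM lee_fin -expR_sum -expRD indicE.
  case: (boolP (t \in E)) => [/set_mem|_]; last by rewrite expR_ge0.
  rewrite /E /= -mulr_sumr => lt.
  rewrite -[X in (X <= _)%R]expR0 ler_expR.
  have -> : (\sum_(i < n) (m i (tnth t i))%:R =
      \sum_(i < n) (if m i (tnth t i) then 1 else 0) :> R)%R.
    by apply: eq_bigr => i _; case: (m i _).
  by lra.
rewrite ge0_integralZl//; last 2 first.
- exact: measurable_prod_tnth.
- by move=> t _; exact: prod_ge0.
rewrite integral_iid_prod// EFinM -prodEFin.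
apply: lee_wpmul2l; first by rewrite lee_fin expR_ge0.
have ui i : 0 <= \int[P]_x u i x by exact: integral_ge0.
suff [] : 0 <= \big[*%E/1]_(i < n) \int[P]_x u i x /\ \big[*%E/1]_(i < n) \int[P]_x u i x <=
    \big[*%E/1]_(i < n) (1 + 15 / 49 * fine (\int[P]_t (if m i t then 1 else 0)%:E))%R%:E.
  by [].
elim/big_ind2: _ => [//|a a' b b' [a0 aa] [b0 bb]|i _].
  by split; [exact: mule_ge0|exact: lee_pmul].
by split; [exact: ui|exact: integral_expR_bool].
Qed.

End chernoff.

(** * Coding a countable family of reals in one real *)

Section cantor_code.
Variable R : realType.
Local Open Scope ereal_scope.

(** With the digits [0] and [2] in base three the expansion is unique and the codes with different
    leading digits are separated by a gap around [1 / 2], so each digit is read off by one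
    comparison; binary digits would be ambiguous at dyadic points. *)
Definition ternary (b : nat -> bool) k : \bar R :=
  (if b k then 2 / 3 ^+ k.+1 else 0 : R)%:E.

Definition ecode (b : nat -> bool) : \bar R := \sum_(0 <= k <oo) ternary b k.

Lemma ternary_ge0 b k : 0 <= ternary b k.
Proof. by rewrite lee_fin; case: ifP => // _; rewrite divr_ge0// exprn_ge0. Qed.

Lemma ecode_ge0 b : 0 <= ecode b.
Proof. by apply: nneseries_ge0 => k _ _; exact: ternary_ge0. Qed.

Lemma ecode_le1 b : ecode b <= 1.
Proof.
apply: lime_le.
  by apply: is_cvg_nneseries => k _ _; exact: ternary_ge0.
apply: nearW => n; apply: (@le_trans _ _ (1 - 3 ^- n : R)%:E); last first.
  by rewrite lee_fin gerBl invr_ge0 exprn_ge0.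
elim: n => [|n IHn]; first by rewrite big_nil expr0 invr1 subrr.
rewrite big_nat_recr//=.
apply: (@le_trans _ _ ((1 - 3 ^- n)%:E + (2 / 3 ^+ n.+1 : R)%:E)).
  apply: leeD => //; rewrite lee_fin; case: ifP => _ //.
rewrite -EFinD lee_fin le_eqVlt; apply/orP; left; apply/eqP.
have : (3 ^+ n != 0 :> R)%R by rewrite expf_neq0.
by rewrite exprS => h; field.
Qed.

Lemma ecodeS b : ecode b =
  (if b 0%N then 2 / 3 else 0 : R)%:E + (3^-1)%:E * ecode (fun k => b k.+1).
Proof.
rewrite {1}/ecode nneseries_recl//; last by move=> k _; exact: ternary_ge0.
rewrite -nneseriesZl; last by move=> k _; exact: ternary_ge0.
congr (_ + _); rewrite -nneseries_addn; last by move=> k; exact: ternary_ge0.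
apply: eq_eseriesr => k _; rewrite addn1 /ternary -EFinM; congr (_%:E).
case: ifP => _; last by rewrite mulr0.
have : (3 ^+ k.+1 != 0 :> R)%R by rewrite expf_neq0.
by rewrite [(3 ^+ k.+2)%R]exprS => h; field.
Qed.

Definition code b : R := fine (ecode b).

Lemma ecode_fin b : ecode b = (code b)%:E.
Proof.
rewrite fineK// ge0_fin_numE ?ecode_ge0//.
by apply: le_lt_trans (ecode_le1 b) _; exact: ltry.
Qed.

Lemma code_bounds b : (0 <= code b <= 1)%R.
Proof.
by have := ecode_ge0 b; have := ecode_le1 b; rewrite ecode_fin !lee_fin => -> ->.
Qed.

Lemma codeS b : (code b = (if b 0%N then 2 / 3 else 0) + code (fun k => b k.+1) / 3)%R.
Proof.
apply: EFin_inj; rewrite -ecode_fin ecodeS ecode_fin -EFinM -EFinD.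
by congr (_ + _)%:E; rewrite mulrC.
Qed.

Definition next_ternary (v : R) : R := (if 1 / 2 <= v then 3 * v - 2 else 3 * v)%R.
Definition digit k (v : R) : bool := (1 / 2 <= iter k next_ternary v)%R.

Lemma digit_code k b : digit k (code b) = b k.
Proof.
elim: k b => [|k IHk] b.
  rewrite /digit /= codeS.
  have /andP[] := code_bounds (fun k => b k.+1); case: (b 0%N) => l u.
    by apply/idP; lra.
  by apply/negbTE; rewrite -ltNge; lra.
rewrite /digit iterSr -/(digit k _) -(IHk (fun k => b k.+1)); congr digit.
rewrite /next_ternary codeS.
have /andP[] := code_bounds (fun k => b k.+1); case: (b 0%N) => l u.
  by rewrite ifT; lra.
by rewrite ifF; [lra|apply/negbTE; rewrite -ltNge; lra].
Qed.

Lemma measurable_digit k : measurable_fun setT (digit k).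
Proof.
rewrite /digit; suff mi : measurable_fun setT (fun v => iter k next_ternary v) by mfun.
elim: k => [|k IHk]; first exact: measurable_id.
have mn : measurable_fun setT next_ternary by rewrite /next_ternary; mfun.
rewrite (_ : (fun v => _) = (fun v => next_ternary (iter k next_ternary v)))//.
by mfun.
Qed.

Lemma measurable_code dT (T : measurableType dT) (b : T -> nat -> bool) :
  (forall k, measurable_fun setT (fun t => b t k)) ->
  measurable_fun setT (fun t => code (b t)).
Proof.
move=> mb; apply: (measurableT_comp (f := fine)); first exact: fine_measurable.
apply: ge0_emeasurable_sum => [k t _ _|k _]; first exact: ternary_ge0.
by have mk := mb k; rewrite /ternary; mfun.
Qed.

End cantor_code.

Section real_family_code.
Variables (R : realType) (I : countType).
Local Open Scope ereal_scope.

(* A real family is stored in a single real as the Cantor expansion of the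
   enumeration of its Dedekind cuts, so that the adversary's one seed can carry
   all the coins. *)
Definition cuts (x : I -> R) k : bool :=
  if unpickle k is Some (i, q) then (ratr (q : rat) < x i)%R else false.

Definition encode (x : I -> R) : R := code R (cuts x).

(** Positions outside the cut of [i] yield [-oo], which is neutral for the supremum taken in
    [decode]. A real that is not a code decodes to some default, still measurably, as the adversary
    has to be defined for every seed. *)
Definition lower_cut (v : R) (i : I) k : \bar R :=
  if unpickle k is Some (i', q)
  then if (i' == i) && digit k v then (ratr (q : rat))%:E else -oo
  else -oo.

Definition decode (v : R) (i : I) : R := fine (esups (lower_cut v i) 0%N).

Lemma decode_encode x i : decode (encode x) i = x i.
Proof.
rewrite /decode (_ : esups _ _ = (x i)%:E)//; apply/eqP; rewrite eq_le; apply/andP; split.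
  apply: ge_ereal_sup => _ [k _ <-]; rewrite /lower_cut /encode digit_code /cuts.
  case: unpickle => [[i' q]|]; last exact: leNye.
  case: eqP => [->|_]; last exact: leNye.
  by case: ifP => [/ltW|_] /=; [rewrite lee_fin|exact: leNye].
apply/lee_subgt0Pr => e e0; have : (x i - e < x i)%R by rewrite ltrBlDr ltrDl.
move=> /rat_in_itvoo[q]; rewrite in_itv/= => /andP[lq qu].
apply: (@le_trans _ _ (ratr q)%:E); first by rewrite -EFinB lee_fin ltW.
apply: ereal_sup_ubound; exists (pickle (i, q)) => //=.
by rewrite /lower_cut /encode digit_code /cuts pickleK eqxx qu.
Qed.

Lemma measurable_encode dT (T : measurableType dT) (x : T -> I -> R) :
  (forall i, measurable_fun setT (fun t => x t i)) ->
  measurable_fun setT (fun t => encode (x t)).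
Proof.
move=> mx; apply: measurable_code => k; rewrite /cuts.
case: unpickle => [[i q]|]; last exact: measurable_cst.
by have mi := mx i; mfun.
Qed.

Lemma measurable_decode i : measurable_fun setT (fun v => decode v i).
Proof.
apply: (measurableT_comp (f := fine)); first exact: fine_measurable.
apply: (measurable_fun_esups (f := fun k v => lower_cut v i k)) => k.
rewrite /lower_cut; case: unpickle => [[i' q]|]; last exact: measurable_cst.
case: eqP => _ /=; last exact: measurable_cst.
by have md := @measurable_digit R k; mfun.
Qed.

End real_family_code.

Lemma prob_integral dT (T : measurableType dT) (R : realType) (P : probability T R)
    (A : set T) : measurable A -> P A = (\int[P]_t (\1_A t)%:E)%E.
Proof. by move=> mA; rewrite integral_indic// setIT. Qed.

(** * Laws of finite families *)

Section product_laws.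
Local Open Scope ereal_scope.
Context d1 d2 (T1 : measurableType d1) (T2 : measurableType d2) (R : realType).
Variables (P : probability T1 R) (Q : probability T2 R).

Lemma integral_prodM (f : T1 -> \bar R) (g : T2 -> \bar R) :
  measurable_fun setT f -> (forall x, 0 <= f x) ->
  measurable_fun setT g -> (forall y, 0 <= g y) ->
  \int[P \x Q]_z (f z.1 * g z.2) = \int[P]_x f x * \int[Q]_y g y.
Proof.
move=> mf f0 mg g0.
have mF : measurable_fun setT (fun z : T1 * T2 => f z.1 * g z.2) by mfun.
apply: (eq_trans (fubini_tonelli1 (fun z => f z.1 * g z.2) mF _)) => /=.
  by move=> z; rewrite mule_ge0.
transitivity (\int[P]_x (f x * \int[Q]_y g y)).
  by apply: eq_integral => x _; rewrite /fubini_F /= ge0_integralZl.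
by rewrite ge0_integralZr//; exact: integral_ge0.
Qed.

Lemma integral_prod_fst (f : T1 -> \bar R) :
  measurable_fun setT f -> (forall x, 0 <= f x) ->
  \int[P \x Q]_z f z.1 = \int[P]_x f x.
Proof.
move=> mf f0.
have := integral_prodM mf f0 (@measurable_cst _ _ T2 _ setT (1 : \bar R)) (fun=> lee01).
rewrite integral_prob_cst mule1 => <-.
by apply: eq_integral => z _; rewrite mule1.
Qed.

Lemma integral_prod_snd (g : T2 -> \bar R) :
  measurable_fun setT g -> (forall y, 0 <= g y) ->
  \int[P \x Q]_z g z.2 = \int[Q]_y g y.
Proof.
move=> mg g0.
have := integral_prodM (@measurable_cst _ _ T1 _ setT (1 : \bar R)) (fun=> lee01) mg g0.
rewrite integral_prob_cst mul1e => <-.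
by apply: eq_integral => z _; rewrite mul1e.
Qed.

Lemma integral_prod_map_fst (h : T1 -> T1) (f : T1 * T2 -> \bar R) :
  measurable_fun setT h ->
  (forall g, measurable_fun setT g -> (forall x, 0 <= g x) ->
     \int[P]_x g (h x) = \int[P]_x g x) ->
  measurable_fun setT f -> (forall z, 0 <= f z) ->
  \int[P \x Q]_z f (h z.1, z.2) = \int[P \x Q]_z f z.
Proof.
move=> mh hP mf f0.
have mF : measurable_fun setT (fun z : T1 * T2 => f (h z.1, z.2)) by mfun.
apply: (eq_trans (fubini_tonelli2 (fun z => f (h z.1, z.2)) mF (fun=> f0 _))).
apply: (eq_trans _ (esym (fubini_tonelli2 f mf f0))).
apply: eq_integral => y _; rewrite /fubini_G /=.
by apply: (hP (fun x => f (x, y))) => //; mfun.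
Qed.

End product_laws.

Section box_laws.
Variables (R : realType) (I : finType).

Definition boxes : set (set (I -> R)) :=
  [set A | exists2 B : I -> set R, (forall i, measurable (B i)) &
           A = [set w | forall i, B i (w i)]].

(* The coarsest sigma-algebra that makes all coordinates measurable; laws of
   independent families are compared there. *)
Definition box_space := g_sigma_algebraType boxes.

Lemma measurable_box_coord i : measurable_fun setT (fun w : box_space => w i).
Proof.
move=> _ Y mY; rewrite setTI; apply: sub_sigma_algebra.
exists (fun j => if j == i then Y else setT) => [j|]; first by case: ifP.
apply/seteqP; split => [w Yw j|w /(_ i)]; last by rewrite eqxx.
by case: eqP => [->|].
Qed.

Lemma measurable_box_map dT (T : measurableType dT) (W : I -> T -> R) :
  (forall i, measurable_fun setT (W i)) ->
  measurable_fun setT (fun t => (fun i => W i t) : box_space).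
Proof.
move=> mW; apply: (@measurability _ _ _ box_space setT _ boxes erefl) => _ [_ [B mB ->] <-].
rewrite setTI (_ : _ @^-1` _ = \bigcap_(i in [set: I]) (W i @^-1` B i)).
  apply: fin_bigcap_measurable; first exact: finite_finset.
  by move=> i _; rewrite -[X in measurable X]setTI; exact: mW.
by apply/seteqP; split => t /=; [move=> h i _; exact: h|move=> h i; exact: h].
Qed.

(** Mutual independence prescribes the probabilities of boxes only. Boxes are stable under
    intersection, so these values determine the law on the sigma-algebra they generate. *)
Lemma box_law_unique dT (T : measurableType dT) (P : probability T R) (W : I -> T -> R)
    dT' (T' : measurableType dT') (P' : probability T' R) (W' : I -> T' -> R) :
  (forall i, measurable_fun setT (W i)) -> (forall i, measurable_fun setT (W' i)) ->
  (forall B : I -> set R, (forall i, measurable (B i)) ->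
     P [set t | forall i, B i (W i t)] = P' [set t | forall i, B i (W' i t)]) ->
  forall F : set box_space, measurable F ->
  P [set t | F (fun i => W i t)] = P' [set t | F (fun i => W' i t)].
Proof.
move=> /measurable_box_map mW /measurable_box_map mW' PP' F mF.
pose m1 : probability box_space R := distribution P (mfun_Sub (mem_set mW)).
pose m2 : probability box_space R := distribution P' (mfun_Sub (mem_set mW')).
apply: (@measure_unique _ R box_space boxes (fun=> setT) erefl _ _ _ m1 m2 _ _ F mF).
- move=> _ _ [A mA ->] [B mB ->]; exists (fun i => A i `&` B i) => [i|].
    exact: measurableI.
  apply/seteqP; split => w /=; first by case=> a b i; split.
  by move=> ab; split => i; have [] := ab i.
- by move=> k; exists (fun=> setT) => //; apply/seteqP; split.
- by apply/seteqP; split => // w _; exists 0%N.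
- by move=> _ [B mB ->]; exact: PP'.
- move=> k; apply: (@le_lt_trans _ _ 1%E); last exact: ltry.
  exact: probability_le1.
Qed.

End box_laws.

Section finite_measurability.
Context dT (T : measurableType dT) (R : realType).

Lemma measurable_forall (I : finType) (p : I -> T -> bool) :
  (forall i, measurable_fun setT (p i)) ->
  measurable_fun setT (fun t => [forall i, p i t]).
Proof.
move=> mp; rewrite (_ : (fun t => _) = (fun t => \big[andb/true]_i p i t)).
  elim: (index_enum I) => [|i s IHs].
    by under eq_fun do rewrite big_nil; exact: measurable_cst.
  by under eq_fun do rewrite big_cons; exact: measurable_and.
by apply/funext => t; rewrite big_andE.
Qed.

(** An algorithm is measurable for each fixed missingness pattern, whereas the mask is random; the
    finitely many patterns split the space into measurable pieces. *)
Lemma measurable_fun_switch (I : finType) (m : T -> {ffun I -> bool})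
    (F : {ffun I -> bool} -> T -> R) :
  (forall i, measurable_fun setT (fun t => m t i)) ->
  (forall c, measurable_fun setT (F c)) ->
  measurable_fun setT (fun t => F (m t) t).
Proof.
move=> mm mF.
have -> : (fun t => F (m t) t) = (fun t => \sum_c (if m t == c then F c t else 0)).
  apply/funext => t; rewrite (bigD1 (m t))//= eqxx big1 ?addr0// => c.
  by rewrite eq_sym => /negbTE ->.
apply: measurable_sum => c; have mFc := mF c.
suff me : measurable_fun setT (fun t => m t == c) by mfun.
rewrite (_ : (fun t => _) = (fun t => [forall i, m t i == c i])).
  apply: measurable_forall => i; have mi := mm i; case: (c i).
    by rewrite (_ : (fun t => _) = (fun t => m t i))//; apply/funext => t; rewrite eqb_id.
  rewrite (_ : (fun t => _) = (fun t => ~~ m t i)); first exact: measurable_neg.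
  by apply/funext => t; rewrite eqbF_neg.
apply/funext => t; apply/eqP/forallP => [-> //|e].
by apply/ffunP => i; apply/eqP.
Qed.

End finite_measurability.

(** * The coupling of the two data sets *)

Section model.
Variables (R : realType) (n d' : nat).
Local Notation d := d'.+1.
Local Notation N := (std_normal R).
Local Notation Q := (unit_law R).
Local Notation I := (ridx n d).
Implicit Types (p : d.-tuple (R * R)) (B : I -> set R).

Definition negate m (p : m.-tuple (R * R)) := shift_sum (2 * xsum p) p.

Lemma xsum_negate p : xsum (negate p) = - xsum p.
Proof. by rewrite xsum_shift_sum//; ring. Qed.

Lemma negateK p : negate (negate p) = p.
Proof.
by rewrite {1}/negate xsum_negate mulrN shift_sumK.
Qed.

Definition flipped m (p : m.-tuple (R * R)) i := moved (2 * xsum p) p i.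

(** The two ends of an involution are compared symmetrically; this is why the erased positions do
    not reveal which of the two samples was drawn. *)
Lemma flipped_negate p i : flipped (negate p) i = flipped p i.
Proof. by rewrite /flipped /moved -!/(negate _) negateK eq_sym. Qed.

Lemma measurable_negate m : measurable_fun setT (@negate m).
Proof.
have mx := @measurable_xsum R m.
apply: (measurableT_comp (@measurable_shift_sum R m)
  (g := fun p : m.-tuple (R * R) => (2 * xsum p, p))).
by mfun.
Qed.

Lemma measurable_flipped m i : measurable_fun setT (fun p : m.-tuple (R * R) => flipped p i).
Proof.
have mx := @measurable_xsum R m.
apply: (measurableT_comp (measurable_moved i)
  (g := fun p : m.-tuple (R * R) => (2 * xsum p, p))).
by mfun.
Qed.

Definition sample := (d.-tuple (R * R) * R)%type.

Definition sample_law : probability sample R := (iid Q d \x N)%E.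

Definition space := (n.-tuple sample * R)%type.

Variable muA : probability R R.

Definition space_law : probability space R := (iid sample_law n \x muA)%E.

Definition negate_sample (s : sample) : sample := (negate s.1, s.2).

Definition negate_space (g : space) : space := (tmap negate_sample g.1, g.2).

Lemma measurable_negate_sample : measurable_fun setT negate_sample.
Proof. by have mn := @measurable_negate d; rewrite /negate_sample; mfun. Qed.

Lemma measurable_negate_space : measurable_fun setT negate_space.
Proof.
have mn := measurable_map_tuple measurable_negate_sample (n := n).
by rewrite /negate_space; mfun.
Qed.

Local Open Scope ereal_scope.

Lemma integral_negate_space (f : space -> \bar R) :
  measurable_fun setT f -> (forall g, 0 <= f g) ->
  \int[space_law]_g f (negate_space g) = \int[space_law]_g f g.
Proof.
move=> mf f0; have mn := measurable_negate_sample.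
have mm : measurable_fun setT (@tmap _ _ negate_sample n) by exact: measurable_map_tuple.
have sP (h : sample -> \bar R) : measurable_fun setT h -> (forall s, 0 <= h s) ->
    \int[sample_law]_s h (negate_sample s) = \int[sample_law]_s h s.
  move=> mh h0; refine (integral_prod_map_fst N (@measurable_negate d) _ mh h0).
  by move=> k; exact: integral_negate.
refine (integral_prod_map_fst muA mm _ mf f0).
by move=> g mg g0; exact: (integral_iid_map mn sP mg g0).
Qed.

Lemma space_law_negate (A : set space) : measurable A ->
  space_law (negate_space @^-1` A) = space_law A.
Proof.
move=> mA.
have mA' : measurable (negate_space @^-1` A).
  by rewrite -[X in measurable X]setTI; exact: measurable_negate_space.
rewrite !prob_integral//.
have mi : measurable_fun setT (fun g => (\1_A g)%:E : \bar R).
  by apply/measurable_EFinP; exact: measurable_indic.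
rewrite -(integral_negate_space mi)//.
Qed.

Variable J : {ffun 'I_n -> 'I_d}.

(* The cyclic shifts [J] spread the moved coordinates evenly over the columns. *)
Definition model_X (i : 'I_n) (j : 'I_d) (g : space) : R :=
  (tnth (tnth g.1 i).1 (j + J i)%R).1.
Definition model_noise (i : 'I_n) (g : space) : R := (tnth g.1 i).2.
Definition model_seed (g : space) : R := g.2.
Definition coins (t : n.-tuple (d.-tuple R)) (k : 'I_n * 'I_d) : R :=
  tnth (tnth t k.1) k.2.
Definition sample_coins (s : sample) : d.-tuple R := tmap snd s.1.
Definition model_coins (g : space) : R := encode (coins (tmap sample_coins g.1)).

Lemma measurable_sample_coins : measurable_fun setT sample_coins.
Proof.
by apply: (measurableT_comp (measurable_map_tuple measurable_snd (n := d))).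
Qed.

Lemma measurable_coins_code : measurable_fun setT (fun t => encode (coins t)).
Proof.
apply: measurable_encode => -[i k]; rewrite /coins /=.
by apply: (measurableT_comp (measurable_tnth k) (g := fun t : n.-tuple (d.-tuple R) => tnth t i)); exact: measurable_tnth.
Qed.

Lemma measurable_model_coins : measurable_fun setT model_coins.
Proof.
apply: (measurableT_comp measurable_coins_code (g := fun g => tmap sample_coins g.1)).
apply: (measurableT_comp (measurable_map_tuple measurable_sample_coins (n := n))).
exact: measurable_fst.
Qed.

(** Taken as the image of the model's own law, the law of the adversary's seed needs no explicit
    description. *)
Definition muV : probability R R := distribution space_law (mfun_Sub (mem_set measurable_model_coins)).

Lemma measurable_family k : measurable_fun setT (rfamily model_X model_noise model_seed model_coins k).
Proof.
case: k => [[[i j]|i]|[]] /=.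
- apply: (measurableT_comp measurable_fst).
  apply: (measurableT_comp (measurable_tnth (j + J i)%R)).
  apply: (measurableT_comp measurable_fst).
  apply: (measurableT_comp (measurable_tnth i)); exact: measurable_fst.
- apply: (measurableT_comp measurable_snd).
  apply: (measurableT_comp (measurable_tnth i)); exact: measurable_fst.
- exact: measurable_snd.
- exact: measurable_model_coins.
Qed.

Definition eindic (A : set R) (x : R) : \bar R := (\1_A x)%:E.

Lemma eindic_ge0 A x : 0 <= eindic A x.
Proof. by rewrite lee_fin. Qed.

Lemma measurable_eindic (A : set R) : measurable A -> measurable_fun setT (eindic A).
Proof. by move=> mA; rewrite /eindic; apply/measurable_EFinP; exact: measurable_indic. Qed.

Lemma integral_eindic dT (T : measurableType dT) (P : probability T R) (f : T -> R)
    (A : set R) : measurable A -> measurable_fun setT f ->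
  \int[P]_t eindic A (f t) = P (f @^-1` A).
Proof.
move=> mA mf; have mfA : measurable (f @^-1` A).
  by rewrite -[X in measurable X]setTI; exact: mf.
by rewrite prob_integral.
Qed.

Definition box_factor B (i : 'I_n) (s : sample) : \bar R :=
  (\big[*%E/1]_(k < d) eindic (B (inl (inl (i, (k - J i)%R)))) (tnth s.1 k).1) *
  eindic (B (inl (inr i))) s.2.

Lemma integral_eindic_id (P : probability R R) (A : set R) : measurable A ->
  \int[P]_x eindic A x = P A.
Proof. by move=> mA; rewrite prob_integral. Qed.

Lemma integral_unit_fstM (A : set R) (h : R -> \bar R) : measurable A ->
  measurable_fun setT h -> (forall c, 0 <= h c) ->
  \int[Q]_u (eindic A u.1 * h u.2) = \int[Q]_u eindic A u.1 * \int[Q]_u h u.2.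
Proof.
move=> mA mh h0; have mi := measurable_eindic mA.
have i0 x : 0 <= eindic A x by exact: eindic_ge0.
apply: (eq_trans (integral_prodM N (coin_law R) mi i0 mh h0)); congr (_ * _).
- exact: (esym (integral_prod_fst N (coin_law R) mi i0)).
- exact: (esym (integral_prod_snd N (coin_law R) mh h0)).
Qed.

Lemma prod_nat_EFin (K : finType) (b : K -> bool) :
  \big[*%E/1]_k (b k)%:R%:E = ([forall k, b k])%:R%:E :> \bar R.
Proof.
have -> : [forall k, b k] = \big[andb/true]_k b k by rewrite big_andE.
elim/big_rec2: _ => // k x y _ ->.
by rewrite -EFinM -natrM mulnb.
Qed.

Lemma box_factor_nat B i s : box_factor B i s =
  ([forall k, (tnth s.1 k).1 \in B (inl (inl (i, (k - J i)%R)))] &&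
   (s.2 \in B (inl (inr i))))%:R%:E.
Proof.
rewrite /box_factor /eindic; under eq_bigr do rewrite indicE.
by rewrite prod_nat_EFin indicE -EFinM -natrM mulnb.
Qed.

Lemma measurable_box_factor1 B i : (forall k, measurable (B k)) ->
  measurable_fun setT (fun p : d.-tuple (R * R) =>
    \big[*%E/1]_(k < d) eindic (B (inl (inl (i, (k - J i)%R)))) (tnth p k).1).
Proof.
move=> mB; apply: (measurable_prod_tnth
  (u := fun k u => eindic (B (inl (inl (i, (k - J i)%R)))) u.1)) => k.
by have mi := measurable_eindic (mB (inl (inl (i, (k - J i)%R)))); mfun.
Qed.

Lemma measurable_box_factor B i : (forall k, measurable (B k)) ->
  measurable_fun setT (box_factor B i).
Proof.
move=> mB; have m1 := measurable_box_factor1 i mB.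
have m2 := measurable_eindic (mB (inl (inr i))).
apply: emeasurable_funM; last by mfun.
by apply: (measurableT_comp m1); exact: measurable_fst.
Qed.

Lemma box_factor_ge0 B i s : 0 <= box_factor B i s.
Proof. by rewrite mule_ge0 ?eindic_ge0// prod_ge0// => k; exact: eindic_ge0. Qed.

Lemma integral_box_factorM B i (h : d.-tuple R -> \bar R) : (forall k, measurable (B k)) ->
  measurable_fun setT h -> (forall t, 0 <= h t) ->
  \int[sample_law]_s (box_factor B i s * h (sample_coins s)) =
  (\big[*%E/1]_(j < d) N (B (inl (inl (i, j)))) * N (B (inl (inr i)))) *
  \int[sample_law]_s h (sample_coins s).
Proof.
move=> mB mh h0; have m1 := measurable_box_factor1 i mB.
have m2 := measurable_eindic (mB (inl (inr i))).
have ms := measurable_map_tuple (T := (R * R)%type) measurable_snd (n := d).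
have mhs : measurable_fun setT (fun p : d.-tuple (R * R) => h (tmap snd p)).
  by mfun.
have p0 p : 0 <= \big[*%E/1]_(k < d) eindic (B (inl (inl (i, (k - J i)%R)))) (tnth p k).1 :> \bar R.
  by rewrite prod_ge0// => k; exact: eindic_ge0.
transitivity (\int[sample_law]_s
   ((\big[*%E/1]_(k < d) eindic (B (inl (inl (i, (k - J i)%R)))) (tnth s.1 k).1) *
      h (tmap snd s.1) * eindic (B (inl (inr i))) s.2)).
  by apply: eq_integral => s _; rewrite /box_factor muleAC.
apply: (eq_trans (integral_prodM (iid Q d) N
  (f := fun p => \big[*%E/1]_(k < d) eindic (B (inl (inl (i, (k - J i)%R)))) (tnth p k).1 *
      h (tmap snd p)) _ _ m2 (fun=> _))).
- by mfun.
- by move=> p; rewrite mule_ge0.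
- exact: eindic_ge0.
rewrite (integral_prod_fst (iid Q d) N mhs)//.
rewrite (integral_eindic_id N (mB _)).
rewrite [RHS]muleAC; congr (_ * _).
apply: (eq_trans (@integral_iid_indep _ _ _ _ R Q snd measurable_snd d
  (fun k u => eindic (B (inl (inl (i, (k - J i)%R)))) u.1) h _ _ _ mh h0)).
- by move=> k; have mi := measurable_eindic (mB (inl (inl (i, (k - J i)%R)))); mfun.
- by move=> k u; exact: eindic_ge0.
- by move=> k g mg g0; exact: integral_unit_fstM.
congr (_ * _); rewrite [RHS](reindex_inj (addIr (- J i)%R)) /=.
apply: eq_bigr => k _.
have mi := measurable_eindic (mB (inl (inl (i, (k - J i)%R)))).
apply: (eq_trans (integral_prod_fst N (coin_law R) mi _)); first by move=> x; exact: eindic_ge0.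
exact: (integral_eindic_id N (mB _)).
Qed.

Lemma integral_box_factor B i : (forall k, measurable (B k)) ->
  \int[sample_law]_s box_factor B i s =
  \big[*%E/1]_(j < d) N (B (inl (inl (i, j)))) * N (B (inl (inr i))).
Proof.
move=> mB.
have := integral_box_factorM i mB (@measurable_cst _ _ _ _ setT (1 : \bar R)) (fun=> lee01).
rewrite integral_prob_cst mule1 => <-.
by apply: eq_integral => s _; rewrite mule1.
Qed.

(** The model realises the independent family of the statement. The point is the adversary's seed, a
    function of the samples: it reads only their coins, which are independent of the coordinates and
    of the noise. *)
Lemma space_law_box B : (forall k, measurable (B k)) ->
  space_law [set g | forall k, B k (rfamily model_X model_noise model_seed model_coins k g)] =
  (\big[*%E/1]_(i < n) (\big[*%E/1]_(j < d) N (B (inl (inl (i, j)))) * N (B (inl (inr i)))) *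
    muV (B (inr false))) * muA (B (inr true)).
Proof.
move=> mB.
have mE : measurable [set g | forall k, B k (rfamily model_X model_noise model_seed model_coins k g)].
  rewrite (_ : [set g | _] = \bigcap_(k in [set: I]) (rfamily model_X model_noise model_seed model_coins k @^-1` B k)).
    apply: fin_bigcap_measurable; first exact: finite_finset.
    by move=> k _; rewrite -[X in measurable X]setTI; exact: measurable_family.
  by apply/seteqP; split => t /=; [move=> h i _; exact: h|move=> h i; exact: h].
rewrite prob_integral//.
have mc := measurable_coins_code.
have mVB := measurable_eindic (mB (inr false)).
have mUB := measurable_eindic (mB (inr true)).
have mmap := measurable_map_tuple measurable_sample_coins (n := n).
have mf : measurable_fun setT (fun t : n.-tuple sample =>
    \big[*%E/1]_(i < n) box_factor B i (tnth t i)).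
  by apply: measurable_prod_tnth => i; exact: measurable_box_factor.
have mh : measurable_fun setT (fun t : n.-tuple (d.-tuple R) =>
    eindic (B (inr false)) (encode (coins t))).
  by mfun.
have f0 (t : n.-tuple sample) : 0 <= \big[*%E/1]_(i < n) box_factor B i (tnth t i).
  by rewrite prod_ge0// => i; exact: box_factor_ge0.
transitivity (\int[space_law]_g
   ((\big[*%E/1]_(i < n) box_factor B i (tnth g.1 i) *
     eindic (B (inr false)) (encode (coins (tmap sample_coins g.1)))) *
    eindic (B (inr true)) g.2)).
  apply: eq_integral => g _.
  under eq_bigr do rewrite box_factor_nat.
  rewrite prod_nat_EFin /eindic !indicE -!EFinM -!natrM !mulnb; congr (_%:R%:E).
  congr nat_of_bool; apply/idP/idP.
    move/set_mem => /= h; apply/andP; split; last by apply/mem_set; exact: (h (inr true)).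
    apply/andP; split; last by apply/mem_set; exact: (h (inr false)).
    apply/forallP => i; apply/andP; split; last by apply/mem_set; exact: (h (inl (inr i))).
    apply/forallP => k; apply/mem_set.
    by have := h (inl (inl (i, k - J i)%R)); rewrite /= /model_X /= subrK.
  move=> /andP[/andP[/forallP hX hV] hU]; apply/mem_set => /=.
  move=> [[[i j]|i]|[]] /=; last 2 first.
  - exact: set_mem hU.
  - exact: set_mem hV.
  - have /andP[/forallP/(_ (j + J i)%R)/set_mem + _] := hX i.
    by rewrite addrK.
  - by have /andP[_ /set_mem] := hX i.
apply: (eq_trans (integral_prodM (iid sample_law n) muA
  (f := fun t => \big[*%E/1]_(i < n) box_factor B i (tnth t i) *
     eindic (B (inr false)) (encode (coins (tmap sample_coins t)))) _ _ mUB (fun=> _))).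
- by apply: emeasurable_funM mf _; exact: (measurableT_comp mh mmap).
- by move=> t; apply: mule_ge0; [exact: f0|exact: eindic_ge0].
- exact: eindic_ge0.
congr (_ * _); last exact: (integral_eindic_id muA (mB _)).
apply: (eq_trans (@integral_iid_indep _ _ _ _ R sample_law sample_coins
  measurable_sample_coins n (box_factor B)
  (fun t => eindic (B (inr false)) (encode (coins t))) _ _ _ mh _)).
- by move=> i; exact: measurable_box_factor.
- by move=> i s; exact: box_factor_ge0.
- by move=> i h mh' h0; rewrite integral_box_factorM// integral_box_factor.
- by move=> t; exact: eindic_ge0.
congr (_ * _); first by apply: eq_bigr => i _; exact: integral_box_factor.
rewrite /muV /distribution /= /pushforward.
rewrite -(integral_eindic space_law (mB _) measurable_model_coins).
apply: (esym (integral_prod_fst (iid sample_law n) muA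
  (f := fun t => eindic (B (inr false)) (encode (coins (tmap sample_coins t)))) _ _)).
- exact: (measurableT_comp mh mmap).
- by move=> t; exact: eindic_ge0.
Qed.

End model.

(** * Erasure counts per column *)

Section overflow.
Variables (R : realType) (n d' : nat).
Local Notation d := d'.+1.
Local Notation Q := (unit_law R).

Definition flip_rate (k : 'I_d) : R :=
  fine (\int[iid Q d]_p (if flipped p k then 1 else 0 : R)%:E)%E.

Definition hits (J : {ffun 'I_n -> 'I_d}) (j : 'I_d) (g : space R n d') : R :=
  \sum_(i < n) (if flipped (tnth g.1 i).1 (j + J i) then 1 else 0).

Lemma measurable_hits J j : measurable_fun setT (hits J j).
Proof.
apply: measurable_sum => i.
have mf := measurable_flipped (R := R) (m := d) (j + J i).
apply: measurable_fun_ifT => //.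
apply: (measurableT_comp mf (g := fun g : space R n d' => (tnth g.1 i).1)).
apply: (measurableT_comp measurable_fst).
by apply: (measurableT_comp (measurable_tnth i)); exact: measurable_fst.
Qed.

Lemma measurable_flipped_if (k : 'I_d) :
  measurable_fun setT (fun p : d.-tuple (R * R) => (if flipped p k then 1 else 0 : R)%:E).
Proof. by have mf := measurable_flipped (R := R) (m := d) k; mfun. Qed.

Lemma flip_rate_ge0 k : 0 <= flip_rate k.
Proof.
by rewrite fine_ge0// integral_ge0// => p _; rewrite lee_fin; case: ifP.
Qed.

Lemma sum_flip_rate : (15 <= d')%N -> \sum_k flip_rate k <= 3 * Num.sqrt d%:R.
Proof.
move=> d15; rewrite -lee_fin; apply: le_trans (expected_cost R d15).
rewrite le_eqVlt; apply/orP; left; apply/eqP.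
rewrite -sumEFin (eq_bigr (fun k => \int[iid Q d]_p (if flipped p k then 1 else 0 : R)%:E)%E).
  rewrite -ge0_integral_sum//; last 2 first.
  - by move=> k; exact: measurable_flipped_if.
  - by move=> k p _; rewrite lee_fin; case: ifP.
  by apply: eq_integral => p _; rewrite sumEFin.
move=> k _; rewrite /flip_rate fineK// ge0_fin_numE; last first.
  by apply: integral_ge0 => p _; rewrite lee_fin; case: ifP.
apply: (@le_lt_trans _ _ (\int[iid Q d]_p 1%:E)%E); last first.
  by rewrite integral_prob_cst ltry.
apply: ge0_le_integral => //.
- by move=> p _; rewrite lee_fin; case: ifP.
- exact: measurable_flipped_if.
- by move=> p _; rewrite lee_fin; case: ifP.
Qed.

Lemma overflow_le (muA : probability R R) J j (x : R) :
  (space_law n d' muA [set g | (x < hits J j g)%R] <=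
  (expR (- (x / 4)) * \prod_(i < n) (1 + 15 / 49 * flip_rate (j + J i)))%:E)%E.
Proof.
pose m (i : 'I_n) (s : sample R d') := flipped s.1 (j + J i).
have mm i : measurable_fun setT (m i).
  by apply: (measurableT_comp (measurable_flipped (j + J i))); exact: measurable_fst.
have := chernoff (sample_law R d') x mm.
have -> : (\prod_(i < n) (1 + 15 / 49 * fine (\int[sample_law R d']_t (if m i t then 1 else 0)%:E)) =
   \prod_(i < n) (1 + 15 / 49 * flip_rate (j + J i)))%R.
  apply: eq_bigr => i _; congr (1 + 15 / 49 * fine _).
  apply: (integral_prod_fst (iid Q d) (std_normal R) (measurable_flipped_if (j + J i))).
  by move=> p; rewrite lee_fin; case: ifP.
apply: le_trans; rewrite le_eqVlt; apply/orP; left; apply/eqP.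
pose E := [set t : n.-tuple (sample R d') |
  x < \sum_(i < n) (if m i (tnth t i) then 1 else 0)].
have mE : measurable E.
  have mt (i : 'I_n) : measurable_fun setT (fun t : n.-tuple (sample R d') => m i (tnth t i)).
    by apply: (measurableT_comp (mm i)); exact: measurable_tnth.
  have mS : measurable_fun setT (fun t : n.-tuple (sample R d') =>
      \sum_(i < n) (if m i (tnth t i) then 1 else 0 : R)).
    by apply: measurable_sum => i; have mi := mt i; mfun.
  by rewrite -[E]setTI; apply: (measurable_fun_ltr (measurable_cst x) mS).
have -> : [set g : space R n d' | x < hits J j g] = E `*` setT.
  by apply/seteqP; split => [g h|g []]; first split.
apply: (eq_trans (product_measure1E (iid (sample_law R d') n) muA mE measurableT)).
apply: (eq_trans (f_equal (mule (iid (sample_law R d') n E)) (probability_setT muA))).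
exact: mule1.
Qed.

Lemma exists_sparse_shifts (eta : R) : 4 / Num.sqrt d%:R <= eta -> eta <= 1 ->
  exists J : {ffun 'I_n -> 'I_d}, forall muA : probability R R,
  (space_law n d' muA [set g | exists j, (eta * n%:R < hits J j g)%R] <=
   (d%:R * expR (- (1 / 100 * eta * n%:R)))%:E)%E.
Proof.
set s : R := Num.sqrt d%:R => eta4 eta1.
have s0 : 0 < s by rewrite sqrtr_gt0 ltr0n.
have s4 : 4 <= s by move: (le_trans eta4 eta1); rewrite ler_pdivrMr ?mul1r.
have s2 : s ^+ 2 = d%:R by rewrite sqr_sqrtr.
(* The two bounds on [eta] force [4 <= s], hence at least 16 coordinates. *)
have d15 : (15 <= d')%N.
  rewrite -ltnS -(ler_nat R) -s2; apply: (@le_trans _ _ (4 * 4)); first by lra.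
  by rewrite expr2 ler_pM.
pose F k := 1 + 15 / 49 * flip_rate k.
have F0 k : 0 <= F k by rewrite /F; have := flip_rate_ge0 k; lra.
(* A bound on the mean of [F]: the rates add up to at most [3 * s] over [s ^+ 2] coordinates, and
   [15 / 49 * 3 = 45 / 49]. *)
pose x := 1 + 45 / 49 / s.
have Fx : \sum_k F k <= d%:R * x.
  rewrite /F big_split /= sumr_const card_ord -mulr_sumr -s2.
  have -> : s ^+ 2 * x = s ^+ 2 + 45 / 49 * s by rewrite /x; field; rewrite gt_eqF.
  by have := sum_flip_rate d15; rewrite -/s; lra.
have [J JF] := exists_shifts n F0 Fx; exists J => muA.
have mJ j : measurable [set g | (eta * n%:R < hits J j g)%R].
  rewrite -[X in measurable X]setTI.
  exact: (measurable_fun_ltr (measurable_cst (eta * n%:R)) (measurable_hits J j)).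
pose A k := [set g | (eta * n%:R < hits J (inord k) g)%R].
have -> : [set g | exists j, (eta * n%:R < hits J j g)%R] = \big[setU/set0]_(k < d) A k.
  rewrite -bigcup_mkord; apply/seteqP; split => [g [j h]|g [k _ h]]; last by exists (inord k).
  by exists j => //=; rewrite /A /= inord_val.
apply: (le_trans (Boole_inequality (A := A) (n := d) (space_law n d' muA) (fun k _ => mJ (inord k)))).
apply: (@le_trans _ _ (\sum_(j < d) (expR (- (eta * n%:R / 4)) * \prod_(i < n) F (j + J i)%R)%:E)%E).
  by apply: lee_sum => j _; rewrite /A inord_val; exact: overflow_le.
rewrite sumEFin lee_fin -mulr_sumr.
apply: le_trans (ler_wpM2l (expR_ge0 _) JF) _.
rewrite mulrCA ler_pM2l ?ltr0n//.
(* From [4 / s <= eta]. Against the Chernoff factor with exponent [- 1 / 4] there remains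
   [45 / 196 - 1 / 4 = - 1 / 49] per sample and unit of [eta], rounded to [- 1 / 100]. *)
have xe : x <= expR (45 / 196 * eta).
  apply: le_trans (expR_ge1Dx _); rewrite /x lerD2l.
  have -> : 45 / 49 / s = 45 / 196 * (4 / s) by field; rewrite gt_eqF.
  by apply: ler_wpM2l => //; lra.
have x0 : 0 <= x by rewrite /x addr_ge0// !divr_ge0// ltW.
apply: (@le_trans _ _ (expR (- (eta * n%:R / 4)) * expR (45 / 196 * eta) ^+ n)).
  by apply: ler_wpM2l; [exact: expR_ge0|rewrite lerXn2r// nnegrE// expR_ge0].
rewrite -expRM_natl -expRD ler_expR -mulr_natl.
have en : 0 <= eta * n%:R by rewrite mulr_ge0//; apply: le_trans eta4; rewrite divr_ge0// ltW.
lra.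
Qed.

End overflow.

(** * The adversary and the lower bound *)

Section error_event.
Context (R : realType) (n d : nat) (sigma b eta : R).
Variables (A : algorithm R n d) (Adv : adversary R n d) (beta : 'I_d -> R).

(** Phrased for a bare family of reals, so that the same event can be read on the given probability
    space and on the explicit model. *)
Definition error_event (W : ridx n d -> R) : Prop :=
  let X := fun i j => W (inl (inl (i, j))) in
  let y := fun i => (\sum_(j < d) beta j * X i j) + sigma * W (inl (inr i)) in
  let mask := Adv (W (inr false)) X y in
  let betahat := A (W (inr true)) eta sigma b
    (fun i j => maskv (mask.1 i j) (X i j)) (fun i => maskv (mask.2 i) (y i)) in
  vnorm beta / Num.sqrt 2 <= vnorm (fun j => betahat j - beta j).

Hypotheses (mA : alg_measurable A) (mAdv : adv_measurable Adv).

Lemma measurable_error_event dT (T : measurableType dT) (W : ridx n d -> T -> R) :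
  (forall k, measurable_fun setT (W k)) ->
  measurable [set t | error_event (fun k => W k t)].
Proof.
move=> mW.
pose X t i j := W (inl (inl (i, j))) t.
pose y t i := (\sum_(j < d) beta j * X t i j) + sigma * W (inl (inr i)) t.
have mX i j : measurable_fun setT (fun t => X t i j) by exact: mW.
have my i : measurable_fun setT (fun t => y t i).
  apply: measurable_funD.
    by apply: measurable_sum => j; have mij := mX i j; mfun.
  by have mi := mW (inl (inr i)); mfun.
have mV := mW (inr false); have mU := mW (inr true).
have [m1 m2] := mAdv mV mX my.
pose mask t := Adv (W (inr false) t) (X t) (y t).
pose m t : {ffun ('I_n * 'I_d) + 'I_n -> bool} :=
  [ffun k => match k with inl ij => (mask t).1 ij.1 ij.2 | inr i => (mask t).2 i end].
have mm k : measurable_fun setT (fun t => m t k).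
  apply: (measurable_fun_bool true); rewrite setTI.
  case: k => [[i j]|i].
  - rewrite (_ : _ @^-1` _ = [set t | (mask t).1 i j]); first exact: m1.
    by apply/seteqP; split => t; rewrite /preimage /= ffunE /= => ->.
  - rewrite (_ : _ @^-1` _ = [set t | (mask t).2 i]); first exact: m2.
    by apply/seteqP; split => t; rewrite /preimage /= ffunE /= => ->.
pose betahat t := A (W (inr true) t) eta sigma b
  (fun i j => maskv ((mask t).1 i j) (X t i j)) (fun i => maskv ((mask t).2 i) (y t i)).
have mb k : measurable_fun setT (fun t => betahat t k).
  pose F (c : {ffun ('I_n * 'I_d) + 'I_n -> bool}) t := A (W (inr true) t) eta sigma b
    (fun i j => maskv (c (inl (i, j))) (X t i j)) (fun i => maskv (c (inr i)) (y t i)) k.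
  rewrite (_ : (fun t => _) = (fun t => F (m t) t)).
    by apply: measurable_fun_switch => // c; exact: (mA _ _ _ (fun i j => c (inl (i, j))) (fun i => c (inr i))).
  apply/funext => t; rewrite /F /betahat; congr (A _ _ _ _ _ _ k).
  - by apply/funext => i; apply/funext => j; rewrite ffunE.
  - by apply/funext => i; rewrite ffunE.
have ms : measurable_fun setT (fun t => vnorm (fun j => betahat t j - beta j)).
  apply: (measurableT_comp (continuous_measurable_fun (@sqrt_continuous R))).
  by apply: measurable_sum => j; have mj := mb j; mfun.
rewrite -[X in measurable X]setTI.
by apply: (measurable_fun_ler (measurable_cst (vnorm beta / Num.sqrt 2)) ms).
Qed.

End error_event.

Section adversary.
Variables (R : realType) (n d' : nat) (eta : R).
Local Notation d := d'.+1.
Variable J : {ffun 'I_n -> 'I_d}.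

Definition seeded_sample (v : R) (x : 'I_n -> 'I_d -> R) (i : 'I_n) : d.-tuple (R * R) :=
  [tuple (x i (k - J i), decode v (i, k)) | k < d].

Definition seeded_hit v x i (j : 'I_d) : bool := flipped (seeded_sample v x i) (j + J i).

Definition within_budget v x : bool :=
  [forall j : 'I_d, \sum_(i < n) (if seeded_hit v x i j then 1 else 0) <= eta * n%:R].

(** The labels are neither used nor erased, so one rule serves both regressors. When some column
    would exceed its budget nothing is erased, which makes the budget hold for all inputs and not
    only with high probability. *)
Definition flip_adversary : adversary R n d :=
  fun v x _ => (fun i j => within_budget v x && seeded_hit v x i j, fun=> false).

Lemma card_classical (p : 'I_n -> bool) :
  #|[set i : 'I_n | p i]|%:R = \sum_(i < n) (if p i then 1 else 0) :> R.
Proof.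
rewrite (@eq_card _ _ p); last first.
  by move=> i; apply/idP/idP => [/set_mem//|pi]; exact/mem_set.
by rewrite -sum1_card natr_sum big_mkcond.
Qed.

Lemma flip_adversary_budget : 0 <= eta -> adv_budget eta flip_adversary.
Proof.
move=> eta0 v x y; split => [j|] /=; rewrite card_classical; last first.
  by rewrite big1 ?mulr_ge0.
case: (boolP (within_budget v x)) => [/forallP/(_ j)//|_].
by rewrite big1 ?mulr_ge0.
Qed.

Lemma flip_adversary_measurable : adv_measurable flip_adversary.
Proof.
move=> dT T v x y mv mx my; split => [i j|i]; last first.
  rewrite (_ : [set t | _] = set0); first exact: measurable0.
  by apply/seteqP; split.
have ms k : measurable_fun setT (fun t => seeded_sample (v t) (x t) k).
  apply/measurable_fun_tnthP => l.
  rewrite (_ : _ \o _ = fun t => (x t k (l - J k), decode (v t) (k, l))); last first.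
    by apply/funext => t /=; rewrite tnth_mktuple.
  have md := @measurable_decode R ('I_n * 'I_d)%type (k, l).
  by apply: measurable_fun_pair; [exact: mx|exact: (measurableT_comp md mv)].
have mh k l : measurable_fun setT (fun t => seeded_hit (v t) (x t) k l).
  by apply: (measurableT_comp (measurable_flipped (l + J k))); exact: ms.
have mw : measurable_fun setT (fun t => within_budget (v t) (x t)).
  apply: measurable_forall => l.
  have mS : measurable_fun setT
      (fun t => \sum_(k < n) (if seeded_hit (v t) (x t) k l then 1 else 0 : R)).
    by apply: measurable_sum => k; have mk := mh k l; mfun.
  by mfun.
rewrite -[X in measurable X]setTI; exact: (measurable_and mw (mh i j)).
Qed.

End adversary.

(** * Confusion of the two regressors *)

Section lower_bound.
Variables (R : realType) (n d' : nat).
Local Notation d := d'.+1.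
Local Notation N := (std_normal R).
Local Notation I := (ridx n d).
Variables (J : {ffun 'I_n -> 'I_d}) (muA : probability R R).
Local Notation model := (rfamily (model_X J) (@model_noise R n d') (@model_seed R n d') (@model_coins R n d')).
Local Notation PG := (space_law n d' muA).

Section transfer.
Local Open Scope ereal_scope.
Context dO (Om : measurableType dO) (P : probability Om R).
Variables (ZX : 'I_n -> 'I_d -> Om -> R) (Zxi : 'I_n -> Om -> R) (U V : Om -> R).
Hypothesis hX : forall i j, has_distribution P (ZX i j) (normal_prob 0 1).
Hypothesis hxi : forall i, has_distribution P (Zxi i) (normal_prob 0 1).
Hypothesis hU : has_distribution P U muA.
Hypothesis hV : has_distribution P V (muV n d' muA).
Hypothesis ind : mutually_independent P (rfamily ZX Zxi U V).

Lemma family_measurable k : measurable_fun setT (rfamily ZX Zxi U V k).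
Proof.
case: k => [[[i j]|i]|[]] /=; [exact: (hX i j).1|exact: (hxi i).1|exact: hU.1|exact: hV.1].
Qed.

Lemma family_law (F : set (box_space R I)) : measurable F ->
  P [set t | F (fun k => rfamily ZX Zxi U V k t)] = PG [set g | F (fun k => model k g)].
Proof.
apply: box_law_unique.
- exact: family_measurable.
- exact: measurable_family.
move=> B mB; rewrite space_law_box//.
have -> : [set t | forall k, B k (rfamily ZX Zxi U V k t)] =
    \bigcap_(k in [set: I]) (rfamily ZX Zxi U V k @^-1` B k).
  by apply/seteqP; split => t /=; [move=> h i _; exact: h|move=> h i; exact: h].
rewrite ind// !big_sumType big_bool /=.
rewrite (hU.2 _ (mB _)) (hV.2 _ (mB _)) muleCA muleC.
congr (_ * _ * _).
rewrite big_split /= pair_bigA /=; congr (_ * _).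
  by apply: eq_bigr => -[i j] _; exact: (hX i j).2.
by apply: eq_bigr => i _; exact: (hxi i).2.
Qed.

End transfer.

Lemma model_X_negate i j (g : space R n d') : ~~ flipped (tnth g.1 i).1 (j + J i) ->
  model_X J i j (negate_space g) = model_X J i j g.
Proof. by rewrite /flipped /moved negbK /model_X /= tnth_map => /eqP. Qed.

Lemma sum_model_X i (g : space R n d') : \sum_j model_X J i j g = xsum (tnth g.1 i).1.
Proof. by rewrite /xsum [RHS](reindex_inj (addIr (J i))). Qed.

Lemma model_sample i (g : space R n d') :
  seeded_sample J (model_coins g) (fun i j => model_X J i j g) i = (tnth g.1 i).1.
Proof.
apply: eq_from_tnth => k; rewrite tnth_mktuple /model_coins decode_encode /coins /model_X subrK.
by rewrite /= !tnth_map; case: (tnth _ k).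
Qed.

Lemma model_hit i j (g : space R n d') :
  seeded_hit J (model_coins g) (fun i j => model_X J i j g) i j = flipped (tnth g.1 i).1 (j + J i).
Proof. by rewrite /seeded_hit model_sample. Qed.

Lemma model_budget eta (g : space R n d') :
  within_budget eta J (model_coins g) (fun i j => model_X J i j g) =
  [forall j, hits J j g <= eta * n%:R].
Proof. by apply: eq_forallb => j; under eq_bigr do rewrite model_hit. Qed.

Lemma hits_negate j (g : space R n d') : hits J j (negate_space g) = hits J j g.
Proof. by apply: eq_bigr => i _; rewrite /= tnth_map /= flipped_negate. Qed.

Section indistinguishable.
Variables (sigma b eta : R) (A : algorithm R n d) (c : R).
Local Notation Adv := (flip_adversary eta J).
Local Notation err := (error_event sigma b eta A Adv).

Lemma vnormN (v : 'I_d -> R) : vnorm (fun j => - v j) = vnorm v.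
Proof. by congr Num.sqrt; apply: eq_bigr => j _; rewrite sqrrN. Qed.

Lemma vnorm_sqr (v : 'I_d -> R) : vnorm v ^+ 2 = \sum_j v j ^+ 2.
Proof. by rewrite sqr_sqrtr// sumr_ge0// => j _; exact: sqr_ge0. Qed.

(** By the parallelogram identity the squared distances from [h] to [v] and to [- v] add up to at
    least twice the squared norm of [v]; this is the origin of the factor [1 / sqrt 2]. *)
Lemma far_from_opposites (h v : 'I_d -> R) :
  vnorm v / Num.sqrt 2 <= vnorm (fun j => h j - v j) \/
  vnorm v / Num.sqrt 2 <= vnorm (fun j => h j - - v j).
Proof.
have s2 : 0 < Num.sqrt (2 : R) by rewrite sqrtr_gt0.
have v0 w : 0 <= vnorm (w : 'I_d -> R) by exact: sqrtr_ge0.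
have [?|l1] := leP (vnorm v / Num.sqrt 2) (vnorm (fun j => h j - v j)); first by left.
have [?|l2] := leP (vnorm v / Num.sqrt 2) (vnorm (fun j => h j - - v j)); first by right.
exfalso.
have sq (w : 'I_d -> R) : vnorm w < vnorm v / Num.sqrt 2 -> \sum_j w j ^+ 2 < (\sum_j v j ^+ 2) / 2.
  move=> lt; rewrite -vnorm_sqr -vnorm_sqr -[X in _ / X](@sqr_sqrtr _ 2)// -expr_div_n.
  by rewrite ltr_pXn2r// nnegrE// divr_ge0// ltW.
have := sq _ l1; have := sq _ l2 => q2 q1.
have e : \sum_j (h j - v j) ^+ 2 + \sum_j (h j - - v j) ^+ 2 =
   2 * \sum_j h j ^+ 2 + 2 * \sum_j v j ^+ 2.
  rewrite -big_split /= !mulr_sumr -big_split /=; apply: eq_bigr => j _; ring.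
have h0 : 0 <= \sum_j h j ^+ 2 by apply: sumr_ge0 => j _; exact: sqr_ge0.
have h1 : 0 <= \sum_j v j ^+ 2 by apply: sumr_ge0 => j _; exact: sqr_ge0.
lra.
Qed.

(** Changing the signs of the regressor and of every sum keeps the labels, since the noise is
    untouched. The masks agree, and so do the entries that survive them; with the same seed the
    algorithm returns the same estimate in both situations. *)
Lemma error_either (g : space R n d') : (forall j, hits J j g <= eta * n%:R) ->
  err (fun=> c) (fun k => model k g) \/ err (fun=> - c) (fun k => model k (negate_space g)).
Proof.
move=> bg.
have wg : within_budget eta J (model_coins g) (fun i j => model_X J i j g).
  by rewrite model_budget; apply/forallP.
have wg' : within_budget eta J (model_coins (negate_space g)) (fun i j => model_X J i j (negate_space g)).
  by rewrite model_budget; apply/forallP => j; rewrite hits_negate.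
have ye i : \sum_j - c * model_X J i j (negate_space g) = \sum_j c * model_X J i j g.
  rewrite -!mulr_sumr !sum_model_X /= tnth_map /= xsum_negate; ring.
rewrite /error_event /= wg wg' /=.
set h := A _ _ _ _ _ _; set h' := A _ _ _ _ _ _.
have -> : h' = h.
  congr (A _ _ _ _ _ _).
  - apply/funext => i; apply/funext => j; rewrite !model_hit /= tnth_map /= flipped_negate.
    by case: (boolP (flipped _ _)) => // /model_X_negate ->.
  - apply/funext => i; rewrite ye; congr (Some (_ + _ * _)).
    by rewrite /model_noise /= tnth_map.
rewrite (vnormN (fun=> c)); exact: far_from_opposites.
Qed.

End indistinguishable.

Local Open Scope ereal_scope.

(** Outside the overflow event one of the two errors occurs, the second being read at
    [negate_space g]; as [negate_space] preserves the law, this costs nothing in probability. *)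
Lemma error_sum (sigma b eta : R) (A : algorithm R n d) (c : R) (x : R) :
  alg_measurable A ->
  PG [set g | exists j, (eta * n%:R < hits J j g)%R] <= x%:E ->
  (1 - x)%:E <=
  PG [set g | error_event sigma b eta A (flip_adversary eta J) (fun=> c) (fun k => model k g)] +
  PG [set g | error_event sigma b eta A (flip_adversary eta J) (fun=> - c)%R (fun k => model k g)].
Proof.
move=> mA le.
have mAdv := @flip_adversary_measurable R n d' eta J.
have mE e := @measurable_error_event R n d sigma b eta A _ (fun=> e) mA mAdv _ _ _
  (measurable_family J).
set E1 := [set g | _]; set E2 := [set g | _].
have mE1 : measurable E1 by exact: mE.
have mE2 : measurable E2 by exact: mE.
have mE2' : measurable (@negate_space R n d' @^-1` E2).
  by rewrite -[X in measurable X]setTI; exact: measurable_negate_space.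
set O := [set g | _] in le.
have mO : measurable O.
  have mh j : measurable_fun setT (fun g => hits J j g <= eta * n%:R)%R.
    exact: (measurable_fun_ler (measurable_hits J j) (measurable_cst (eta * n%:R)%R)).
  have mg := measurable_neg (measurable_forall mh).
  rewrite (_ : O = [set g | ~~ [forall j, hits J j g <= eta * n%:R]%R]); last first.
    apply/seteqP; split => g /=.
      by move=> [j jg]; apply/forallPn; exists j; rewrite -ltNge.
    by move=> /forallPn[j]; rewrite -ltNge => jg; exists j.
  by rewrite -[X in measurable X]setTI; exact: mg.
have cover : [set: space R n d'] `<=` O `|` (E1 `|` @negate_space R n d' @^-1` E2).
  move=> g _; have [h|h] := pselect (forall j, hits J j g <= eta * n%:R)%R.
    by right; exact: error_either.
  left; apply: contrapT => no; apply: h => j; rewrite leNgt; apply/negP => jg.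
  by apply: no; exists j.
have : 1 <= PG (O `|` (E1 `|` @negate_space R n d' @^-1` E2)).
  rewrite -(probability_setT PG); apply: le_measure => //; rewrite inE//.
  by apply: measurableU => //; exact: measurableU.
move=> /le_trans/(_ (measureU2 _ mO (measurableU _ _ mE1 mE2'))).
have le12 : PG (E1 `|` @negate_space R n d' @^-1` E2) <= PG E1 + PG E2.
  by rewrite -(space_law_negate muA mE2); exact: measureU2.
move=> le1.
rewrite EFinB leeBlDl//; apply: (le_trans le1); apply: leeD => //.
Qed.

End lower_bound.

Theorem theorem1 (R : realType) :
  exists kappa : R, 0 < kappa /\
  forall (d : nat) (sigma b eta : R),
    (0 < d)%N -> 0 <= sigma -> 0 <= b ->
    4 / Num.sqrt (d%:R) <= eta -> eta <= 1 ->
    forall (n : nat) (A : algorithm R n d) (muA : probability R R),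
      alg_measurable A ->
      exists beta : 'I_d -> R, vnorm beta = b /\
      exists (Adv : adversary R n d) (muV : probability R R),
        adv_budget eta Adv /\ adv_measurable Adv /\
        forall (dO : measure_display) (Om : measurableType dO)
               (P : probability Om R)
               (ZX : 'I_n -> 'I_d -> Om -> R) (Zxi : 'I_n -> Om -> R)
               (U V : Om -> R),
          (forall i j, has_distribution P (ZX i j) (normal_prob 0 1)) ->
          (forall i, has_distribution P (Zxi i) (normal_prob 0 1)) ->
          has_distribution P U muA ->
          has_distribution P V muV ->
          mutually_independent P (rfamily ZX Zxi U V) ->
          let X := fun t i j => ZX i j t in
          let y := fun t i => (\sum_(j < d) beta j * ZX i j t) + sigma * Zxi i t in
          let mask := fun t => Adv (V t) (X t) (y t) in
          let betahat := fun t =>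
            A (U t) eta sigma b
              (fun i j => maskv ((mask t).1 i j) (X t i j))
              (fun i => maskv ((mask t).2 i) (y t i)) in
          ((1 / 2 * (1 - d.+1%:R * expR (- (kappa * eta * n%:R))))%:E
            <= P [set t | (vnorm beta / Num.sqrt 2
                          <= vnorm (fun j => betahat t j - beta j))%R])%E.
Proof.
exists (1 / 100); split; first by lra.
move=> [//|d'] sigma b eta _ _ b0 eta4 eta1 n A muA mA.
have [J JP] := exists_sparse_shifts n eta4 eta1.
pose x : R := d'.+1%:R * expR (- (1 / 100 * eta * n%:R)).
rewrite -/x in JP.
have eta0 : 0 <= eta by apply: le_trans eta4; rewrite divr_ge0// sqrtr_ge0.
have mAdv := @flip_adversary_measurable R n d' eta J.
(* The regressor has all entries equal to [c], and both signs are candidates: the two error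
   probabilities add up to at least [1 - x], so one of them reaches the half. *)
suff [c cb cP] : exists2 c : R, c ^+ 2 * d'.+1%:R = b ^+ 2 &
    ((1 / 2 * (1 - x))%:E <= space_law n d' muA
      [set g | error_event sigma b eta A (flip_adversary eta J) (fun=> c)
         (fun k => rfamily (model_X J) (@model_noise R n d') (@model_seed R n d') (@model_coins R n d') k g)])%E.
  exists (fun=> c); split.
    by rewrite /vnorm sumr_const card_ord -mulr_natr cb sqrtr_sqr ger0_norm.
  exists (flip_adversary eta J), (muV n d' muA); split; first exact: flip_adversary_budget.
  split=> // dO Om P ZX Zxi U V hX hxi hU hV ind; cbv zeta.
  have mF := @measurable_error_event R n d'.+1 sigma b eta A _ (fun=> c) mA mAdv _
    (box_space R (ridx n d'.+1)) (fun k w => w k) (@measurable_box_coord R _).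
  have law := @family_law R n d' J muA _ Om P ZX Zxi U V hX hxi hU hV ind _ mF.
  apply: (le_trans _ (le_trans cP _)); last first.
    by rewrite le_eqVlt; apply/orP; left; apply/eqP; exact: (esym law).
  (* Only the [d] covariate columns contribute an overflow term; the factor is enlarged to
     [d + 1]. *)
  rewrite lee_fin ler_pM2l ?divr_gt0// lerD2l lerN2 /x.
  by rewrite ler_wpM2r ?expR_ge0// ler_nat.
pose c := b / Num.sqrt d'.+1%:R.
have cb : c ^+ 2 * d'.+1%:R = b ^+ 2.
  by rewrite /c expr_div_n sqr_sqrtr// divfK// pnatr_eq0.
have := error_sum sigma b c mA (JP muA).
set p1 := space_law _ _ _ _; set p2 := space_law _ _ _ _ => sum12.
have [h|h1] := leP (1 / 2 * (1 - x))%:E p1; first by exists c.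
have [h|h2] := leP (1 / 2 * (1 - x))%:E p2; first by exists (- c); rewrite ?sqrrN.
have := lteD h1 h2; rewrite -EFinD => lt.
have := le_lt_trans sum12 lt; rewrite lte_fin; lra.
Qed.
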